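(* Assume $5\le N\le12$. Let $u$ be a solution of $\Delta^2u=e^u$ in $\mathbb{R}^N$ such that $\overline v(\infty)=0$, where $v=-\Delta u$. Then $u$ is unstable outside every compact set, that is, there is no compact set $K\subset\mathbb{R}^N$ such that $$\int_{\Omega}e^u\varphi^2\,dx\le\int_{\Omega}|\Delta\varphi|^2\,dx\quad\text{for all }\varphi\in H^2(\Omega)\cap H^1_0(\Omega),\qquad \Omega=\mathbb{R}^N\setminus K.$$
   Context: Solutions are classical entire solutions. For $v=-\Delta u$, $\overline v(r)=\frac{1}{|\partial B_r|}\int_{\partial B_r}v\,d\sigma$ denotes the spherical average of $v$ over the sphere of radius $r$ centered at the origin. Since $-\Delta v=e^u>0$, $\overline v$ is a decreasing function of $r$, and $\overline v(\infty):=\lim_{r\to+\infty}\overline v(r)$. *)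

(* Defs.v *)
From HB Require Import structures.
From mathcomp Require Import all_boot all_order all_algebra.
From mathcomp Require Import all_classical all_reals all_analysis.
From mathcomp Require Import measurable_realfun.

Set Implicit Arguments.
Unset Strict Implicit.
Unset Printing Implicit Defensive.

Import Order.TTheory GRing.Theory Num.Theory.
Import numFieldNormedType.Exports.

Local Open Scope classical_set_scope.
Local Open Scope ring_scope.

Section measurable_rV.
Context {d : measure_display} {T : measurableType d} {n : nat}.

Let coors : 'I_n -> 'rV[T]_n -> T := fun i x => x ord0 i.

Let rV_set0 : g_sigma_preimage coors set0.
Proof. exact: sigma_algebra0. Qed.

Let rV_setC A : g_sigma_preimage coors A -> g_sigma_preimage coors (~` A).
Proof. exact: sigma_algebraC. Qed.

Let rV_bigcup (F : (set 'rV[T]_n)^nat) :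
  (forall i, g_sigma_preimage coors (F i)) ->
  g_sigma_preimage coors (\bigcup_i (F i)).
Proof. exact: sigma_algebra_bigcup. Qed.

(* Product sigma-algebra, as for tuples in the library; for R it coincides with
   the Borel sigma-algebra of 'rV[R]_n. *)
HB.instance Definition _ := @isMeasurable.Build (measure_tuple_display d)
  'rV[T]_n (g_sigma_preimage coors) rV_set0 rV_setC rV_bigcup.

Lemma measurable_coor (i : 'I_n) :
  measurable_fun [set: 'rV[T]_n] (fun x => x ord0 i).
Proof.
move=> _ Y mY; rewrite setTI; apply: sub_sigma_algebra => /=.
rewrite -bigcup_seq/=; exists i => /=; first by rewrite mem_index_enum.
by exists Y => //; rewrite setTI.
Qed.

Lemma measurable_fun_coorP d' (S : measurableType d') (f : S -> 'rV[T]_n) :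
  (forall i, measurable_fun [set: S] (fun s => f s ord0 i)) ->
  measurable_fun [set: S] f.
Proof.
move=> mf.
suff : g_sigma_preimage (fun i => coors i \o f) `<=` measurable.
  rewrite g_sigma_preimage_comp => prefS _ A mA.
  by apply: prefS; exists A.
apply: smallest_sub; first exact: sigma_algebra_measurable.
rewrite -bigcup_seq => A [i _ [B mB <-]].
exact: mf.
Qed.

End measurable_rV.

Section image_measure.
Context d d' (S : measurableType d) (T : measurableType d') (R : realType).
Context (mu : {measure set S -> \bar R}) (f : S -> T).

(* [pushforward] with the measurability proof kept as an argument, so that the
   measure structure can be inferred. *)
Definition image_measure (mf : measurable_fun [set: S] f) : set T -> \bar R :=
  pushforward mu f.

Hypothesis mf : measurable_fun [set: S] f.

Let mpre A : measurable A -> measurable (f @^-1` A).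
Proof. by move=> mA; rewrite -[X in measurable X]setTI; exact: mf. Qed.

Let image_measure0 : image_measure mf set0 = 0%E.
Proof. by rewrite /image_measure /pushforward preimage_set0 measure0. Qed.

Let image_measure_ge0 A : (0 <= image_measure mf A)%E.
Proof. by rewrite /image_measure /pushforward measure_ge0. Qed.

Let image_measure_sigma_additive : semi_sigma_additive (image_measure mf).
Proof.
move=> F mF tF mUF; rewrite /image_measure /pushforward preimage_bigcup.
apply: measure_semi_sigma_additive.
- by move=> i; exact: mpre.
- apply/trivIsetP => /= i j _ _ ij; rewrite -preimage_setI.
  by move/trivIsetP : tF => /(_ _ _ _ _ ij) ->//; rewrite preimage_set0.
- by rewrite -preimage_bigcup; exact: mpre.
Qed.

HB.instance Definition _ := isMeasure.Build _ _ _ (image_measure mf)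
  image_measure0 image_measure_ge0 image_measure_sigma_additive.

End image_measure.

Section lebesgue_rV.
Context {R : realType}.

Definition cons_rV n (xy : measurableTypeR R * 'rV[R]_n) : 'rV[R]_n.+1 :=
  row_mx (const_mx xy.1 : 'rV[R]_1) xy.2.

Definition uncons_rV n (x : 'rV[R]_n.+1) : measurableTypeR R * 'rV[R]_n :=
  (x ord0 ord0, \row_j x ord0 (lift ord0 j)).

Lemma cons_rVK n : cancel (@cons_rV n) (@uncons_rV n).
Proof.
move=> [x y]; rewrite /cons_rV /uncons_rV; congr pair.
  rewrite (_ : ord0 = lshift n (ord0 : 'I_1)) ?(@row_mxEl _ _ 1 n) ?mxE//.
  exact: val_inj.
apply/rowP => j; rewrite mxE (_ : lift ord0 j = rshift 1 j).
  by rewrite (@row_mxEr _ _ 1 n).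
exact: val_inj.
Qed.

Lemma measurable_cons_rV n : measurable_fun [set: _] (@cons_rV n).
Proof.
apply: measurable_fun_coorP => i; rewrite /cons_rV.
have [j ij|j ij] := split_ordP (i : 'I_(1 + n)).
  rewrite (_ : (fun _ => _) = fst)//.
  by apply/funext => xy; rewrite ij (@row_mxEl _ _ 1 n) mxE.
rewrite (_ : (fun _ => _) = (fun x : 'rV[R]_n => x ord0 j) \o snd).
  by apply: measurableT_comp => //; exact: measurable_coor.
by apply/funext => xy; rewrite ij (@row_mxEr _ _ 1 n).
Qed.

Lemma measurable_uncons_rV n : measurable_fun [set: _] (@uncons_rV n).
Proof.
apply/measurable_fun_pairP; split; first exact: measurable_coor.
apply: measurable_fun_coorP => i.
rewrite (_ : (fun _ => _) = fun x : 'rV[R]_n.+1 => x ord0 (lift ord0 i)).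
  exact: measurable_coor.
by apply/funext => x /=; rewrite mxE.
Qed.

(* Lebesgue measure on R^n is built by iterating the product with the Lebesgue
   measure of the line. *)
Section step.
Context (n : nat) (mu : {sigma_finite_measure set 'rV[R]_n -> \bar R}).

Let nu := image_measure (@lebesgue_measure R \x mu)%E (@measurable_cons_rV n).

Let nu_sigma_finite : sigma_finite setT nu.
Proof.
have /sigma_finiteP[F [TF ndF Foo]] := sigma_finiteT (@lebesgue_measure R).
have /sigma_finiteP[G [TG ndG Goo]] := sigma_finiteT mu.
exists (fun k => @uncons_rV n @^-1` (F k `*` G k)) => [|k].
  rewrite -preimage_bigcup (_ : \bigcup_k _ = setT) ?preimage_setT//.
  rewrite -setXTT TF TG predeqE => -[x y]; split => [[k _ []/= ? ?]|].
    by split; exists k.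
  move=> [/= [i _ Fix] [j _ Gjy]]; exists (maxn i j) => //; split.
  - by move: x Fix; exact/subsetPset/ndF/leq_maxl.
  - by move: y Gjy; exact/subsetPset/ndG/leq_maxr.
have [mF Fkoo] := Foo k; have [mG Gkoo] := Goo k; split.
  rewrite -[X in measurable X]setTI.
  by apply: measurable_uncons_rV => //; exact: measurableX.
rewrite /nu /image_measure /pushforward -comp_preimage.
rewrite (_ : _ \o _ = id); last by apply/funext => x; exact: cons_rVK.
rewrite preimage_id [ltLHS](product_measure1E (@lebesgue_measure R) mu mF mG).
by rewrite lte_mul_pinfty// ge0_fin_numE.
Qed.

HB.instance Definition _ := Measure.on nu.
HB.instance Definition _ := Measure_isSigmaFinite.Build _ _ _ nu
  nu_sigma_finite.

Definition lebesgue_rV_step : {sigma_finite_measure set 'rV[R]_n.+1 -> \bar R} :=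
  nu.

End step.

Fixpoint lebesgue_rV n : {sigma_finite_measure set 'rV[R]_n -> \bar R} :=
  if n is m.+1 then lebesgue_rV_step (lebesgue_rV m) else dirac (0 : 'rV[R]_0).

(* The norm carried by 'rV[R]_n in the library is the sup norm; this is the
   Euclidean one. *)
Definition enorm n (x : 'rV[R]_n) : R := Num.sqrt (\sum_i x ord0 i ^+ 2).

Definition eball n (r : R) : set 'rV[R]_n := [set x | enorm x < r].

Definition esphere n (r : R) : set 'rV[R]_n := [set x | enorm x = r].

Definition radial_proj n (r : R) (x : 'rV[R]_n) : 'rV[R]_n :=
  (r / enorm x) *: x.

Lemma measurable_enorm n : measurable_fun [set: _] (@enorm n).
Proof.
apply: (@measurableT_comp _ _ _ _ _ _ (@Num.sqrt R)).
  by apply: continuous_measurable_fun; exact: sqrt_continuous.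
apply: measurable_sum => i; apply: measurable_funX; exact: measurable_coor.
Qed.

Lemma measurable_eball n r : measurable (@eball n r).
Proof.
rewrite (_ : eball r = setT `&` @enorm n @^-1` `]-oo, r[).
  by apply: measurable_enorm => //; exact: measurable_itv.
by rewrite setTI; apply/seteqP; split=> x /=; rewrite in_itv.
Qed.

Lemma measurable_radial_proj n r : measurable_fun [set: _] (@radial_proj n r).
Proof.
apply: measurable_fun_coorP => i.
rewrite (_ : (fun _ => _) =
  (fun x : 'rV[R]_n => r * (enorm x `^ (-1)) * x ord0 i)).
  apply: measurable_funM; last exact: measurable_coor.
  apply: measurable_funM => //.
  apply: (@measurableT_comp _ _ _ _ _ _ (@powR R ^~ (-1))).
    exact: measurable_powR.
  exact: measurable_enorm.
by apply/funext => x; rewrite /radial_proj !mxE powR_inv1// sqrtr_ge0.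
Qed.

(* Surface measure of the sphere of radius r > 0, in its polar-coordinates
   form: sigma_r(A) = (n / r) |{x in B_r | r x / |x| in A}|, i.e. the cone over
   A with apex 0 and height r has volume (r / n) sigma_r(A). *)
Section sphere_measure.
Context (n : nat) (r : R).

Let restr := mrestr (lebesgue_rV n) (@measurable_eball n r).

Let nu := mscale `|n%:R / r|%:nng
  (image_measure restr (@measurable_radial_proj n r)).

Definition sphere_measure : {measure set 'rV[R]_n -> \bar R} := nu.

End sphere_measure.

Definition sphere_avg n (v : 'rV[R]_n -> R) (r : R) : R :=
  (fine (sphere_measure n r (esphere r)))^-1 *
  \int[sphere_measure n r]_(x in esphere r) v x.

End lebesgue_rV.

Section derivatives.
Context {R : realType} {n : nat}.
Implicit Types (f : 'rV[R]_n -> R) (s : seq 'I_n) (k : nat).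

(* A multi-index is the sequence of the directions of differentiation: the
   order |s| of the derivative is [size s]. *)
Definition pderiv s f : 'rV[R]_n -> R :=
  foldr (fun i g => 'D_(delta_mx ord0 i) g) f s.

(* Library derivatives are total functions, so the existence of the partial
   derivatives of order at most k has to be required explicitly. *)
Definition Ck k f : Prop := forall s, (size s <= k)%N ->
  continuous (pderiv s f) /\
  ((size s < k)%N ->
    forall i x, derivable (pderiv s f) x (delta_mx ord0 i)).

Definition laplacian f (x : 'rV[R]_n) : R := \sum_i pderiv [:: i; i] f x.

End derivatives.

Section sobolev.
Context {R : realType} {n : nat} (O : set 'rV[R]_n).
Implicit Types (f g psi phi : 'rV[R]_n -> R) (s : seq 'I_n) (k : nat).

Local Notation mu := (lebesgue_rV n).

(* C_c^oo(O) *)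
Definition test_function psi : Prop :=
  let supp := closure [set x | psi x != 0] in
  [/\ forall k, Ck k psi, compact supp & supp `<=` O].

(* Functions on O are represented by functions on the whole space, whose values
   outside O are irrelevant. *)
Definition L2 f : Prop :=
  measurable_fun O f /\ mu.-integrable O (fun x => (f x ^+ 2)%:E).

(* D^s f = g in the sense of distributions on O, used for f and g in L^2(O),
   for which both integrals below converge. *)
Definition weak_pderiv s f g : Prop := forall psi, test_function psi ->
  \int[mu]_(x in O) (f x * pderiv s psi x) =
  (-1) ^+ size s * \int[mu]_(x in O) (g x * psi x).

(* H^k(O) = W^(k,2)(O) *)
Definition sobolevH k f : Prop :=
  L2 f /\ forall s, (size s <= k)%N -> exists2 g, L2 g & weak_pderiv s f g.

(* A representative of the weak derivative D^s f in L^2(O), which is unique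
   almost everywhere in O; 0 if there is none. *)
Definition wderiv s f : 'rV[R]_n -> R :=
  xget (fun=> 0) [set g | L2 g /\ weak_pderiv s f g].

Definition wlaplacian f (x : 'rV[R]_n) : R := \sum_i wderiv [:: i; i] f x.

Definition H1_sqnorm f : \bar R :=
  (\int[mu]_(x in O) (f x ^+ 2)%:E +
   \sum_i \int[mu]_(x in O) (wderiv [:: i] f x ^+ 2)%:E)%E.

(* H^1_0(O), the closure of C_c^oo(O) in H^1(O) *)
Definition sobolevH10 phi : Prop :=
  sobolevH 1 phi /\
  forall e : R, 0 < e -> exists2 psi, test_function psi &
    (H1_sqnorm (phi \- psi)%R < e%:E)%E.

(* The left-hand side may be +oo: the integrals of these nonnegative functions
   are taken in [0, +oo]. *)
Definition stable_on (u : 'rV[R]_n -> R) : Prop :=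
  forall phi, sobolevH 2 phi -> sobolevH10 phi ->
    (\int[mu]_(x in O) (expR (u x) * phi x ^+ 2)%:E <=
     \int[mu]_(x in O) (`|wlaplacian phi x| ^+ 2)%:E)%E.

End sobolev.

(* Main.v *)
(* Put v = - Delta u, f = e^u and, for a function g, let B_m[g](l) be the integral
   of g(x) (l^2 - |x|^2)^m over the ball of radius l.  Green's formula gives
     U' = - (l/6) V,  V' = - (l/8) E,
   for U = l^-(N+4) B_2[u], V = l^-(N+6) B_3[v], E = l^-(N+8) B_4[f].  Let Q be
   the primitive of l^3 E vanishing at l = 1; it is the integral of f against a
   kernel at most of size |x|^-(N-4).

   If u is stable outside K, testing stability with |x|^(-(N-4)/2), cut off near K
   and beyond |x| = l, bounds the integral of f |x|^-(N-4) over |x| < l by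
   N^2 (N-4)^2 / 16 times the integral of |x|^-N, which grows like ln l; hence
   Q <= q ln l + C.  Since V tends to 0, integrating the two equations yields
   U >= C - (q/96) ln l.  By Jensen's inequality l^-(N+4) B_2[f], which the bound
   on Q makes O(l^-4 ln l), is at least a constant times exp (U / c), where
   c = l^-(N+4) B_2[1].  The two growth rates are incompatible exactly when
   N^2 (N - 4) < 128 (N - 2), that is, for 5 <= N <= 12. *)

Require Import Defs.
From HB Require Import structures.
From mathcomp Require Import all_boot all_order all_algebra.
From mathcomp Require Import all_classical all_reals all_analysis.
From mathcomp Require Import measurable_realfun.
From mathcomp Require Import ring lra zify.

Set Implicit Arguments.
Unset Strict Implicit.
Unset Printing Implicit Defensive.

Import Order.TTheory GRing.Theory Num.Theory.
Import numFieldNormedType.Exports.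

Local Open Scope classical_set_scope.
Local Open Scope ring_scope.


(** The powers of [l^2 - |x|^2], truncated at zero, stand in for spherical means: from exponent 3 on
    they are C^2 with compact support, so Green's formula on the whole space leaves no boundary term
    and every averaged quantity obeys a first-order equation in l. The integrals of [|x|^-N] and
    [f |x|^-(N-4)] are likewise compared with kernels whose derivative in l is explicit, so that ln
    l appears by differentiation. Polar coordinates enter once, to turn the hypothesis on spherical
    averages into the one-sided bound V <= e for large l. The constant 96 comes from solving the
    system with Q = q ln l: then E = q l^-4, V = (q/16) l^-2 and U' = -(q/96) / l. The other
    obstacle is the class of test functions. The power must be made smooth and compactly supported
    off K, with errors uniform in l; and since weak derivatives are chosen representatives, the
    fundamental lemma of the calculus of variations has to identify them almost everywhere with
    classical ones before stability can be tested on a smooth function. *)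

(** * Continuity and Borel sets on R^n *)

Section continuity_rV.
Context {R : realType}.

Lemma cvg_coorP (T : Type) (F : set_system T) {FF : Filter F} n
    (f : T -> 'rV[R]_n) (l : 'rV[R]_n) :
  (forall i, f t ord0 i @[t --> F] --> l ord0 i) -> f t @[t --> F] --> l.
Proof.
move=> cf A [P Pn sPA]; rewrite /nbhs/=.
have : F [set t | forall i, P ord0 i (f t ord0 i)].
  by apply: filter_forall => i; exact: (cf i _ (Pn ord0 i)).
by apply: filterS => t Pt; apply: sPA => i j; rewrite (ord1 i); exact: Pt.
Qed.

Lemma continuous_coorP (T : topologicalType) n (f : T -> 'rV[R]_n) :
  (forall i, continuous (fun t => f t ord0 i)) -> continuous f.
Proof. by move=> cf t; apply: cvg_coorP => i; exact: cf. Qed.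

(** Countably many cubes, of rational centre and half-side [1 / (k + 1)], suffice to cover an open
    set. The closed cube is kept inside [U] because it later serves as the compact set that carries
    test functions. *)
Lemma open_rat_cube n (U : set 'rV[R]_n) x : open U -> U x ->
  exists q : 'rV[rat]_n * nat,
    (forall i, `|ratr (q.1 ord0 i) - x ord0 i| < q.2.+1%:R^-1) /\
    forall y : 'rV[R]_n,
      (forall i, `|ratr (q.1 ord0 i) - y ord0 i| <= q.2.+1%:R^-1) -> U y.
Proof.
move=> oU Ux; have /nbhs_ballP[e /= e0 xeU] : nbhs x U by exact: open_nbhs_nbhs.
pose k := Num.truncn (2 / e).
have ke : k.+1%:R^-1 < e / 2.
  rewrite -[ltRHS]invrK ltf_pV2 ?posrE ?invr_gt0 ?divr_gt0//.
  by rewrite invf_div truncnS_gt.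
have k0 : 0 < k.+1%:R^-1 :> R by rewrite invr_gt0.
have xq i : exists q : rat, `|ratr q - x ord0 i| < k.+1%:R^-1.
  have /rat_in_itvoo[q] : x ord0 i < x ord0 i + k.+1%:R^-1 by rewrite ltrDl.
  rewrite in_itv/= => /andP[q1 q2]; exists q.
  by rewrite ger0_norm ?subr_ge0 ?(ltW q1)// ltrBlDl.
exists (\row_i projT1 (cid (xq i)), k); split=> [i|y qy] /=.
  by rewrite mxE; case: cid.
apply: xeU; split => // i j; rewrite (ord1 i) /ball/=.
have := qy j; rewrite /= mxE; case: cid => r /= xr ry.
rewrite (le_lt_trans (ler_distD (ratr r) _ _))// (splitr e) ltrD//.
  by rewrite distrC (lt_trans xr).
exact: le_lt_trans ke.
Qed.

Lemma measurable_openrV n (U : set 'rV[R]_n) : open U -> measurable U.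
Proof.
move=> oU.
pose B (q : 'rV[rat]_n * nat) : set 'rV[R]_n :=
  \bigcap_(i in [set: 'I_n])
    [set x | `|ratr (q.1 ord0 i) - x ord0 i| < q.2.+1%:R^-1].
have mB q : measurable (B q).
  apply: fin_bigcap_measurable => // i _.
  rewrite -[X in measurable X]setTI.
  exact: (measurable_coor i measurableT (measurable_ball (ratr (q.1 ord0 i) : R) _)).
rewrite (_ : U = \bigcup_(q in [set: 'rV[rat]_n * nat])
    (if `[< B q `<=` U >] then B q else set0)); last first.
  apply/seteqP; split=> [x Ux|x [q _]]; last by case: asboolP => // + Bq; exact.
  have [q [qx qU]] := open_rat_cube oU Ux.
  exists q => //; case: asboolP => [_ i _ /=|[]]; first exact: qx.
  by move=> y By; apply: qU => i; exact: ltW (By i I).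
apply: countable_bigcupT_measurable => [|q]; first exact: countableP.
by case: asboolP.
Qed.

Lemma continuous_measurable_rV n (f : 'rV[R]_n -> R) :
  continuous f -> measurable_fun [set: 'rV[R]_n] f.
Proof.
move=> /continuousP cf; apply: (measurability _ (RGenOpens.measurableE R)).
move=> _ [_ [a [b ->] <-]]; rewrite setTI; apply: measurable_openrV.
by apply: cf; exact: interval_open.
Qed.

End continuity_rV.

Lemma cvg_sumr {R : numFieldType} (V : normedModType R) (T : Type)
    (F : set_system T) {FF : Filter F} (I : Type) (r : seq I)
    (f : I -> T -> V) (l : I -> V) :
  (forall i, f i t @[t --> F] --> l i) ->
  \sum_(i <- r) f i t @[t --> F] --> \sum_(i <- r) l i.
Proof.
move=> fl; elim: r => [|i r IH].
  by rewrite big_nil; under eq_cvg do rewrite big_nil; exact: cvg_cst.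
by rewrite big_cons; under eq_cvg do rewrite big_cons; exact: cvgD.
Qed.

(** * The squared Euclidean norm *)

Section sqn.
Context {R : realType} {n : nat}.
Implicit Types x : 'rV[R]_n.

(** Radial functions are written in the variable [|x|^2], a polynomial in the coordinates, hence
    smooth at the origin, unlike [enorm]. *)
Definition sqn x : R := \sum_i x ord0 i ^+ 2.

Lemma sqn_ge0 x : 0 <= sqn x.
Proof. by apply: sumr_ge0 => i _; exact: sqr_ge0. Qed.

Lemma coor_sqn x i : x ord0 i ^+ 2 <= sqn x.
Proof.
rewrite /sqn (bigD1 i)//= lerDl; apply: sumr_ge0 => j _; exact: sqr_ge0.
Qed.

Lemma continuous_sqn : continuous (@sqn : 'rV[R]_n -> R).
Proof.
move=> x; apply: (@cvg_sumr _ _ _ (nbhs x)) => i.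
apply: (@continuous_comp _ _ _ (fun x : 'rV[R]_n => x ord0 i) (fun t : R => t ^+ 2)).
  exact: coord_continuous.
exact: exprn_continuous.
Qed.

Lemma sqnZ (a : R) x : sqn (a *: x) = a ^+ 2 * sqn x.
Proof. by rewrite /sqn mulr_sumr; apply: eq_bigr => i _; rewrite mxE exprMn. Qed.

Lemma enormE x : enorm x = Num.sqrt (sqn x). Proof. by []. Qed.

Lemma enorm_ge0 x : 0 <= enorm x. Proof. exact: sqrtr_ge0. Qed.

Lemma sqr_enorm x : enorm x ^+ 2 = sqn x.
Proof. by rewrite sqr_sqrtr// sqn_ge0. Qed.

End sqn.

(** * Lebesgue measure on R^n as an iterated integral *)

Section lebesgue_rV_step.
Context {R : realType}.
Local Notation mu := (@lebesgue_measure R).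
Local Open Scope ereal_scope.

Lemma lebesgue_rVS n (A : set 'rV[R]_n.+1) :
  lebesgue_rV n.+1 A = (mu \x lebesgue_rV n) (@cons_rV R n @^-1` A).
Proof. by []. Qed.

Lemma measurable_fun_cons n (f : 'rV[R]_n.+1 -> \bar R) :
  measurable_fun setT f -> measurable_fun setT (f \o @cons_rV R n).
Proof. by move=> mf; apply: measurableT_comp => //; exact: measurable_cons_rV. Qed.

Lemma ge0_integral_rVS n (f : 'rV[R]_n.+1 -> \bar R) :
  measurable_fun setT f -> (forall x, 0 <= f x) ->
  \int[lebesgue_rV n.+1]_x f x =
  \int[mu]_x \int[lebesgue_rV n]_y f (cons_rV (x, y)).
Proof.
move=> mf f0; transitivity (\int[mu \x lebesgue_rV n]_z (f \o @cons_rV R n) z).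
  have := @ge0_integral_pushforward _ _ _ _ _ _ (@measurable_cons_rV R n)
    (mu \x lebesgue_rV n) setT f measurableT mf (fun x _ => f0 x).
  by rewrite preimage_setT => <-.
by rewrite fubini_tonelli1//; [exact: measurable_fun_cons|move=> z; exact: f0].
Qed.

Lemma integrable_rVS n (f : 'rV[R]_n.+1 -> \bar R) :
  (lebesgue_rV n.+1).-integrable setT f ->
  (mu \x lebesgue_rV n).-integrable setT (f \o @cons_rV R n).
Proof.
move=> /integrableP[mf foo]; apply/integrableP; split.
  exact: measurable_fun_cons.
have -> : \int[mu \x lebesgue_rV n]_x `|(f \o @cons_rV R n) x| =
          \int[lebesgue_rV n.+1]_x `|f x|; last by [].
have := @ge0_integral_pushforward _ _ _ _ _ _ (@measurable_cons_rV R n)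
  (mu \x lebesgue_rV n) setT (abse \o f) measurableT.
rewrite preimage_setT => <-//; first exact: measurableT_comp.
by move=> y _; exact: abse_ge0.
Qed.

Lemma integral_rVS n (f : 'rV[R]_n.+1 -> \bar R) :
  (lebesgue_rV n.+1).-integrable setT f ->
  \int[lebesgue_rV n.+1]_x f x =
  \int[mu \x lebesgue_rV n]_z (f \o @cons_rV R n) z.
Proof.
move=> fi; have /integrableP[mf _] := fi.
have := @integral_pushforward _ _ _ _ _ _ (@measurable_cons_rV R n)
  (mu \x lebesgue_rV n) setT f mf.
rewrite preimage_setT => <- //; exact: integrable_rVS.
Qed.

Lemma cons_rV0 n (xy : measurableTypeR R * 'rV[R]_n) :
  cons_rV xy ord0 ord0 = xy.1.
Proof. by have /(congr1 fst) := cons_rVK xy. Qed.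

Lemma cons_rVS n (xy : measurableTypeR R * 'rV[R]_n) i :
  cons_rV xy ord0 (lift ord0 i) = xy.2 ord0 i.
Proof.
have /(congr1 (fun z : measurableTypeR R * 'rV[R]_n => z.2 ord0 i)) := cons_rVK xy.
by rewrite mxE.
Qed.

Lemma measurable_rV_box n (M : R) :
  measurable [set x : 'rV[R]_n | forall i, (`|x ord0 i| <= M)%R].
Proof.
rewrite (_ : [set _ | _] = \bigcap_(i in [set: 'I_n])
  [set x : 'rV[R]_n | `|x ord0 i| <= M]%R); last first.
  by apply/seteqP; split=> [x xM i _|x xM i]; [exact: xM|exact: (xM i I)].
apply: fin_bigcap_measurable => // i _.
rewrite -[X in measurable X]setTI.
rewrite (_ : [set _ | _] = (fun x : 'rV[R]_n => x ord0 i) @^-1` [set` `[(-M)%R, M]]).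
  by apply: (measurable_coor i) => //; exact: measurable_itv.
by apply/seteqP; split=> x /=; rewrite in_itv/= ler_norml.
Qed.

Lemma lebesgue_rV_box n (M : R) :
  lebesgue_rV n [set x | forall i, (`|x ord0 i| <= M)%R] < +oo.
Proof.
elim: n => [|n IH].
  by rewrite (le_lt_trans (probability_le1 _ _))// ?ltry//; exact: measurable_rV_box.
pose A : set (measurableTypeR R) := [set` `[(-M)%R, M]].
pose B : set 'rV[R]_n := [set x | forall i, (`|x ord0 i| <= M)%R].
have E : @cons_rV R n @^-1` [set x | forall i, (`|x ord0 i| <= M)%R] = A `*` B.
  apply/seteqP; split=> -[a y]; rewrite /A /B /=.
    move=> h; split.
      by have := h ord0; rewrite cons_rV0 in_itv/= ler_norml.
    by move=> i; have := h (lift ord0 i); rewrite cons_rVS.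
  rewrite in_itv/= -ler_norml => -[ha hy] i.
  by case: (unliftP ord0 i) => [j ->|->]; rewrite ?cons_rVS ?cons_rV0.
rewrite lebesgue_rVS E [ltLHS](product_measure1E mu (lebesgue_rV n))//=.
- apply: lte_mul_pinfty => //.
  by rewrite [X in X \is a fin_num]lebesgue_measure_itv/=; case: ifP.
- exact: measurable_itv.
- exact: measurable_rV_box.
Qed.

End lebesgue_rV_step.

(** * Directional derivatives *)

Section line_derivative.
Context {R : realType}.

(** A directional derivative only sees the values along one line; this transfers derivatives between
    R^(n+1), its coordinate slices and R. *)
Lemma is_derive_along (V V' W : normedModType R) (f : V -> W) (g : V' -> W)
    (x v : V) (y w : V') (l : W) :
  (forall h : R, f (h *: v + x) = g (h *: w + y)) ->
  is_derive x v f l -> is_derive y w g l.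
Proof.
move=> fg [df fl].
have E : (fun h : R => h^-1 *: (f (h *: v + x) - f x)) =
         (fun h : R => h^-1 *: (g (h *: w + y) - g y)).
  apply/funext => h; rewrite fg; congr (_ *: (_ - _)).
  by have := fg 0; rewrite !scale0r !add0r.
split; first by rewrite /derivable -E.
by rewrite /derive -E.
Qed.

Lemma is_derive_unique (V W : normedModType R) (f : V -> W) x v l m :
  is_derive x v f l -> is_derive x v f m -> l = m.
Proof. by move=> [_ <-] [_ <-]. Qed.

End line_derivative.

Section continuous_operations.
Context {R : realType} {T : topologicalType}.
Implicit Types f g : T -> R.

Lemma contD f g : continuous f -> continuous g -> continuous (fun x => f x + g x).
Proof. by move=> cf cg x; apply: cvgD; [exact: cf|exact: cg]. Qed.

Lemma contM f g : continuous f -> continuous g -> continuous (fun x => f x * g x).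
Proof. by move=> cf cg x; apply: cvgM; [exact: cf|exact: cg]. Qed.

Lemma contN f : continuous f -> continuous (fun x => - f x).
Proof. by move=> cf x; apply: cvgN; exact: cf. Qed.

Lemma contB f g : continuous f -> continuous g -> continuous (fun x => f x - g x).
Proof. by move=> cf cg; apply: contD => //; exact: contN. Qed.

Lemma cont_cst (a : R) : continuous (fun _ : T => a).
Proof. by move=> x; exact: cvg_cst. Qed.

Lemma contZ (a : R) f : continuous f -> continuous (fun x => a * f x).
Proof. by apply: contM; exact: cont_cst. Qed.

Lemma cont_sum (I : Type) (r : seq I) (F : I -> T -> R) :
  (forall i, continuous (F i)) -> continuous (fun x => \sum_(i <- r) F i x).
Proof. by move=> cF x; apply: cvg_sumr => i; exact: cF. Qed.

Lemma cont_comp (g : R -> R) f :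
  continuous g -> continuous f -> continuous (fun x => g (f x)).
Proof.
by move=> cg cf x; apply: (@continuous_comp _ _ _ f g); [exact: cf|exact: cg].
Qed.

End continuous_operations.

(** * Continuous functions of bounded support *)

Section compactly_supported.
Context {R : realType} {n : nat}.
Implicit Types f g : 'rV[R]_n -> R.
Local Notation mu := (@lebesgue_rV R n).

Definition bounded_supp f := exists M : R, forall x, M <= sqn x -> f x = 0.

Definition Cc f := continuous f /\ bounded_supp f.

Lemma CcMl f g : continuous f -> Cc g -> Cc (fun x => f x * g x).
Proof.
move=> cf [cg [M gM]]; split; first exact: contM.
by exists M => x Mx; rewrite gM ?mulr0.
Qed.

Lemma CcD f g : Cc f -> Cc g -> Cc (fun x => f x + g x).
Proof.
move=> [cf [M fM]] [cg [L gL]]; split.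
  exact: contD.
exists (Num.max M L) => x; rewrite ge_max => /andP[? ?].
by rewrite fM ?gL ?addr0.
Qed.

Lemma CcZ (a : R) f : Cc f -> Cc (fun x => a * f x).
Proof. by apply: CcMl; exact: cont_cst. Qed.

Lemma Cc_sum (I : Type) (r : seq I) (F : I -> 'rV[R]_n -> R) :
  (forall i, Cc (F i)) -> Cc (fun x => \sum_(i <- r) F i x).
Proof.
move=> cF; elim: r => [|i r IH].
  under eq_fun do rewrite big_nil.
  by split; [exact: cont_cst|exists 0].
by under eq_fun do rewrite big_cons; exact: CcD.
Qed.

Lemma compact_rV_box (M : R) :
  compact [set x : 'rV[R]_n | forall i, `|x ord0 i| <= M].
Proof.
have := @rV_compact R n (fun=> `[-M, M]%classic) (fun=> @segment_compact R (- M) M).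
by congr compact; apply/seteqP; split=> x xM i; have := xM i;
  rewrite /= in_itv/= ler_norml.
Qed.

Lemma Cc_integrable f : Cc f -> mu.-integrable setT (EFin \o f).
Proof.
move=> [cf [M fM]].
(* The square of the half-side [1 + |M|] is at least [M], so the box contains the support without
   taking a square root. *)
pose D := [set x : 'rV[R]_n | forall i, `|x ord0 i| <= 1 + `|M|].
have mD : measurable D by exact: measurable_rV_box.
have -> : EFin \o f = (EFin \o f) \_ D.
  apply/funext => x; rewrite patchE; case: ifPn => //= /negP xD.
  rewrite fM//; have /existsNP[i /negP xi] : ~ D x by move/mem_set.
  rewrite leNgt; apply/negP => xM; apply: xD; rewrite inE => j.
  rewrite -ler_sqr ?nnegrE// ?addr_ge0// real_normK ?num_real//.
  rewrite (le_trans (coor_sqn x j))// (le_trans (ltW xM))//.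
  rewrite (le_trans (ler_norm _))// sqrrD expr1n mul1r.
  by rewrite (@le_trans _ _ (`|M| *+ 2)) ?ler_wpMn2l// ?mulr2n ?lerDl//
    addrAC lerDr addr_ge0// sqr_ge0.
have [+ _] := @integrable_mkcond _ _ R mu D (EFin \o f) mD; apply.
apply: measurable_bounded_integrable => //.
- exact: lebesgue_rV_box.
- by apply: measurable_funTS; exact: continuous_measurable_rV.
- have /compact_bounded[L [_ Lf]] := @continuous_compact _ _ _ _
    (continuous_subspaceT cf) (@compact_rV_box (1 + `|M|)).
  by exists L; split; rewrite ?num_real// => a La x Dx; apply: (Lf a La); exists x.
Qed.

Lemma Cc_derive f (i : 'I_n) (f' : 'rV[R]_n -> R) :
  bounded_supp f -> (forall x, is_derive x (delta_mx ord0 i) f (f' x)) ->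
  bounded_supp f'.
Proof.
(* Past [M + 1] the function vanishes in a whole neighbourhood of the point, and so does its
   derivative. *)
move=> [M fM] df; exists (M + 1) => x Mx.
apply: (is_derive_unique (df x)).
apply: (@near_eq_is_derive _ _ _ (cst 0)).
have : \forall y \near x, M < sqn y.
  apply: (cvgr_gt (sqn x) (@continuous_sqn R n x)).
  by rewrite (lt_le_trans _ Mx)// ltrDl.
by apply: filterS => y /ltW/fM ->.
Qed.

End compactly_supported.

(** * The integral of a partial derivative of a compactly supported function *)

Section integral_partial_derivative.
Context {R : realType}.
Local Notation mu := (@lebesgue_measure R).

Lemma is_derive_cons0 n (g : 'rV[R]_n.+1 -> R) x (y : 'rV[R]_n) l :
  is_derive (cons_rV (x, y)) (delta_mx ord0 ord0 : 'rV[R]_n.+1) g l ->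
  is_derive (x : R) 1 (fun t : R => g (cons_rV (t, y))) l.
Proof.
apply: is_derive_along => h; congr g; apply/rowP => j.
case: (unliftP ord0 j) => [k ->|->].
  by rewrite cons_rVS mxE cons_rVS 2!mxE/= mulr0 add0r.
by rewrite cons_rV0 mxE cons_rV0 2!mxE/=.
Qed.

Lemma is_derive_consS n (g : 'rV[R]_n.+1 -> R) x (y : 'rV[R]_n) i l :
  is_derive (cons_rV (x, y)) (delta_mx ord0 (lift ord0 i) : 'rV[R]_n.+1) g l ->
  is_derive y (delta_mx ord0 i : 'rV[R]_n) (fun z => g (cons_rV (x, z))) l.
Proof.
apply: is_derive_along => h; congr g; apply/rowP => j.
case: (unliftP ord0 j) => [k ->|->].
  by rewrite cons_rVS mxE cons_rVS 2!mxE/= (inj_eq lift_inj) !mxE.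
by rewrite cons_rV0 mxE cons_rV0 2!mxE/= mulr0 add0r.
Qed.

Lemma continuous_cons0 n (y : 'rV[R]_n) :
  continuous (fun t : R => cons_rV (t, y) : 'rV[R]_n.+1).
Proof.
apply: continuous_coorP => j; case: (unliftP ord0 j) => [k ->|->].
  by under eq_fun do rewrite cons_rVS; exact: cst_continuous.
by under eq_fun do rewrite cons_rV0; move=> ?; exact: cvg_id.
Qed.

Lemma continuous_consS n (t : R) :
  continuous (fun y : 'rV[R]_n => cons_rV (t, y) : 'rV[R]_n.+1).
Proof.
apply: continuous_coorP => j; case: (unliftP ord0 j) => [k ->|->].
  by under eq_fun do rewrite cons_rVS; exact: coord_continuous.
by under eq_fun do rewrite cons_rV0; exact: cst_continuous.
Qed.

Lemma sqn_cons n (t : R) (y : 'rV[R]_n) :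
  sqn (cons_rV (t, y)) = t ^+ 2 + sqn y.
Proof.
rewrite /sqn big_ord_recl cons_rV0; congr (_ + _).
by apply: eq_bigr => i _; rewrite cons_rVS.
Qed.

Lemma integral_derive_bounded_supp (h h' : R -> R) (M : R) :
  (forall x, M <= `|x| -> h x = 0) -> continuous h' ->
  (forall x : R, is_derive x 1 h (h' x)) ->
  (\int[mu]_x (h' x)%:E = 0)%E.
Proof.
move=> hM ch' dh; pose L := 1 + `|M|.
have L0 : 0 < L by rewrite ltr_pwDl.
have ML : M < L by rewrite (le_lt_trans (ler_norm _))// ltrDr.
have h'L x : L < `|x| -> h' x = 0.
  move=> Lx; apply: (is_derive_unique (dh x)).
  apply: (@near_eq_is_derive _ _ _ (cst 0)).
  have : \forall y \near x, L < `|y|.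
    exact: (cvgr_gt `|x| (@norm_continuous _ R^o x)).
  by apply: filterS => y Ly; rewrite hM// (le_trans (ltW ML))// ltW.
rewrite (_ : (fun _ => _) = (EFin \o h') \_ [set` `[-L, L]]); last first.
  apply/funext => x; rewrite patchE; case: ifPn => //= /negP xL.
  rewrite h'L// ltNge; apply/negP => xL'; apply: xL.
  by rewrite inE/= in_itv/= -ler_norml.
rewrite -integral_mkcond.
have /(_ h) -> := @continuous_FTC2 R h' _ (-L) L.
- by rewrite !hM ?subee ?normrN ?(ger0_norm (ltW L0)) ?ltW.
- by rewrite (lt_trans _ L0)// oppr_lt0.
- exact: continuous_subspaceT.
- have ch : continuous h.
    by move=> x; apply/differentiable_continuous/derivable1_diffP; case: (dh x).
  split; first by move=> x _; case: (dh x).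
  - exact/cvg_at_right_filter/ch.
  - exact/cvg_at_left_filter/ch.
- by move=> x _; rewrite derive1E; case: (dh x).
Qed.

(** Induction on the dimension through Fubini, the order of integration being dictated by the
    direction: the remaining coordinates are integrated first when [i] is one of them, and the first
    coordinate when [i] is that one, where the fundamental theorem of calculus applies. *)
Lemma integral_pderiv0 n (i : 'I_n) (g g' : 'rV[R]_n -> R) :
  Cc g -> continuous g' ->
  (forall x, is_derive x (delta_mx ord0 i) g (g' x)) ->
  (\int[lebesgue_rV n]_x (g' x)%:E = 0)%E.
Proof.
elim: n => [|n IH] in i g g' *; first by case: i.
move=> [cg bg] cg' dg.
have Ccg' : Cc g' by split => //; exact: Cc_derive dg.
have ig' := Cc_integrable Ccg'.
have jg' := integrable_rVS ig'.
rewrite integral_rVS//.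
have [M gM] := bg.
case: (unliftP ord0 i) dg => [j ->|->] dg.
  rewrite -(integral12_prod_meas1 jg').
  apply: integral0_eq => x _; rewrite /fubini_F.
  apply: (IH j (fun y => g (cons_rV (x, y)))).
  - split; first by move=> y; apply: continuous_comp;[exact: continuous_consS|exact: cg].
    exists M => y My; rewrite gM// sqn_cons.
    by rewrite (le_trans My)// lerDr sqr_ge0.
  - by move=> y; apply: continuous_comp; [exact: continuous_consS|exact: cg'].
  - by move=> y; exact: is_derive_consS (dg _).
rewrite -(integral21_prod_meas1 jg').
apply: integral0_eq => y _; rewrite /fubini_G.
apply: (@integral_derive_bounded_supp (fun t => g (cons_rV (t, y))) _ (1 + `|M|)).
- move=> t tM; apply: gM; rewrite sqn_cons.
  rewrite (le_trans (ler_norm M))// (@le_trans _ _ (t ^+ 2)) ?lerDl ?sqn_ge0//.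
  rewrite -[leRHS]real_normK ?num_real// expr2.
  rewrite (@le_trans _ _ (1 * `|t|))//.
    by rewrite mul1r (le_trans _ tM)// lerDr.
  by rewrite ler_wpM2r// (le_trans _ tM)// lerDl.
- by move=> t; apply: continuous_comp; [exact: continuous_cons0|exact: cg'].
- by move=> t; exact: is_derive_cons0 (dg _).
Qed.

End integral_partial_derivative.

(** * Integration by parts and Green's formula *)

Section Rintegral_rV.
Context {R : realType} {n : nat}.
Implicit Types f g : 'rV[R]_n -> R.

Definition Int f : R := \int[@lebesgue_rV R n]_x f x.

Lemma EFin_Int f : Cc f -> (Int f)%:E = (\int[@lebesgue_rV R n]_x (f x)%:E)%E.
Proof.
move=> cf; rewrite /Int /Rintegral fineK//.
by apply: integrable_fin_num => //; exact: Cc_integrable.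
Qed.

Lemma IntD f g : Cc f -> Cc g -> Int (fun x => f x + g x) = Int f + Int g.
Proof. by move=> cf cg; apply: RintegralD => //; exact: Cc_integrable. Qed.

Lemma IntB f g : Cc f -> Cc g -> Int (fun x => f x - g x) = Int f - Int g.
Proof. by move=> cf cg; apply: RintegralB => //; exact: Cc_integrable. Qed.

Lemma IntZ (a : R) f : Cc f -> Int (fun x => a * f x) = a * Int f.
Proof. by move=> cf; apply: RintegralZl => //; exact: Cc_integrable. Qed.

Lemma IntN f : Cc f -> Int (fun x => - f x) = - Int f.
Proof.
by move=> cf; rewrite -mulN1r -IntZ//; congr Int; apply/funext => x; rewrite mulN1r.
Qed.

Lemma le_Int f g : Cc f -> Cc g -> (forall x, f x <= g x) -> Int f <= Int g.
Proof. by move=> cf cg fg; apply: le_Rintegral => //; exact: Cc_integrable. Qed.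

Lemma Int_ge0 f : (forall x, 0 <= f x) -> 0 <= Int f.
Proof. by move=> f0; apply: Rintegral_ge0. Qed.

Lemma Int0 : Int (fun=> 0) = 0.
Proof. by rewrite /Int /Rintegral integral0. Qed.

Lemma Int_sum (I : Type) (r : seq I) (F : I -> 'rV[R]_n -> R) :
  (forall i, Cc (F i)) ->
  Int (fun x => \sum_(i <- r) F i x) = \sum_(i <- r) Int (F i).
Proof.
move=> cF; elim: r => [|i r IH].
  by under eq_fun do rewrite big_nil; rewrite big_nil Int0.
under eq_fun do rewrite big_cons.
by rewrite big_cons IntD ?IH//; exact: Cc_sum.
Qed.

Lemma Int_pderiv0 (i : 'I_n) g g' : Cc g -> continuous g' ->
  (forall x, is_derive x (delta_mx ord0 i) g (g' x)) -> Int g' = 0.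
Proof.
by move=> cg cg' dg; rewrite /Int /Rintegral (@integral_pderiv0 _ _ i g g').
Qed.

Lemma is_deriveM_fun (V : normedModType R) (f g : V -> R) x v (df dg : R) :
  is_derive x v f df -> is_derive x v g dg ->
  is_derive x v (fun y => f y * g y) (df * g x + f x * dg).
Proof.
move=> fx gx; have := @is_deriveM _ _ f g x v df dg fx gx.
by move=> h; apply: (is_derive_eq h); rewrite addrC /GRing.scale/= [g x * _]mulrC.
Qed.

Lemma Int_by_parts (i : 'I_n) f f' g g' :
  continuous f -> continuous f' -> Cc g -> continuous g' ->
  (forall x, is_derive x (delta_mx ord0 i) f (f' x)) ->
  (forall x, is_derive x (delta_mx ord0 i) g (g' x)) ->
  Int (fun x => f x * g' x) = - Int (fun x => f' x * g x).
Proof.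
move=> cf cf' cg cg' df dg.
have Cg' : Cc g' by split=> //; apply: (Cc_derive cg.2 dg).
apply/eqP; rewrite -addr_eq0 -IntD; [|exact: CcMl..]; apply/eqP.
apply: (@Int_pderiv0 i (fun x => f x * g x)); first exact: CcMl.
  by apply: contD; apply: contM => //; case: cg.
by move=> x; rewrite addrC; exact: is_deriveM_fun.
Qed.

(** The derivatives are data, which keeps explicit formulas at hand instead of the total operator
    ['D_v]; only the pure second derivatives are recorded, as the Laplacian involves no others. *)
Definition C2of f (df d2f : 'I_n -> 'rV[R]_n -> R) :=
  [/\ continuous f, forall i, continuous (df i), forall i, continuous (d2f i),
      forall i x, is_derive x (delta_mx ord0 i) f (df i x) &
      forall i x, is_derive x (delta_mx ord0 i) (df i) (d2f i x)].

Lemma Green f df d2f g dg d2g :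
  C2of f df d2f -> C2of g dg d2g -> bounded_supp g ->
  Int (fun x => (\sum_i d2f i x) * g x) = Int (fun x => f x * (\sum_i d2g i x)).
Proof.
move=> [cf cdf cd2f f1 f2] [cg cdg cd2g g1 g2] bg.
have Cg : Cc g by [].
have Cdg i : Cc (dg i) by split=> //; exact: (Cc_derive bg (g1 i)).
have Cd2g i : Cc (d2g i) by split=> //; exact: (Cc_derive (Cdg i).2 (g2 i)).
rewrite [LHS](_ : _ = Int (fun x => \sum_i d2f i x * g x)); last first.
  by congr Int; apply/funext => x; rewrite mulr_suml.
rewrite [RHS](_ : _ = Int (fun x => \sum_i f x * d2g i x)); last first.
  by congr Int; apply/funext => x; rewrite mulr_sumr.
rewrite !Int_sum; [|by move=> i; exact: CcMl..].
apply: eq_bigr => i _.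
rewrite (@Int_by_parts i f (df i) (dg i))//.
by rewrite (@Int_by_parts i (df i) (d2f i) g (dg i))// opprK.
Qed.

End Rintegral_rV.

(** * Radial functions and their Laplacian *)

Section radial.
Context {R : realType} {n : nat}.

Lemma is_derive_line (V : normedModType R) (f : V -> R) x v l :
  is_derive x v f l <-> is_derive (0 : R) 1 (fun h : R => f (h *: v + x)) l.
Proof.
have E (h : R) : f (h *: v + x) = (fun h : R => f (h *: v + x)) (h *: 1 + 0).
  by rewrite addr0 [h *: 1]mulr1.
split; apply: is_derive_along => h; first exact: E.
by rewrite -E.
Qed.

Lemma is_derive_chain (V : normedModType R) (G : R -> R) (f : V -> R) x v l m :
  is_derive (f x) 1 G m -> is_derive x v f l ->
  is_derive x v (fun y => G (f y)) (m * l).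
Proof.
move=> dG /is_derive_line df; apply/is_derive_line.
apply: (@is_derive1_comp _ G (fun h : R => f (h *: v + x))) => //.
by rewrite scale0r add0r.
Qed.

Lemma is_derive_line_eq (V : normedModType R) (f : V -> R) (F : R -> R) x v l :
  (forall h, f (h *: v + x) = F h) -> is_derive (0 : R) 1 F l ->
  is_derive x v f l.
Proof. by move=> fF dF; apply/is_derive_line; under eq_fun do rewrite fF. Qed.

Lemma is_derive_coor (i j : 'I_n) (x : 'rV[R]_n) :
  is_derive x (delta_mx ord0 i) (fun y : 'rV[R]_n => y ord0 j) (i == j)%:R.
Proof.
have d : is_derive (0 : R) 1 (fun h : R => h * (i == j)%:R + x ord0 j) (i == j)%:R.
  by apply: is_derive_eq; rewrite /GRing.scale/=; ring.
apply: is_derive_line_eq d => h.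
by rewrite 3!mxE eqxx andTb (eq_sym i j).
Qed.

Lemma is_derive_sqn (i : 'I_n) (x : 'rV[R]_n) :
  is_derive x (delta_mx ord0 i) (@sqn R n) (2 * x ord0 i).
Proof.
have d : is_derive (0 : R) 1 (fun h : R => h * h + 2 * x ord0 i * h + sqn x)
    (2 * x ord0 i).
  by apply: is_derive_eq; rewrite /GRing.scale/=; ring.
apply: is_derive_line_eq d => h.
rewrite /sqn [in LHS](bigD1 i)//= [in RHS](bigD1 i)//= !mxE !eqxx mulr1 addrA.
rewrite (eq_bigr (fun j => x ord0 j ^+ 2)); first by congr (_ + _); ring.
by move=> j ji; rewrite !mxE/= (negbTE ji) mulr0 add0r.
Qed.

Lemma C2of_radial (G G1 G2 : R -> R) :
  continuous G -> continuous G1 -> continuous G2 ->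
  (forall s : R, is_derive s 1 G (G1 s)) ->
  (forall s : R, is_derive s 1 G1 (G2 s)) ->
  C2of (fun x : 'rV[R]_n => G (sqn x)) (fun i x => G1 (sqn x) * (2 * x ord0 i))
   (fun i x => G2 (sqn x) * (2 * x ord0 i) * (2 * x ord0 i) + G1 (sqn x) * 2).
Proof.
move=> cG cG1 cG2 dG dG1.
have cc i : continuous (fun x : 'rV[R]_n => 2 * x ord0 i).
  by apply: contZ; exact: coord_continuous.
have cs (H : R -> R) : continuous H -> continuous (fun x : 'rV[R]_n => H (sqn x)).
  by move=> cH; apply: cont_comp => //; exact: continuous_sqn.
split.
- exact: cs.
- by move=> i; apply: contM => //; exact: cs.
- move=> i; apply: contD; first by apply: contM => //; apply: contM => //; exact: cs.
  by apply: contM; [exact: cs|exact: cont_cst].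
- by move=> i x; apply: is_derive_chain => //; exact: is_derive_sqn.
- move=> i x; apply: is_deriveM_fun.
    by apply: is_derive_chain => //; exact: is_derive_sqn.
  have := @is_deriveM_fun _ _ (cst 2) (fun y : 'rV[R]_n => y ord0 i) x _ _ _
     (is_derive_cst _ _ _) (is_derive_coor i i x).
  by move=> h; apply: (is_derive_eq h); rewrite mul0r add0r eqxx mulr1.
Qed.

(** With [a] and [b] the values of G'' and G' at [|x|^2], this is the Laplacian of [G(|x|^2)]; in
    this variable no singular term [(n - 1) / r] occurs. *)
Lemma radial_laplacian (a b : R) (x : 'rV[R]_n) :
  \sum_(i < n) (a * (2 * x ord0 i) * (2 * x ord0 i) + b * 2) =
  4 * sqn x * a + 2 * n%:R * b.
Proof.
rewrite big_split/= sumr_const card_ord; congr (_ + _); last first.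
  by rewrite mulr_natr mulr_natl; rewrite -mulr_natr; ring.
by rewrite /sqn mulr_sumr mulr_suml; apply: eq_bigr => i _; ring.
Qed.

End radial.

(** * Differentiation of an integral with respect to a parameter of its kernel *)

Section kernel_derivative.
Context {R : realType} {n : nat}.

Lemma continuous_max0 : continuous (Num.max 0 : R -> R).
Proof.
rewrite (_ : Num.max 0 = fun t : R => (t + `|t|) / 2); last first.
  apply/funext => t; case: (leP 0 t) => t0.
    by rewrite ger0_norm//; lra.
  by rewrite ltr0_norm//; lra.
move=> t; apply: cvgM; last exact: cvg_cst.
by apply: cvgD; [exact: cvg_id|exact: (@norm_continuous _ R^o)].
Qed.

Lemma is_derive_supp (F F' : R -> R) (u v l : R) :
  u < l < v -> (forall t, u < t < v -> F t = 0) -> is_derive l 1 F (F' l) ->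
  F' l = 0.
Proof.
move=> /andP[ul lv] F0 dF; apply: (is_derive_unique dF).
apply: (@near_eq_is_derive _ _ _ (cst 0)).
near=> t; rewrite F0//; apply/andP; split; near: t.
  exact: lt_nbhsr.
exact: lt_nbhsl.
Unshelve. all: by end_near. Qed.

(** Differentiation under the integral sign by domination: the common bound [M] on the supports
    makes the l-derivative vanish for [|x|^2 >= M], and [C] bounds it elsewhere. *)
Lemma derive_Int_kernel (f : 'rV[R]_n -> R) (k k' : R -> R -> R) (a u v M C : R) :
  continuous f -> u < a < v ->
  (forall l, u < l < v -> continuous (k l)) ->
  (forall l s, u < l < v -> M <= s -> k l s = 0) ->
  (forall l s, u < l < v -> 0 <= s -> is_derive l 1 (k ^~ s) (k' l s)) ->
  (forall l s, u < l < v -> 0 <= s -> `|k' l s| <= C) ->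
  is_derive a 1 (fun l => Int (fun x : 'rV[R]_n => f x * k l (sqn x)))
                (Int (fun x => f x * k' a (sqn x))).
Proof.
move=> cf uav ck k0 dk k'C.
have C0 : 0 <= C by apply: le_trans (k'C a 0 uav (lexx _)).
have Ck l : u < l < v -> Cc (fun x : 'rV[R]_n => f x * k l (sqn x)).
  move=> ul; apply: CcMl => //; split.
    by apply: cont_comp; [exact: ck|exact: continuous_sqn].
  by exists M => x Mx; exact: k0.
(* A continuous compactly supported majorant: the truncated factor is at least 1 as long as
   [|x|^2 <= M]. *)
pose G x : R := `|f x| * (C * Num.max 0 (M + 1 - sqn x)).
have CG : Cc G.
  apply: CcMl; first by apply: cont_comp cf; exact: norm_continuous.
  split.
    apply: contZ; apply: cont_comp; first exact: continuous_max0.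
    by apply: contB; [exact: cont_cst|exact: continuous_sqn].
  by exists (M + 1) => x Mx; rewrite max_l ?mulr0// subr_le0.
have d1 l x : u < l < v ->
    is_derive l 1 (fun l => f x * k l (sqn x)) (f x * k' l (sqn x)).
  move=> ul; have h := is_deriveM_fun (is_derive_cst (f x) l 1)
    (dk l (sqn x) ul (sqn_ge0 x)).
  by apply: (is_derive_eq h); rewrite mul0r add0r.
have G0 x : 0 <= G x by rewrite mulr_ge0// mulr_ge0// le_max lexx.
pose F := fun l x => f x * k l (sqn x).
have E x l : u < l < v -> partial1of2 F l x = f x * k' l (sqn x).
  by move=> ul; rewrite partial1of2E; case: (d1 l x ul).
have ia : `]u, v[%classic a by rewrite /= in_itv/=.
have h1 : forall x, `]u, v[%classic x ->
    (@lebesgue_rV R n).-integrable setT (EFin \o F x).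
  by move=> l; rewrite /= in_itv/= => /Ck/Cc_integrable.
have h2 : forall x y, `]u, v[%classic x -> setT y -> derivable (F ^~ y) x 1.
  by move=> l x; rewrite /= in_itv/= => ul _; case: (d1 l x ul).
have h3 : forall x y, `]u, v[%classic x -> setT y -> `|partial1of2 F x y| <= G y.
  move=> l x; rewrite /= in_itv/= => ul _; rewrite E// normrM ler_wpM2l//.
  have [Mx|xM] := leP M (sqn x).
    have -> : k' l (sqn x) = 0.
      apply: (@is_derive_supp (k ^~ (sqn x)) (k' ^~ (sqn x)) u v l) => //.
        by move=> t ut; exact: k0.
      by apply: dk => //; exact: sqn_ge0.
    by rewrite normr0 mulr_ge0// le_max lexx.
  rewrite (le_trans (k'C _ _ ul (sqn_ge0 x)))// -[leLHS]mulr1 ler_wpM2l//.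
  by rewrite le_max; apply/orP; right; rewrite addrAC lerDr subr_ge0 ltW.
have der := @derivable_under_integral R _ _ (@lebesgue_rV R n) F setT measurableT
  a u v ia h1 h2 G G0 (Cc_integrable CG) h3.
have val := @differentiation_under_integral R _ _ (@lebesgue_rV R n) F setT
  measurableT a u v ia h1 h2 G G0 (Cc_integrable CG) h3.
split; first exact: der.
rewrite -derive1E val /Int; apply: eq_Rintegral => x _.
exact: E.
Qed.

(* At [t = 0] the two one-sided derivatives agree because [g 0 = 0]. *)
Lemma is_derive_pos (G g : R -> R) (t : R) :
  (0 <= t -> is_derive t 1 G (g t)) -> g 0 = 0 ->
  is_derive t 1 (fun t => G (Num.max 0 t)) (g (Num.max 0 t)).
Proof.
move=> dG g0.
have [t0|t0|t0] := ltgtP t 0.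
- rewrite g0.
  apply: (@near_eq_is_derive _ _ _ (cst (G 0))).
  have : \forall y \near t, y < 0 by exact: lt_nbhsl.
  by apply: filterS => y y0 /=; rewrite max_l// ltW.
- apply: (@near_eq_is_derive _ _ _ G); last exact: dG (ltW t0).
  have : \forall y \near t, 0 < y by exact: lt_nbhsr.
  by apply: filterS => y y0 /=; rewrite max_r// ltW.
rewrite t0 in dG *; rewrite g0.
have [cG vG] := dG (lexx _).
pose Gp := fun t : R => G (Num.max 0 t).
have lim0 : h^-1 *: (Gp (h *: (1 : R) + 0) - Gp 0) @[h --> (0 : R)^'] --> (0 : R).
  have : h^-1 *: (G (h *: (1 : R) + 0) - G 0) @[h --> (0 : R)^'] --> (0 : R).
    suff : h^-1 *: (G (h *: (1 : R) + 0) - G 0) @[h --> (0 : R)^'] --> 'D_1 G 0.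
      by rewrite vG g0.
    exact: cG.
  move=> /cvgr0_norm_lt H; apply/cvgr0Pnorm_lt => e e0.
  have := H e e0; apply: filterS => h.
  rewrite /Gp maxxx addr0 [h *: 1]mulr1 => he.
  case: (leP 0 h) => h0; first exact: he.
  by rewrite subrr scaler0 normr0.
split; first by apply/cvg_ex; exists 0.
exact/cvg_lim.
Qed.

End kernel_derivative.

Section calculus.
Context {R : realType}.
Implicit Types (V : normedModType R).

Lemma is_deriveD_fun V (f g : V -> R) x v (df dg : R) :
  is_derive x v f df -> is_derive x v g dg ->
  is_derive x v (fun y => f y + g y) (df + dg).
Proof. by move=> fx gx; exact: (@is_deriveD _ _ _ f g x v df dg). Qed.

Lemma is_deriveN_fun V (f : V -> R) x v (df : R) :
  is_derive x v f df -> is_derive x v (fun y => - f y) (- df).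
Proof. by move=> fx; exact: (@is_deriveN _ _ _ f x v df). Qed.

Lemma is_deriveB_fun V (f g : V -> R) x v (df dg : R) :
  is_derive x v f df -> is_derive x v g dg ->
  is_derive x v (fun y => f y - g y) (df - dg).
Proof. by move=> fx gx; exact: (@is_deriveB _ _ _ f g x v df dg). Qed.

Lemma is_deriveZ_fun V (a : R) (f : V -> R) x v (df : R) :
  is_derive x v f df -> is_derive x v (fun y => a * f y) (a * df).
Proof.
move=> fx; have h := is_deriveM_fun (@is_derive_cst _ _ R a x v) fx.
by apply: (is_derive_eq h); rewrite mul0r add0r.
Qed.

Lemma is_deriveV_fun V (f : V -> R) x v (df : R) :
  f x != 0 -> is_derive x v f df ->
  is_derive x v (fun y => (f y)^-1) (- (f x) ^- 2 * df).
Proof.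
by move=> f0 [dfx <-]; split; [exact: derivableV|rewrite deriveV].
Qed.

Lemma is_derive_exprn m (t : R) : is_derive t 1 (fun t => t ^+ m) (m%:R * t ^+ m.-1).
Proof.
split; first exact: exprn_derivable.
by rewrite exp_derive [LHS]mulr1.
Qed.

Lemma is_derive_exprVn m (l : R) : 0 < l ->
  is_derive l 1 (fun l => l ^- m) (- m%:R * l ^- m.+1).
Proof.
move=> l0; have lm0 k : l ^+ k != 0 by rewrite expf_neq0// gt_eqF.
have h := @is_deriveV_fun _ (fun l : R => l ^+ m) l 1 _ (lm0 m) (is_derive_exprn m l).
apply: (is_derive_eq h); case: m {h} => [|m]; first by rewrite !mul0r mulr0 oppr0 mul0r.
rewrite -pred_Sn !exprS; have := lm0 m; move: (l ^+ m) => w w0.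
by field; rewrite w0 gt_eqF.
Qed.

End calculus.

(** * Ball averages with weights [(l^2 - |x|^2)^m] *)

Section bump_kernels.
Context {R : realType} {n : nat}.
Implicit Types (f : 'rV[R]_n -> R) (l s : R).

Definition bump m l s : R := Num.max 0 (l ^+ 2 - s) ^+ m.

Lemma bump_ge0 m l s : 0 <= bump m l s.
Proof. by rewrite exprn_ge0// le_max lexx. Qed.

Lemma bump_eq0 m l s : l ^+ 2 <= s -> bump m.+1 l s = 0.
Proof. by move=> ls; rewrite /bump max_l ?subr_le0// expr0n. Qed.

Lemma bumpE m l s : s <= l ^+ 2 -> bump m l s = (l ^+ 2 - s) ^+ m.
Proof. by move=> ls; rewrite /bump max_r ?subr_ge0. Qed.

(** This absorbs the factor [|x|^2] that the radial Laplacian puts in front of the second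
    derivative, so that moments of [f] reappear. *)
Lemma mul_bump m l s : s * bump m.+1 l s = l ^+ 2 * bump m.+1 l s - bump m.+2 l s.
Proof.
have [ls|sl] := leP (l ^+ 2) s; first by rewrite !bump_eq0// !mulr0 subr0.
by rewrite !bumpE ?(ltW sl)// (exprS _ m.+1); move: (_ ^+ m.+1) => P; ring.
Qed.

Lemma continuous_bump m l : continuous (bump m l).
Proof.
apply: (@cont_comp _ _ (fun t : R => t ^+ m)); first exact: exprn_continuous.
apply: cont_comp; first exact: continuous_max0.
by apply: contB; [exact: cont_cst|move=> ?; exact: cvg_id].
Qed.

Lemma is_derive_pos_pow m (t : R) :
  is_derive t 1 (fun t => Num.max 0 t ^+ m.+2) (m.+2%:R * Num.max 0 t ^+ m.+1).
Proof.
apply: (@is_derive_pos _ (fun t => t ^+ m.+2) (fun t => m.+2%:R * t ^+ m.+1)).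
  by move=> _; exact: is_derive_exprn.
by rewrite expr0n mulr0.
Qed.

Lemma is_derive_bump_l m l s :
  is_derive l 1 (fun l => bump m.+2 l s) (2 * m.+2%:R * l * bump m.+1 l s).
Proof.
have d : is_derive l 1 (fun l : R => l ^+ 2 - s) (2 * l).
  by apply: is_derive_eq; rewrite /GRing.scale/=; ring.
have h := @is_derive_chain _ _ (fun t => Num.max 0 t ^+ m.+2)
  (fun l : R => l ^+ 2 - s) l 1 _ _ (@is_derive_pos_pow m (l ^+ 2 - s)) d.
by apply: (is_derive_eq h); rewrite /bump; ring.
Qed.

Lemma is_derive_bump_s m l s :
  is_derive s 1 (bump m.+2 l) (- (m.+2%:R * bump m.+1 l s)).
Proof.
have d : is_derive s 1 (fun s : R => l ^+ 2 - s) (-1).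
  by apply: is_derive_eq; rewrite /GRing.scale/=; ring.
have h := @is_derive_chain _ _ (fun t => Num.max 0 t ^+ m.+2)
  (fun s : R => l ^+ 2 - s) s 1 _ _ (@is_derive_pos_pow m (l ^+ 2 - s)) d.
by apply: (is_derive_eq h); rewrite /bump; ring.
Qed.

Lemma Cc_bump m l : Cc (fun x : 'rV[R]_n => bump m.+1 l (sqn x)).
Proof.
split; last by exists (l ^+ 2) => x; exact: bump_eq0.
by apply: cont_comp; [exact: continuous_bump|exact: continuous_sqn].
Qed.

(** This is the [B_m[f](l)] of the overview, taken over the whole space with a truncated weight. *)
Definition ball_moment m f l := Int (fun x => f x * bump m l (sqn x)).

Lemma is_derive_ball_moment m f l : continuous f ->
  is_derive l 1 (ball_moment m.+2 f) (2 * m.+2%:R * l * ball_moment m.+1 f l).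
Proof.
move=> cf.
pose L := `|l| + 1.
have lL t : l - 1 < t < l + 1 -> `|t| <= L.
  move=> /andP[t1 t2]; rewrite /L ler_norml; have := ler_norm l; have := ler_norm (- l).
  by rewrite normrN; lra.
have h := @derive_Int_kernel R n f (bump m.+2) (fun l s => 2 * m.+2%:R * l * bump m.+1 l s)
  l (l - 1) (l + 1) (L ^+ 2) (2 * m.+2%:R * L * (L ^+ 2) ^+ m.+1) cf.
have Ll t : l - 1 < t < l + 1 -> t ^+ 2 <= L ^+ 2.
  by move=> /lL tL; rewrite -[t ^+ 2]real_normK ?num_real// lerXn2r ?nnegrE// addr_ge0.
apply: (is_derive_eq (h _ _ _ _ _)).
- by apply/andP; split; [rewrite gtrBl|rewrite ltrDl].
- by move=> t _; exact: continuous_bump.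
- by move=> t s /Ll tL Ls; rewrite bump_eq0// (le_trans tL).
- by move=> t s _ _; exact: is_derive_bump_l.
- move=> t s tl s0; rewrite normrM (ger0_norm (bump_ge0 _ _ _)) normrM.
  rewrite (@ger0_norm _ (2 * m.+2%:R)) ?mulr_ge0//.
  apply: ler_pM; rewrite ?mulr_ge0 ?bump_ge0//.
    by rewrite ler_wpM2l ?mulr_ge0// lL.
  rewrite lerXn2r ?nnegrE ?le_max ?lexx ?sqr_ge0// ge_max sqr_ge0/=.
  by rewrite (le_trans _ (Ll t tl))// lerBlDr lerDl.
- rewrite /ball_moment -IntZ; last by apply: CcMl => //; exact: Cc_bump.
  by congr Int; apply/funext => x; ring.
Qed.

Lemma C2of_bump m l :
  C2of (fun x : 'rV[R]_n => bump m.+3 l (sqn x))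
   (fun i x => - (m.+3%:R * bump m.+2 l (sqn x)) * (2 * x ord0 i))
   (fun i x => m.+3%:R * m.+2%:R * bump m.+1 l (sqn x) * (2 * x ord0 i) * (2 * x ord0 i) +
        - (m.+3%:R * bump m.+2 l (sqn x)) * 2).
Proof.
apply: (@C2of_radial R n (bump m.+3 l) (fun s => - (m.+3%:R * bump m.+2 l s))
  (fun s => m.+3%:R * m.+2%:R * bump m.+1 l s)).
- exact: continuous_bump.
- by apply: contN; apply: contZ; exact: continuous_bump.
- by apply: contZ; exact: continuous_bump.
- exact: is_derive_bump_s.
- move=> s; have h := @is_deriveM_fun _ _ (cst (- m.+3%:R)) (bump m.+2 l) s _ _ _
    (is_derive_cst _ _ _) (is_derive_bump_s m l s).
  rewrite (_ : (fun s => _) = (fun s => cst (- m.+3%:R) s * bump m.+2 l s)); last first.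
    by apply/funext => t /=; rewrite mulNr.
  by apply: (is_derive_eq h) => /=; ring.
Qed.

(** Green's formula moves the Laplacian onto the weight. The exponent [m + 3] makes the truncated
    weight C^2 across the sphere [|x| = l], its second derivatives involving the powers [m + 1] and
    [m + 2]. *)
Lemma ball_moment_laplacian m f df d2f l : C2of f df d2f ->
  ball_moment m.+3 (fun x => \sum_i d2f i x) l =
  4 * m.+3%:R * m.+2%:R * (l ^+ 2 * ball_moment m.+1 f l - ball_moment m.+2 f l)
  - 2 * m.+3%:R * n%:R * ball_moment m.+2 f l.
Proof.
move=> Cf; have [cf _ _ _ _] := Cf.
rewrite /ball_moment (Green Cf (C2of_bump m l)); last first.
  by exists (l ^+ 2) => x; exact: bump_eq0.
have C1 k (a : R) : Cc (fun x => a * (f x * bump k.+1 l (sqn x))).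
  by apply: CcZ; apply: CcMl => //; exact: Cc_bump.
have C2 k : Cc (fun x => f x * bump k.+1 l (sqn x)).
  by apply: CcMl => //; exact: Cc_bump.
rewrite [LHS](_ : _ = Int (fun x =>
   4 * m.+3%:R * m.+2%:R * l ^+ 2 * (f x * bump m.+1 l (sqn x)) -
   (4 * m.+3%:R * m.+2%:R + 2 * m.+3%:R * n%:R) * (f x * bump m.+2 l (sqn x)))); last first.
  congr Int; apply/funext => x; rewrite radial_laplacian.
  rewrite (_ : 4 * _ * _ = 4 * m.+3%:R * m.+2%:R * (sqn x * bump m.+1 l (sqn x))).
    by rewrite mul_bump; ring.
  by ring.
by rewrite IntB// !IntZ//; ring.
Qed.

(* Darboux-type identity: the radial average of [f] against the weight
   (1 - |x|^2/l^2)^(m+2) satisfies a first-order equation in l. *)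
Lemma is_derive_ball_avg m f df d2f l : C2of f df d2f -> 0 < l ->
  is_derive l 1 (fun l => l ^- (n + 2 * m.+2) * ball_moment m.+2 f l)
   (l / (2 * m.+3%:R) * (l ^- (n + 2 * m.+3) *
     ball_moment m.+3 (fun x => \sum_i d2f i x) l)).
Proof.
move=> Cf l0; have [cf _ _ _ _] := Cf.
have h := is_deriveM_fun (is_derive_exprVn (n + 2 * m.+2) l0) (is_derive_ball_moment m l cf).
apply: (is_derive_eq h); rewrite (ball_moment_laplacian _ _ Cf).
have -> : (n + 2 * m.+3 = (n + 2 * m.+2).+2)%N by lia.
have lm0 : l ^+ (n + 2 * m.+2) != 0 by rewrite expf_neq0// gt_eqF.
rewrite natrD natrM !exprS; move: (l ^+ _) lm0 => w w0.
have l1 : l != 0 by rewrite gt_eqF.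
have m3 : m.+3%:R != 0 :> R by rewrite pnatr_eq0.
move: (ball_moment _ _ _) => X; move: (ball_moment _ _ _) => Y.
by field; rewrite w0 l1 -natrD pnatr_eq0.
Qed.

End bump_kernels.

(** * Primitives of the weights in the variable l *)

Section tail_kernels.
Context {R : realType}.
Implicit Types (r : R -> R) (l s t : R).

(* [tail p r t s] is the integral of l^-(p+1+2m) (l^2 - s)^m over l > t when
   p r(z) + 2 z r'(z) = (1 - z)^m. *)
Definition tail p r t s : R := t ^- p * r (s * t ^- 2).

(** The integral of the same weight over l from [max 1 (sqrt s)] to [max l (sqrt s)]: the truncated
    weight vanishes before [sqrt s], and the lower limit 1 keeps the kernel bounded near [s = 0].
    For [l >= 1] it is the primitive that vanishes at [l = 1]. *)
Definition kern p r l s : R :=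
  tail p r (Num.max 1 (Num.sqrt s)) s - tail p r (Num.max l (Num.sqrt s)) s.

Lemma is_derive_tail p m r r1 t s :
  (forall z : R, is_derive z 1 r (r1 z)) ->
  (forall z, p%:R * r z + 2 * z * r1 z = (1 - z) ^+ m) ->
  0 < t -> is_derive t 1 (fun t => tail p r t s) (- (t ^- p.+1 * (1 - s * t ^- 2) ^+ m)).
Proof.
move=> dr pr t0; have t1 : t != 0 by rewrite gt_eqF.
have d1 : is_derive t 1 (fun t : R => s * t ^- 2) (s * (- 2 * t ^- 3)).
  by apply: is_deriveZ_fun; exact: is_derive_exprVn.
have h := is_deriveM_fun (is_derive_exprVn p t0) (is_derive_chain (dr _) d1).
apply: (is_derive_eq h); rewrite -pr.
have tp0 : t ^+ p != 0 by rewrite expf_neq0.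
rewrite !exprS !expr0 mulr1; move: (t ^+ p) tp0 => w w0.
move: (r _) (r1 _) => a b.
by field; rewrite w0 t1.
Qed.

Lemma sqrt_le_abs l s : 0 <= l -> 0 <= s -> (Num.sqrt s <= l) = (s <= l ^+ 2).
Proof.
by move=> l0 s0; rewrite -[in RHS](sqr_sqrtr s0) ler_sqr ?nnegrE ?sqrtr_ge0.
Qed.

(** Writing [max l q = q + max 0 (l - q)] with [q = sqrt s] reduces the truncation to
    [is_derive_pos], which applies because a positive power of [l^2 - s] vanishes at [l = q]. *)
Lemma is_derive_kern p m r r1 l s :
  (forall z : R, is_derive z 1 r (r1 z)) ->
  (forall z, p%:R * r z + 2 * z * r1 z = (1 - z) ^+ m.+1) ->
  0 < l -> 0 <= s ->
  is_derive l 1 (fun l => kern p r l s) (l ^- (p.+1 + 2 * m.+1) * bump m.+1 l s).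
Proof.
move=> dr pr l0 s0; set q := Num.sqrt s.
have q0 : 0 <= q by exact: sqrtr_ge0.
pose G t := tail p r (q + t) s.
pose g t : R := - ((q + t) ^- p.+1 * (1 - s * (q + t) ^- 2) ^+ m.+1).
have dG : 0 <= l - q -> is_derive (l - q) 1 G (g (l - q)).
  move=> lq.
  have d1 : is_derive (l - q) 1 (fun t : R => q + t) 1.
    have := is_deriveD_fun (@is_derive_cst _ _ R q (l - q) 1) (is_derive_id (l - q) 1).
    by rewrite add0r.
  have e : q + (l - q) = l by ring.
  have dt : is_derive (q + (l - q)) 1 (fun t => tail p r t s) (g (l - q)).
    by apply: is_derive_tail => //; rewrite e.
  by have h := is_derive_chain dt d1; apply: (is_derive_eq h); rewrite mulr1.
have g0 : g 0 = 0.
  (* For [q = 0] the value is zero by the convention [0^-1 = 0]; for [q > 0] the factor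
     [1 - s / q^2] vanishes. *)
  rewrite /g addr0; have [q00|q00] := eqVneq q 0.
    by rewrite q00 exprS mul0r invr0 mul0r oppr0.
  rewrite -[s](sqr_sqrtr s0) -/q mulfV ?expf_neq0// subrr.
  by rewrite expr0n mulr0 oppr0.
have d2 : is_derive l 1 (fun t : R => t - q) 1.
  have := is_deriveB_fun (is_derive_id l 1) (@is_derive_cst _ _ R q l 1).
  by rewrite subr0.
have h := @is_derive_chain _ _ _ (fun t : R => t - q) l 1 _ _ (is_derive_pos dG g0) d2.
have h' := is_deriveB_fun (@is_derive_cst _ _ R (tail p r (Num.max 1 q) s) l 1) h.
rewrite (_ : (fun l => _) = (fun l => cst (tail p r (Num.max 1 q) s) l - G (Num.max 0 (l - q)))); last first.
  apply/funext => t /=; rewrite /kern -/q /G; congr (_ - tail p r _ s).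
  by rewrite addr_maxr addr0 addrC subrK maxC.
apply: (is_derive_eq h'); rewrite sub0r mulr1.
have [lq|ql] := leP (l - q) 0.
  rewrite g0 oppr0 bump_eq0 ?mulr0//.
  rewrite -[leRHS](sqr_sqrtr s0) ler_sqr ?nnegrE ?(ltW l0)//.
  by rewrite -/q -subr_le0.
rewrite /g opprK bumpE; last by rewrite -sqrt_le_abs// ?(ltW l0)// -/q ltW// -subr_gt0.
have -> : q + (l - q) = l by ring.
have l1 : l != 0 by rewrite gt_eqF.
have -> : l ^+ 2 - s = l ^+ 2 * (1 - s * l ^- 2) by field.
have -> : l ^- (p.+1 + 2 * m.+1) = l ^- p.+1 * l ^- (2 * m.+1).
  by rewrite exprD invfM.
rewrite exprMn -exprM -[RHS]mulrA; congr (_ * _).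
by rewrite mulrA mulVf ?mul1r// expf_neq0.
Qed.

Lemma kern_eq0 p r l s : 1 <= l -> l ^+ 2 <= s -> kern p r l s = 0.
Proof.
move=> l1 ls; have l0 : 0 <= l by exact: le_trans l1.
have lq : l <= Num.sqrt s.
  by rewrite -[l]ger0_norm// -sqrtr_sqr ler_sqrt// (le_trans (sqr_ge0 l)).
by rewrite /kern !max_r ?subrr// (le_trans l1).
Qed.

(** Both truncations are resolved in this range. The leading term [r 1 * |x|^-p] is the source of
    the constants [r2 N 1] and [r4 (N - 4) 1] in the final inequality. *)
Lemma kernE p r l s : 1 <= s -> s <= l ^+ 2 -> 0 <= l ->
  kern p r l s = Num.sqrt s ^- p * r 1 - l ^- p * r (s * l ^- 2).
Proof.
move=> s1 sl l0; have s0 : 0 <= s by exact: le_trans s1.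
have q1 : 1 <= Num.sqrt s by rewrite -[leLHS]sqrtr1 ler_sqrt.
rewrite /kern (max_r q1) (@max_l _ _ l) ?sqrt_le_abs//.
rewrite /tail sqr_sqrtr// mulfV// gt_eqF// (lt_le_trans _ s1)//.
Qed.

Lemma tail_bound p r C t s : (forall z, 0 <= z <= 1 -> `|r z| <= C) ->
  1 <= t -> 0 <= s <= t ^+ 2 -> `|tail p r t s| <= C.
Proof.
move=> rC t1 /andP[s0 st]; have t0 : 0 < t by rewrite (lt_le_trans _ t1).
have C0 : 0 <= C by apply: le_trans (rC 0 _); rewrite ?lexx ?ler01.
rewrite /tail normrM -[leRHS]mul1r ler_pM//.
  rewrite ger0_norm ?invr_ge0 ?exprn_ge0 ?(ltW t0)//.
  by rewrite invf_le1 ?exprn_gt0// exprn_ege1.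
apply: rC; rewrite mulr_ge0 ?invr_ge0 ?sqr_ge0//=.
by rewrite ler_pdivrMr ?exprn_gt0// mul1r.
Qed.

Lemma kern_bound p r C l s : (forall z, 0 <= z <= 1 -> `|r z| <= C) ->
  1 <= l -> 0 <= s -> `|kern p r l s| <= 2 * C.
Proof.
move=> rC l1 s0; have l0 : 0 <= l by exact: le_trans l1.
have sq : Num.sqrt s ^+ 2 = s by rewrite sqr_sqrtr.
rewrite (le_trans (ler_normB _ _))// mulr_natl mulr2n lerD//.
  apply: tail_bound => //; first by rewrite le_max lexx.
  rewrite s0 -[leLHS]sq ler_sqr ?nnegrE ?sqrtr_ge0 ?le_max ?lexx ?orbT//.
  by rewrite ler01.
apply: tail_bound => //; first by rewrite le_max l1.
by rewrite s0 -[leLHS]sq ler_sqr ?nnegrE ?sqrtr_ge0 ?le_max ?lexx ?orbT// l0.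
Qed.

Lemma continuous_kern p r l : 1 <= l -> continuous r -> continuous (kern p r l).
Proof.
move=> l1 cr.
have cm (a : R) : continuous (fun s => Num.max a (Num.sqrt s)).
  rewrite (_ : (fun s => _) = fun s => a + Num.max 0 (Num.sqrt s - a)); last first.
    by apply/funext => s; rewrite addr_maxr addr0 addrC subrK.
  apply: contD; first exact: cont_cst.
  apply: cont_comp; first exact: continuous_max0.
  by apply: contB; [exact: sqrt_continuous|exact: cont_cst].
have ct (a : R) : 1 <= a -> continuous (fun s => tail p r (Num.max a (Num.sqrt s)) s).
  move=> a1.
  have cV k : continuous (fun s => Num.max a (Num.sqrt s) ^- k).
    have ck : continuous (fun s => Num.max a (Num.sqrt s) ^+ k).
      apply: (@cont_comp _ _ (fun t : R => t ^+ k)); last exact: cm.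
      exact: exprn_continuous.
    move=> s; apply: cvgV; last exact: ck.
    by rewrite expf_neq0// gt_eqF// lt_max (lt_le_trans _ a1).
  apply: contM; first exact: cV.
  apply: cont_comp => //; apply: contM; last exact: cV.
  by move=> s; exact: cvg_id.
by apply: contB; exact: ct.
Qed.

End tail_kernels.

(** * The radial system and the clash of growth rates *)

Section real_variable.
Context {R : realType}.

Lemma is_derive_cont (F : R -> R) (a l : R) : is_derive a 1 F l -> {for a, continuous F}.
Proof. by case=> dF _; apply/differentiable_continuous/derivable1_diffP. Qed.

Lemma derive_ge0_le (F F' : R -> R) (l0 a b : R) :
  (forall t, l0 < t -> is_derive t 1 F (F' t)) ->
  (forall t, l0 < t -> 0 <= F' t) -> l0 < a -> a <= b -> F a <= F b.
Proof.
move=> dF F'0 l0a; rewrite le_eqVlt => /predU1P[->//|ab].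
have [||c] := @MVT R F F' a b ab.
- by move=> x; rewrite in_itv/= => /andP[ax _]; apply: dF; exact: lt_trans ax.
- apply: derivable_within_continuous => x; rewrite in_itv/= => /andP[ax _].
  by case: (dF x (lt_le_trans l0a ax)).
rewrite in_itv/= => /andP[ac _] e.
rewrite -subr_ge0 e mulr_ge0 ?subr_ge0 ?(ltW ab)// F'0//.
exact: lt_trans ac.
Qed.

Lemma derive_eq0_cst (F : R -> R) (l0 a b : R) :
  (forall t, l0 < t -> is_derive t 1 F 0) -> l0 < a -> l0 < b -> F a = F b.
Proof.
move=> dF; wlog ab : a b / a <= b.
  move=> H l0a l0b; case: (leP a b) => [ab|/ltW ba]; first exact: H.
  by apply/esym; exact: H.
move=> l0a l0b; apply/eqP; rewrite eq_le; apply/andP; split.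
  exact: (@derive_ge0_le F (fun=> 0) l0).
have dN t : l0 < t -> is_derive t 1 (fun t => - F t) 0.
  by move=> l0t; have h := is_deriveN_fun (dF t l0t); apply: (is_derive_eq h); rewrite oppr0.
by rewrite -lerN2; exact: (@derive_ge0_le (fun t => - F t) (fun=> 0) l0).
Qed.

(** Here [W] is -V. Two auxiliary functions avoid integrating the system: [D] is monotone and gives
    a lower bound on [W] in terms of [Q]; [T] is a first integral that expresses [U] by [W] and [Q].
    When the bound is inserted, the terms in [Q] cancel exactly and only [P / 96] remains. *)
Lemma radial_ode_lower_bound (U W E Q : R -> R) (q C l0 : R) :
  1 <= l0 -> 0 <= q ->
  (forall l, l0 < l -> is_derive l 1 U (l / 6 * W l)) ->
  (forall l, l0 < l -> is_derive l 1 W (l / 8 * E l)) ->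
  (forall l, l0 < l -> is_derive l 1 Q (l ^+ 3 * E l)) ->
  (forall l, l0 < l -> Q l <= q * ln l + C) ->
  (forall e, 0 < e -> exists L, forall l, L <= l -> - e <= W l) ->
  exists C', forall l, l0 < l -> C' - q / 96 * ln l <= U l.
Proof.
move=> l01 q0 dU dW dQ Qle Winf.
(* The summand [q / 2] compensates the derivative of [q ln l], so that D' is a positive multiple of
   [q ln l + C - Q]. *)
pose P l : R := q * ln l + q / 2 + C.
have pos l : l0 < l -> 0 < l by move=> /(le_lt_trans l01)/(lt_trans ltr01).
have dln l : l0 < l -> is_derive l 1 P (q * l^-1).
  move=> /pos l_gt0.
  have h := is_deriveD_fun (is_deriveD_fun (is_deriveZ_fun q (is_derive1_ln l_gt0))
    (@is_derive_cst _ _ R (q / 2) l 1)) (@is_derive_cst _ _ R C l 1).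
  by apply: (is_derive_eq h); rewrite !addr0.
(* [D] is nondecreasing and at most [- W], which eventually falls below every positive number; hence
   [D <= 0], that is, [8 l^2 W >= Q - P]. *)
pose D l : R := (Q l - P l) * (8^-1 * l ^- 2) - W l.
have dD l : l0 < l -> is_derive l 1 D ((q * ln l + C - Q l) * (4^-1 * l ^- 3)).
  move=> ll; have l_gt0 := pos l ll.
  have h := is_deriveB_fun (is_deriveM_fun (is_deriveB_fun (dQ l ll) (dln l ll))
    (is_deriveZ_fun 8^-1 (is_derive_exprVn 2 l_gt0))) (dW l ll).
  apply: (is_derive_eq h); rewrite /P.
  move: (ln l) (E l) (Q l) => a b c; field.
  by rewrite gt_eqF.
have D0 l : l0 < l -> D l <= 0.
  move=> ll; rewrite leNgt; apply/negP => Dl.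
  have [L HL] := Winf (D l / 2) (divr_gt0 Dl (ltr0n _ 2)).
  pose m := Num.max l L.
  have lm : l <= m by rewrite le_max lexx.
  have m0 : l0 < m by exact: lt_le_trans lm.
  have : D l <= D m.
    apply: (derive_ge0_le dD) => // t lt.
    by rewrite mulr_ge0 ?subr_ge0 ?Qle// mulr_ge0// invr_ge0 exprn_ge0 ?ltW ?pos.
  have : D m <= - W m.
    rewrite /D -[leRHS]add0r lerD2r mulr_le0_ge0//.
      by rewrite subr_le0 (le_trans (Qle m m0))// /P addrAC lerDl divr_ge0.
    by rewrite mulr_ge0// invr_ge0 exprn_ge0// ltW// pos.
  have := HL m; rewrite /m le_max lexx orbT => /(_ isT).
  by rewrite -/m => a b c; lra.
(* The derivative of [l^2 W / 12] is [l W / 6 + l^3 E / 96]; its two terms are cancelled by U' and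
   Q' / 96. *)
pose T l : R := U l - 12^-1 * (l ^+ 2 * W l) + 96^-1 * Q l.
have dT l : l0 < l -> is_derive l 1 T 0.
  move=> ll.
  have h := is_deriveD_fun (is_deriveB_fun (dU l ll) (is_deriveZ_fun 12^-1
    (is_deriveM_fun (is_derive_exprn 2 l) (dW l ll)))) (is_deriveZ_fun 96^-1 (dQ l ll)).
  by apply: (is_derive_eq h); rewrite /=; field.
pose T0 := T (l0 + 1).
exists (T0 - (q / 2 + C) / 96) => l ll.
have : T l = T0 by apply: (derive_eq0_cst dT) => //; rewrite ltrDl.
rewrite /T => TE; have := D0 l ll; rewrite /D /P.
have l_gt0 := pos l ll; rewrite subr_le0 => h.
have : Q l - (q * ln l + q / 2 + C) <= 8 * (l ^+ 2 * W l).
  rewrite -(@ler_pM2r _ (8^-1 * l ^- 2)); last first.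
    by rewrite mulr_gt0// invr_gt0 exprn_gt0.
  apply: (le_trans h); rewrite le_eqVlt; apply/orP; left; apply/eqP.
  by field; rewrite gt_eqF.
by move: TE; lra.
Qed.

Lemma exp_linear_contradiction (d K a b t0 : R) : 0 < d -> 0 < K ->
  ~ (forall t, t0 < t -> K * expR (d * t) <= a * t + b).
Proof.
move=> d0 K0 H.
(* [c t^2] is the quadratic term of [K exp(d t)]; it exceeds [(|a| + |b|) t], hence the affine
   function, as soon as [t >= 1] and [t > (|a| + |b|) / c]. *)
pose c := K * d ^+ 2 / 2.
have c0 : 0 < c by rewrite divr_gt0// mulr_gt0// exprn_gt0.
pose t := 1 + `|t0| + (`|a| + `|b|) / c.
have ab0 : 0 <= (`|a| + `|b|) / c by rewrite divr_ge0 ?(ltW c0)// addr_ge0.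
have t1 : 1 <= t by rewrite /t -addrA lerDl addr_ge0.
have tt0 : t0 < t.
  by rewrite (le_lt_trans (ler_norm _))// /t addrAC ltr_pwDl// ltr_pwDl.
have t_ge0 : 0 <= t by exact: le_trans t1.
have := H t tt0; apply/negP; rewrite -ltNge.
apply: (@lt_le_trans _ _ (c * t ^+ 2)).
  have h : a * t + b <= (`|a| + `|b|) * t.
    rewrite mulrDl lerD// ?ler_wpM2r ?ler_norm//.
    by rewrite (le_trans (ler_norm b))// ler_peMr.
  apply: (le_lt_trans h); rewrite expr2 mulrA ltr_pM2r ?(lt_le_trans _ t1)//.
  rewrite mulrC -ltr_pdivrMr// /t.
  by rewrite ltrDr (@lt_le_trans _ _ 1)// lerDl.
have := expR_ge1Dxn 1 (mulr_ge0 (ltW d0) t_ge0).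
rewrite -(ler_pM2l K0); apply: le_trans.
rewrite mulrDr mulr1 (_ : (2`!)%:R = 2)//.
have -> : K * ((d * t) ^+ 2 / 2) = c * t ^+ 2 by rewrite /c; field.
by rewrite lerDr ltW.
Qed.

End real_variable.

(** * The two kernel polynomials and the critical dimension *)

Section kernel_polynomials.
Context {R : realType}.
Implicit Types z : R.

(** The polynomial solution of [n r + 2 z r' = (1 - z)^4]: the coefficient of [z^j] in [(1 - z)^4]
    is divided by [n + 2 j]. [r2] is the same for exponent 2. *)
Definition r4 (n z : R) : R :=
  n^-1 - 4 / (n + 2) * z + 6 / (n + 4) * z ^+ 2 - 4 / (n + 6) * z ^+ 3
  + (n + 8)^-1 * z ^+ 4.

Definition r4' (n z : R) : R :=
  - (4 / (n + 2)) + 12 / (n + 4) * z - 12 / (n + 6) * z ^+ 2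
  + 4 / (n + 8) * z ^+ 3.

Definition r2 (n z : R) : R := n^-1 - 2 / (n + 2) * z + (n + 4)^-1 * z ^+ 2.

Definition r2' (n z : R) : R := - (2 / (n + 2)) + 2 / (n + 4) * z.

Lemma is_derive_r4 n z : is_derive z 1 (r4 n) (r4' n z).
Proof.
rewrite /r4.
have h := is_deriveD_fun (is_deriveB_fun (is_deriveD_fun (is_deriveB_fun
  (@is_derive_cst _ _ R n^-1 z 1) (is_deriveZ_fun (4 / (n + 2)) (is_derive_id z 1)))
  (is_deriveZ_fun (6 / (n + 4)) (is_derive_exprn 2 z)))
  (is_deriveZ_fun (4 / (n + 6)) (is_derive_exprn 3 z)))
  (is_deriveZ_fun (n + 8)^-1 (is_derive_exprn 4 z)).
by apply: (is_derive_eq h); rewrite /r4' /=; ring.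
Qed.

Lemma is_derive_r2 n z : is_derive z 1 (r2 n) (r2' n z).
Proof.
rewrite /r2.
have h := is_deriveD_fun (is_deriveB_fun
  (@is_derive_cst _ _ R n^-1 z 1) (is_deriveZ_fun (2 / (n + 2)) (is_derive_id z 1)))
  (is_deriveZ_fun (n + 4)^-1 (is_derive_exprn 2 z)).
by apply: (is_derive_eq h); rewrite /r2' /=; ring.
Qed.

Lemma r4_ode n z : 0 < n -> n * r4 n z + 2 * z * r4' n z = (1 - z) ^+ 4.
Proof. by move=> n0; rewrite /r4 /r4'; field; rewrite !gt_eqF// ?addr_gt0. Qed.

Lemma r2_ode n z : 0 < n -> n * r2 n z + 2 * z * r2' n z = (1 - z) ^+ 2.
Proof. by move=> n0; rewrite /r2 /r2'; field; rewrite !gt_eqF// ?addr_gt0. Qed.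

(** An instance of the Beta integral [2^m m! / (n (n + 2) ... (n + 2 m))], here with m = 4. *)
Lemma r4_1 n : 0 < n ->
  r4 n 1 = 384 / (n * (n + 2) * (n + 4) * (n + 6) * (n + 8)).
Proof. by move=> n0; rewrite /r4; field; rewrite !gt_eqF// ?addr_gt0. Qed.

Lemma r2_1 n : 0 < n -> r2 n 1 = 8 / (n * (n + 2) * (n + 4)).
Proof. by move=> n0; rewrite /r2; field; rewrite !gt_eqF// ?addr_gt0. Qed.

(* Expansion in powers of 1 - z: all coefficients are positive. *)
Lemma r4_ge0 n z : 0 < n -> z <= 1 -> 0 <= r4 n z.
Proof.
move=> n0 z1; have y0 : 0 <= 1 - z by rewrite subr_ge0.
have -> : r4 n z = 384 / (n * (n + 2) * (n + 4) * (n + 6) * (n + 8)) +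
   4 * 48 / ((n + 2) * (n + 4) * (n + 6) * (n + 8)) * (1 - z) +
   6 * 8 / ((n + 4) * (n + 6) * (n + 8)) * (1 - z) ^+ 2 +
   4 * 2 / ((n + 6) * (n + 8)) * (1 - z) ^+ 3 + (n + 8)^-1 * (1 - z) ^+ 4.
  by rewrite /r4; field; rewrite !gt_eqF// ?addr_gt0.
have [a b c d] : [/\ 0 <= n + 2, 0 <= n + 4, 0 <= n + 6 & 0 <= n + 8].
  by split; rewrite addr_ge0// ltW.
have n1 := ltW n0.
have e8 : 0 <= (n + 8)^-1 by rewrite invr_ge0.
have e68 : 0 <= 4 * 2 / ((n + 6) * (n + 8)) by rewrite divr_ge0// mulr_ge0.
have e48 : 0 <= 6 * 8 / ((n + 4) * (n + 6) * (n + 8)).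
  by rewrite divr_ge0// mulr_ge0// mulr_ge0.
have e28 : 0 <= 4 * 48 / ((n + 2) * (n + 4) * (n + 6) * (n + 8)).
  by rewrite divr_ge0// mulr_ge0// mulr_ge0// mulr_ge0.
have e08 : 0 <= 384 / (n * (n + 2) * (n + 4) * (n + 6) * (n + 8)).
  apply: divr_ge0; first exact: ler0n.
  by rewrite mulr_ge0// mulr_ge0// mulr_ge0// mulr_ge0.
apply: addr_ge0; last by rewrite mulr_ge0// exprn_ge0.
apply: addr_ge0; last by rewrite mulr_ge0// exprn_ge0.
apply: addr_ge0; last by rewrite mulr_ge0// exprn_ge0.
by apply: addr_ge0 => //; rewrite mulr_ge0.
Qed.

Lemma r4_le n z : 1 <= n -> 0 <= z <= 1 -> `|r4 n z| <= 16.
Proof.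
move=> n1 /andP[z0 z1]; have n0 : 0 < n by exact: lt_le_trans n1.
have inv (k : R) : 0 <= k -> 0 <= (n + k)^-1 <= 1.
  move=> k0; have nk : 1 <= n + k by rewrite ler_wpDr.
  by rewrite invr_ge0 (le_trans ler01)//= invf_le1// (lt_le_trans ltr01).
have [i0 i2 i4 i6] : [/\ 0 <= n^-1 <= 1, 0 <= (n + 2)^-1 <= 1, 0 <= (n + 4)^-1 <= 1 &
   0 <= (n + 6)^-1 <= 1] by split; rewrite ?inv// -[n]addr0 inv.
have i8 := inv 8 (ler0n _ 8).
have mb (a b : R) : 0 <= a <= 1 -> 0 <= b <= 1 -> 0 <= a * b <= 1.
  by move=> /andP[a0 a1] /andP[b0 b1]; rewrite mulr_ge0//= mulr_ile1.
have z01 : 0 <= z <= 1 by rewrite z0.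
have z2 : 0 <= z ^+ 2 <= 1 by rewrite exprn_ge0// exprn_ile1.
have z3 : 0 <= z ^+ 3 <= 1 by rewrite exprn_ge0// exprn_ile1.
have z4 : 0 <= z ^+ 4 <= 1 by rewrite exprn_ge0// exprn_ile1.
have := mb _ _ i2 z01; have := mb _ _ i4 z2; have := mb _ _ i6 z3.
have := mb _ _ i8 z4.
rewrite /r4 -!mulrA ler_norml => /andP[? ?] /andP[? ?] /andP[? ?] /andP[? ?].
by move: i0 => /andP[? ?]; apply/andP; split; lra.
Qed.

Lemma r2_le n z : 1 <= n -> 0 <= z <= 1 -> `|r2 n z| <= 4.
Proof.
move=> n1 /andP[z0 z1]; have n0 : 0 < n by exact: lt_le_trans n1.
have inv (k : R) : 0 <= k -> 0 <= (n + k)^-1 <= 1.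
  move=> k0; have nk : 1 <= n + k by rewrite ler_wpDr.
  by rewrite invr_ge0 (le_trans ler01)//= invf_le1// (lt_le_trans ltr01).
have [i0 i2 i4] : [/\ 0 <= n^-1 <= 1, 0 <= (n + 2)^-1 <= 1 & 0 <= (n + 4)^-1 <= 1].
  by split; rewrite ?inv// -[n]addr0 inv.
have mb (a b : R) : 0 <= a <= 1 -> 0 <= b <= 1 -> 0 <= a * b <= 1.
  by move=> /andP[a0 a1] /andP[b0 b1]; rewrite mulr_ge0//= mulr_ile1.
have z01 : 0 <= z <= 1 by rewrite z0.
have z2 : 0 <= z ^+ 2 <= 1 by rewrite exprn_ge0// exprn_ile1.
have := mb _ _ i2 z01; have := mb _ _ i4 z2.
rewrite /r2 -!mulrA ler_norml => /andP[? ?] /andP[? ?].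
by move: i0 => /andP[? ?]; apply/andP; split; lra.
Qed.

(** The left-hand side is the exponent q / (96 c): [r4 (n - 4) 1] compares the kernel of Q with
    [|x|^-(n-4)], the middle factor is the Rellich constant, and [1 / r2 n 1] compares [|x|^-n] with
    the volume kernel. It simplifies to [n^2 (n - 4) / (32 (n - 2))], which is 3.6 at n = 12 and
    about 4.32 at n = 13; the 4 on the right is the decay rate of [l^-4]. *)
Lemma critical_dimension (n : R) : 5 <= n <= 12 ->
  r4 (n - 4) 1 * (n ^+ 2 * (n - 4) ^+ 2 / 16) / r2 n 1 / 96 < 4.
Proof.
move=> /andP[n5 n12]; have n4 : 0 < n - 4 by rewrite subr_gt0 (lt_le_trans _ n5)// ltr_nat.
have n0 : 0 < n by rewrite (lt_le_trans _ n5).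
have n2 : 0 < n - 2 by rewrite subr_gt0 (lt_le_trans _ n5)// ltr_nat.
rewrite r4_1// r2_1//.
have -> : 384 / ((n - 4) * (n - 4 + 2) * (n - 4 + 4) * (n - 4 + 6) * (n - 4 + 8)) *
   (n ^+ 2 * (n - 4) ^+ 2 / 16) / (8 / (n * (n + 2) * (n + 4))) / 96 =
   n ^+ 2 * (n - 4) / (32 * (n - 2)).
  have e1 : n - 4 + 2 = n - 2 by ring.
  have e2 : n - 4 + 4 = n by ring.
  have e3 : n - 4 + 6 = n + 2 by ring.
  have e4 : n - 4 + 8 = n + 4 by ring.
  rewrite e1 e2 e3 e4; field.
  by rewrite !gt_eqF// ?addr_gt0.
rewrite ltr_pdivrMr ?mulr_gt0//.
nra.
Qed.

End kernel_polynomials.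

(** * The total mass of the ball weight *)

Section volume.
Context {R : realType}.

Lemma lebesgue_rV_box_gt0 n (M : R) : 0 < M ->
  (0 < lebesgue_rV n [set x : 'rV[R]_n | forall i, (`|x ord0 i| <= M)%R])%E.
Proof.
move=> M0; elim: n => [|n IH].
  by rewrite /= diracE mem_set//= => -[].
pose A : set (measurableTypeR R) := [set` `[(-M)%R, M]].
pose B : set 'rV[R]_n := [set x | forall i, (`|x ord0 i| <= M)%R].
have E : @cons_rV R n @^-1` [set x | forall i, (`|x ord0 i| <= M)%R] = A `*` B.
  apply/seteqP; split=> -[a y]; rewrite /A /B /=.
    move=> h; split.
      by have := h ord0; rewrite cons_rV0 in_itv/= ler_norml.
    by move=> i; have := h (lift ord0 i); rewrite cons_rVS.
  rewrite in_itv/= -ler_norml => -[ha hy] i.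
  by case: (unliftP ord0 i) => [j ->|->]; rewrite ?cons_rVS ?cons_rV0.
rewrite lebesgue_rVS E [ltRHS](product_measure1E (@lebesgue_measure R) (lebesgue_rV n))//=.
- apply: mule_gt0 => //.
  rewrite [ltRHS]lebesgue_measure_itv/= ifT ?lte_fin ?gtrN//.
  by rewrite opprK addr_gt0.
- exact: measurable_itv.
- exact: measurable_rV_box.
Qed.

Context {n : nat}.

(** The mass of the weight of exponent 2 at radius 1: the [c] of the overview. *)
Definition c0 : R := @ball_moment R n 2 (cst 1) 1.

Lemma C2of_cst (a : R) : @C2of R n (cst a) (fun _ => cst 0) (fun _ => cst 0).
Proof.
by split=> //; move=> *; first [exact: cont_cst | exact: is_derive_cst].
Qed.

(** Homogeneity without a change of variables: the identity of [is_derive_ball_avg] for the constant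
    1, whose Laplacian is zero, shows that the normalised mass has zero derivative in l. *)
Lemma ball_moment_cst l : 0 < l -> l ^- (n + 4) * @ball_moment R n 2 (cst 1) l = c0.
Proof.
move=> l0.
pose F l : R := l ^- (n + 4) * @ball_moment R n 2 (cst 1) l.
have F1 : F 1 = c0 by rewrite /F expr1n invr1 mul1r.
rewrite -F1 -[LHS]/(F l); apply: (@derive_eq0_cst _ F 0) => // t t0.
have h := is_derive_ball_avg 0 (C2of_cst 1) t0.
apply: (is_derive_eq h).
rewrite /ball_moment (_ : (fun x => _) = (fun=> 0)) ?Int0 ?mulr0//.
by apply/funext => x; rewrite big1 ?mul0r.
Qed.

Lemma c0_gt0 : 0 < c0.
Proof.
rewrite /c0 /ball_moment -lte_fin EFin_Int; last first.
  by apply: CcMl; [exact: cont_cst|exact: Cc_bump].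
(* In the box of half-side [1 / (2 (n + 1))] one has [|x|^2 <= 1/2], so the weight is at least 1/4
   there. *)
pose M : R := 2^-1 / n.+1%:R.
have M0 : 0 < M by rewrite divr_gt0.
pose A := [set x : 'rV[R]_n | forall i, `|x ord0 i| <= M].
have mA : measurable A by exact: measurable_rV_box.
apply: (@lt_le_trans _ _ (\int[lebesgue_rV n]_(x in A) (4^-1)%:E)%E).
  rewrite integral_cst// mule_gt0 ?lte_fin//.
  exact: lebesgue_rV_box_gt0.
rewrite integral_mkcond; apply: ge0_le_integral => //.
- by move=> x _; rewrite patchE; case: ifP => // _; rewrite lee_fin.
- by apply/(measurable_restrictT _ mA); exact: measurable_cst.
- apply/measurable_EFinP; apply: continuous_measurable_rV.
  by have [] := @CcMl R n (cst 1) _ (@cont_cst R _ 1) (@Cc_bump R n 1 1).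
move=> x _; rewrite patchE; case: ifPn => [|_]; last by rewrite lee_fin mul1r bump_ge0.
rewrite inE => Ax; rewrite lee_fin mul1r.
have sx : sqn x <= 2^-1.
  apply: (@le_trans _ _ (\sum_(i < n) M)).
    apply: ler_sum => i _; rewrite -[leLHS]real_normK ?num_real// expr2.
    apply: (@le_trans _ _ (M * 1)); last by rewrite mulr1.
    apply: ler_pM => //; apply: (le_trans (Ax i)).
    rewrite /M ler_pdivrMr ?ltr0n// mul1r (@le_trans _ _ 1)//; last by rewrite ler1n.
    by rewrite invf_le1// ler1n.
  rewrite sumr_const card_ord.
  have -> : M *+ n = 2^-1 * (n%:R / n.+1%:R) by rewrite -[LHS]mulr_natr /M; ring.
  by rewrite ler_piMr// ler_pdivrMr ?ltr0n// mul1r ler_nat.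
rewrite bumpE expr1n; last by rewrite (le_trans sx)// invf_le1// ler1n.
have -> : 4^-1 = (2^-1) ^+ 2 :> R by rewrite expr2; field.
by rewrite lerXn2r ?nnegrE// ?subr_ge0; lra.
Qed.

End volume.

(** * Integrals against the primitive kernels *)

Section kernel_integrals.
Context {R : realType} {n : nat}.

Lemma Cc_kern p (r : R -> R) l : 1 <= l -> continuous r ->
  Cc (fun x : 'rV[R]_n => kern p r l (sqn x)).
Proof.
move=> l1 cr; split; last by exists (l ^+ 2) => x; exact: kern_eq0.
by apply: cont_comp; [exact: continuous_kern|exact: continuous_sqn].
Qed.

Lemma derive_Int_kern p m (r r1 : R -> R) (f : 'rV[R]_n -> R) (l : R) :
  (forall z : R, is_derive z 1 r (r1 z)) ->
  (forall z, p%:R * r z + 2 * z * r1 z = (1 - z) ^+ m.+1) ->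
  continuous f -> 1 < l ->
  is_derive l 1 (fun l => Int (fun x => f x * kern p r l (sqn x)))
    (l ^- (p.+1 + 2 * m.+1) * ball_moment m.+1 f l).
Proof.
move=> dr pr cf l1.
have cr : continuous r by move=> z; exact: (is_derive_cont (dr z)).
have h := @derive_Int_kernel R n f (kern p r)
  (fun l s => l ^- (p.+1 + 2 * m.+1) * bump m.+1 l s)
  l 1 (l + 1) ((l + 1) ^+ 2) (((l + 1) ^+ 2) ^+ m.+1) cf.
have sq t : 1 < t < l + 1 -> t ^+ 2 <= (l + 1) ^+ 2.
  move=> /andP[t1 t2]; have t0 : 0 < t by exact: lt_trans t1.
  by rewrite lerXn2r ?nnegrE ?ltW// (lt_trans t0).
apply: (is_derive_eq (h _ _ _ _ _)).
- by apply/andP; split => //; rewrite ltrDl.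
- by move=> t /andP[t1 _]; apply: continuous_kern => //; exact: ltW.
- by move=> t s tl ls; apply: kern_eq0; [case/andP: tl => /ltW|rewrite (le_trans _ ls) ?sq].
- move=> t s /andP[t1 _] s0; apply: is_derive_kern => //; exact: lt_trans t1.
- move=> t s tl s0; have /andP[t1 _] := tl.
  have t0 : 0 < t by exact: lt_trans t1.
  rewrite ger0_norm ?mulr_ge0 ?bump_ge0 ?invr_ge0 ?exprn_ge0 ?(ltW t0)//.
  rewrite -[leRHS]mul1r ler_pM ?bump_ge0 ?invr_ge0 ?exprn_ge0 ?(ltW t0)//.
    by rewrite invf_le1 ?exprn_gt0// exprn_ege1// ltW.
  rewrite lerXn2r ?nnegrE ?le_max ?lexx ?sqr_ge0// ge_max sqr_ge0/=.
  by rewrite (le_trans _ (sq t tl))// lerBlDr lerDl.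
- rewrite /ball_moment -IntZ; last by apply: CcMl => //; exact: Cc_bump.
  by congr Int; apply/funext => x; ring.
Qed.

End kernel_integrals.

(** * The contradiction, given test functions for every radius *)

Section core.
Context {R : realType} {N : nat}.
Implicit Types (f psi : 'rV[R]_N -> R).

(** The Rellich constant: the square of the factor in [Delta |x|^(-(N-4)/2) = - (N (N - 4) / 4)
    |x|^(-N/2)]. *)
Definition hardy_rellich : R := N%:R ^+ 2 * (N%:R - 4) ^+ 2 / 16.

(* [psi] stands for phi^2 and [D] for |Delta phi|^2, where phi is
   |x|^-(N-4)/2 cut off outside 2A <= |x|^2 <= l^2. *)
Definition rellich_test (A C l : R) (f psi D : 'rV[R]_N -> R) : Prop :=
  [/\ Cc psi, Cc D, forall x, 0 <= psi x,
      forall x, 2 * A <= sqn x <= l ^+ 2 -> psi x = enorm x ^- (N - 4) &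
      Int (fun x => f x * psi x) <= Int D] /\
  [/\ forall x, 2 * A <= sqn x <= l ^+ 2 -> D x <= hardy_rellich * enorm x ^- N,
      forall x, sqn x <= 2 * A -> D x <= C,
      forall x, l ^+ 2 <= sqn x <= 2 * l ^+ 2 -> D x <= C * l ^- N &
      forall x, 2 * l ^+ 2 <= sqn x -> D x <= 0].

Hypothesis N5 : (5 <= N <= 12)%N.

Let p := (N - 4)%N.

Let N4 : (4 <= N)%N. Proof. by case/andP: N5 => /ltnW. Qed.

Let pE : p%:R = N%:R - 4 :> R. Proof. by rewrite /p natrB. Qed.

Let N8E : (N + 8 = 3 + (p.+1 + 2 * 4))%N.
Proof. by rewrite -[in LHS](subnK N4) -/p; lia. Qed.

Let p0 : 1 <= p%:R :> R.
Proof. by rewrite /p ler1n subn_gt0; case/andP: N5. Qed.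

Let N1 : 1 <= N%:R :> R.
Proof. by rewrite ler1n; apply: leq_trans N4. Qed.

Let rN := @r2 R N%:R.
Let rp := @r4 R p%:R.

Let rN1 : 0 < rN 1.
Proof.
have n0 : 0 < N%:R :> R by exact: lt_le_trans N1.
by rewrite /rN r2_1// divr_gt0// !mulr_gt0// addr_gt0.
Qed.

Let drN (z : R) : is_derive z 1 rN (r2' N%:R z).
Proof. exact: is_derive_r2. Qed.

Let drp (z : R) : is_derive z 1 rp (r4' p%:R z).
Proof. exact: is_derive_r4. Qed.

Let crN : continuous rN.
Proof. by move=> z; exact: (is_derive_cont (drN z)). Qed.

Let crp : continuous rp.
Proof. by move=> z; exact: (is_derive_cont (drp z)). Qed.

Let H := hardy_rellich.

Let H0 : 0 <= H.
Proof. by rewrite /H /hardy_rellich divr_ge0// mulr_ge0 ?sqr_ge0. Qed.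

(** The coefficient of ln l in the bound on the integral of [f psi]; the [q] of the overview is
    [rp 1 * q']. *)
Let q' : R := H / rN 1 * @c0 R N.

Let volume_kernel l := Int (fun x : 'rV[R]_N => 1 * kern N rN l (sqn x)).

(** This kernel replaces [|x|^-N]: by homogeneity of the ball weight the derivative of its integral
    is exactly [c0 / l]. *)
Lemma volume_kernelE : exists K0, forall l, 1 < l -> volume_kernel l = @c0 R N * ln l + K0.
Proof.
pose F (l : R) := volume_kernel l - @c0 R N * ln l.
exists (F 2) => l l1; suff <- : F l = F 2 by rewrite /F addrC subrK.
apply: (@derive_eq0_cst _ F 1) => //; last by rewrite ltr1n.
move=> t t1; have t0 : 0 < t by exact: lt_trans t1.
have dk := @derive_Int_kern R N N 1 rN (r2' N%:R) (cst 1) t drN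
  (fun z => r2_ode z (lt_le_trans ltr01 N1)) (@cont_cst R _ 1) t1.
have h := is_deriveB_fun dk (is_deriveZ_fun (@c0 R N) (is_derive1_ln t0)).
apply: (is_derive_eq h); rewrite -(ball_moment_cst t0).
have -> : (N.+1 + 2 * 2 = (N + 4).+1)%N by lia.
by rewrite exprS invfM; ring.
Qed.

(** The 4 is the bound of [r2_le]. The error [4 l^-N] is harmless, as its integral over a ball of
    radius comparable to l stays bounded. *)
Lemma kern_volume_ge A l x : 1 <= A -> 1 <= l -> 2 * A <= sqn x <= l ^+ 2 ->
  rN 1 * enorm x ^- N - 4 * l ^- N <= kern N rN l (@sqn R N x).
Proof.
move=> A1 l1 /andP[s1 s2].
have l0 : 0 <= l by exact: le_trans l1.
have s0 : 1 <= sqn x by lra.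
rewrite kernE// -enormE mulrC lerB// mulrC ler_wpM2r ?invr_ge0 ?exprn_ge0//.
apply: (le_trans (ler_norm _)); apply: r2_le => //.
rewrite mulr_ge0 ?sqn_ge0 ?invr_ge0 ?exprn_ge0//=.
by rewrite ler_pdivrMr ?mul1r// exprn_gt0// (lt_le_trans ltr01).
Qed.

Lemma kern_rellich_le A l x : 1 <= A -> 1 <= l -> 2 * A <= sqn x <= l ^+ 2 ->
  kern p rp l (@sqn R N x) <= rp 1 * enorm x ^- p.
Proof.
move=> A1 l1 /andP[s1 s2].
have l0 : 0 <= l by exact: le_trans l1.
have s0 : 1 <= sqn x by lra.
rewrite kernE// -enormE mulrC lerBlDr lerDl mulr_ge0 ?invr_ge0 ?exprn_ge0//.
apply: r4_ge0; first exact: lt_le_trans p0.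
by rewrite ler_pdivrMr ?mul1r// exprn_gt0// (lt_le_trans ltr01).
Qed.

Lemma bump_ge1 A s : 1 <= A -> s <= 2 * A -> 1 <= @bump R 1 (2 * A) s.
Proof.
move=> A1 sA; have sA2 : s <= (2 * A) ^+ 2 by nra.
by rewrite bumpE// expr1; nra.
Qed.

(** Instead of splitting the domain of integration, [D] is bounded pointwise by one compactly
    supported function [G] with a known integral; the constant does not depend on l. *)
Lemma rellich_test_bound (A C : R) (f : 'rV[R]_N -> R) : 1 <= A -> 0 <= C ->
  exists C', forall l psi D, 1 < l -> 2 * A <= l ^+ 2 ->
    rellich_test A C l f psi D ->
    Int (fun x => f x * psi x) <= q' * ln l + C'.
Proof.
move=> A1 C0; have [K0 volE] := volume_kernelE.
pose b := H / rN 1; have b0 : 0 <= b by rewrite divr_ge0// ltW.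
pose I1 := Int (fun x : 'rV[R]_N => bump 1 (2 * A) (sqn x)).
exists (b * K0 + (C + 8 * b) * I1 + (C + 4 * b) * (2 ^+ (N + 4) * @c0 R N)).
move=> l psi D l1 Al [[Cpsi CD psi0 psiE fD] [D1 D2 D3 D4]].
have l1' := ltW l1; have l0 : 0 < l by exact: lt_trans l1.
have ll0 : 0 < l ^+ 2 by rewrite exprn_gt0.
have lN : 0 <= l ^- N by rewrite invr_ge0 exprn_ge0// ltW.
apply: (le_trans fD).
(* The first term carries the logarithm. The second covers [|x|^2 <= 2 A], where its bump is at
   least 1: [C] bounds [D], and [8 b] offsets a kernel bounded below only by -8. The third covers
   the errors of order [l^-N] and has an integral independent of l. *)
pose G x : R := b * (1 * kern N rN l (sqn x)) +
  (C + 8 * b) * bump 1 (2 * A) (sqn x) +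
  (C + 4 * b) * (l ^- (N + 4) * (1 * bump 2 (2 * l) (@sqn R N x))).
have Ck : Cc (fun x : 'rV[R]_N => 1 * kern N rN l (sqn x)).
  by apply: CcZ; exact: Cc_kern.
have Cb m k : Cc (fun x : 'rV[R]_N => 1 * bump m.+1 k (sqn x)).
  by apply: CcZ; exact: Cc_bump.
have IG : Int G = q' * ln l + (b * K0 + (C + 8 * b) * I1 +
    (C + 4 * b) * (2 ^+ (N + 4) * @c0 R N)).
  rewrite /G IntD; [|apply: CcD; apply: CcZ => //; exact: Cc_bump|]; last first.
    by do 2 apply: CcZ; exact: Cb.
  rewrite IntD; [|exact: CcZ|apply: CcZ; exact: Cc_bump].
  rewrite (IntZ b Ck) (IntZ _ (@Cc_bump R N 0 (2 * A))).
  rewrite (IntZ _ (CcZ (l ^- (N + 4)) (Cb 1%N (2 * l)))) (IntZ _ (Cb 1%N (2 * l))).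
  rewrite -/(volume_kernel l) volE// -/I1.
  have -> : Int (fun x : 'rV[R]_N => 1 * bump 2 (2 * l) (sqn x)) =
      (2 * l) ^+ (N + 4) * @c0 R N.
    have l20 : 0 < 2 * l by rewrite mulr_gt0.
    rewrite -(ball_moment_cst l20) mulrA mulfV ?mul1r//.
    by rewrite expf_neq0// gt_eqF.
  have -> : l ^- (N + 4) * ((2 * l) ^+ (N + 4) * @c0 R N) = 2 ^+ (N + 4) * @c0 R N.
    rewrite exprMn; have : l ^+ (N + 4) != 0 by rewrite expf_neq0// gt_eqF.
    by move: (l ^+ _) (2 ^+ _) => w z w0; field.
  by rewrite /q' -/b; ring.
rewrite -IG; apply: le_Int => //.
  apply: CcD; last by do 2 apply: CcZ; exact: Cb.
  by apply: CcD; apply: CcZ => //; exact: Cc_bump.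
move=> x; rewrite /G mul1r.
have s0 := sqn_ge0 x.
have B1 : 0 <= (C + 8 * b) * bump 1 (2 * A) (sqn x).
  by rewrite mulr_ge0 ?bump_ge0// addr_ge0// mulr_ge0.
have lN4 : l ^- (N + 4) * l ^+ 4 = l ^- N.
  by rewrite exprD invfM -mulrA mulVf ?mulr1// expf_neq0// gt_eqF.
have B2 : 0 <= (C + 4 * b) * (l ^- (N + 4) * (1 * bump 2 (2 * l) (sqn x))).
  have ll := ltW l0.
  apply: mulr_ge0; first by rewrite addr_ge0// mulr_ge0.
  apply: mulr_ge0; first by rewrite invr_ge0 exprn_ge0.
  by rewrite mul1r bump_ge0.
(* For [|x|^2 <= 2 l^2] one has [(2 l)^2 - |x|^2 >= 2 l^2], so the bump of exponent 2 is at least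
   [l^4]. *)
have B3 : sqn x <= 2 * l ^+ 2 ->
    (C + 4 * b) * l ^- N <= (C + 4 * b) * (l ^- (N + 4) * (1 * bump 2 (2 * l) (sqn x))).
  move=> sl; apply: ler_wpM2l; first by rewrite addr_ge0// mulr_ge0.
  rewrite -[leLHS]lN4; apply: ler_wpM2l; first by rewrite invr_ge0 exprn_ge0// ltW.
  rewrite mul1r bumpE; last by rewrite exprMn; lra.
  rewrite (exprM l 2 2) lerXn2r ?nnegrE ?sqr_ge0 ?subr_ge0 ?exprMn//; lra.
have [sA|As] := leP (sqn x) (2 * A).
  have kb : - 8 <= kern N rN l (sqn x).
    have := @kern_bound R N rN 4 l (sqn x) (fun z => r2_le N1) l1' s0.
    by rewrite ler_norml => /andP[+ _]; lra.
  have bb := bump_ge1 A1 sA.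
  have h1 : C + 8 * b <= (C + 8 * b) * bump 1 (2 * A) (sqn x).
    by rewrite ler_peMr// addr_ge0// mulr_ge0.
  have h2 : b * (- 8) <= b * kern N rN l (sqn x) by rewrite ler_wpM2l.
  have := D2 x sA; lra.
have [sl|ls] := leP (sqn x) (l ^+ 2).
  have range : 2 * A <= sqn x <= l ^+ 2 by rewrite (ltW As).
  have h3 : (C + 4 * b) * l ^- N <=
      (C + 4 * b) * (l ^- (N + 4) * (1 * bump 2 (2 * l) (sqn x))).
    by apply: B3; lra.
  have h4 : b * (rN 1 * enorm x ^- N - 4 * l ^- N) <= b * kern N rN l (sqn x).
    by apply: ler_wpM2l => //; exact: (kern_volume_ge A1 l1' range).
  have h5 : b * (rN 1 * enorm x ^- N - 4 * l ^- N) =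
      hardy_rellich * enorm x ^- N - 4 * b * l ^- N.
    rewrite /b -/H; move: (rN 1) rN1 (enorm x ^- N) (l ^- N) => r r0 y z.
    by field; rewrite gt_eqF.
  have h6 : 0 <= C * l ^- N by rewrite mulr_ge0.
  by have := D1 x range; rewrite h5 in h4; rewrite mulrDl in h3; lra.
rewrite kern_eq0// ?(ltW ls)// mulr0 add0r.
have [sl2|l2s] := leP (sqn x) (2 * l ^+ 2).
  have range : l ^+ 2 <= sqn x <= 2 * l ^+ 2 by rewrite (ltW ls).
  have := D3 x range; have := B3 sl2; rewrite mulrDl.
  have h6 : 0 <= 4 * b * l ^- N by apply: mulr_ge0 => //; exact: mulr_ge0.
  by lra.
have := D4 x (ltW l2s); lra.
Qed.

(** Jensen's inequality through the tangent line of the exponential at the weighted mean [a]: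
    [exp u >= exp a (1 + u - a)], integrated against the weight. *)
Lemma weighted_jensen (u : 'rV[R]_N -> R) (l : R) : continuous u -> 0 < l ->
  @c0 R N * expR (l ^- (N + 4) * ball_moment 2 u l / @c0 R N) <=
  l ^- (N + 4) * ball_moment 2 (fun x => expR (u x)) l.
Proof.
move=> cu l0; set U := l ^- (N + 4) * _.
pose a := U / @c0 R N.
have w0 : 0 <= l ^- (N + 4) by rewrite invr_ge0 exprn_ge0// ltW.
have Cb := @Cc_bump R N 1 l.
have C1 : Cc (fun x : 'rV[R]_N => 1 * bump 2 l (sqn x)) by exact: CcZ.
have Cu : Cc (fun x : 'rV[R]_N => u x * bump 2 l (sqn x)) by exact: CcMl.
have ce : continuous (fun x => expR (u x)).
  by apply: cont_comp cu; exact: continuous_expR.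
have le : Int (fun x : 'rV[R]_N => expR a * (1 - a) * (1 * bump 2 l (sqn x)) +
     expR a * (u x * bump 2 l (sqn x))) <= ball_moment 2 (fun x => expR (u x)) l.
  apply: le_Int; [by apply: CcD; exact: CcZ|exact: CcMl|move=> x].
  have -> : expR (u x) = expR a * expR (u x - a) by rewrite -expRD addrC subrK.
  rewrite mul1r mulrA -mulrDl ler_wpM2r ?bump_ge0// -mulrDr ler_wpM2l ?expR_ge0//.
  by apply: le_trans (expR_ge1Dx _); rewrite addrA addrAC.
rewrite IntD in le; [|exact: CcZ|exact: CcZ].
rewrite (IntZ _ C1) (IntZ _ Cu) in le.
apply: le_trans (ler_wpM2l w0 le).
rewrite mulrDr ![l ^- _ * (_ * _)]mulrCA.
rewrite -/(ball_moment 2 u l) -/U -[Int _]/(ball_moment 2 (cst 1) l).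
rewrite (ball_moment_cst l0) le_eqVlt; apply/orP; left; apply/eqP.
by rewrite -/a /a; field; rewrite gt_eqF// c0_gt0.
Qed.

(** Here [w] is the Laplacian of [u], hence -v; stability enters only through the existence of [psi]
    and [D] for each large l. *)
Lemma no_rellich_solution (u : 'rV[R]_N -> R) (d1u d2u d1w d2w : 'I_N -> 'rV[R]_N -> R)
    (A C : R) :
  let w := fun x => \sum_i d2u i x in
  C2of u d1u d2u -> C2of w d1w d2w ->
  (forall x, \sum_i d2w i x = expR (u x)) ->
  1 <= A -> 0 <= C ->
  (forall l, 1 < l -> 2 * A <= l ^+ 2 ->
    exists psi D, rellich_test A C l (fun x => expR (u x)) psi D) ->
  (forall e, 0 < e -> exists L, forall l, L <= l ->
    - e <= l ^- (N + 6) * ball_moment 3 w l) ->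
  False.
Proof.
move=> w Cu Cw we A1 C0 test winf.
have [cu _ _ _ _] := Cu.
pose f x := expR (u x).
have cf : continuous f by apply: cont_comp cu; exact: continuous_expR.
have [C5 psiB] := rellich_test_bound f A1 C0.
pose l0 := 2 * A.
have l01 : 1 < l0 by rewrite /l0; lra.
have l0l l : l0 < l -> [/\ 1 < l, 0 < l & 2 * A <= l ^+ 2].
  by rewrite /l0 => ll; split; [lra|lra|nra].
pose I2 := Int (fun x => f x * bump 1 (2 * A) (sqn x)).
have CI2 : Cc (fun x => f x * bump 1 (2 * A) (sqn x)) by apply: CcMl => //; exact: Cc_bump.
have I20 : 0 <= I2 by apply: Int_ge0 => x; rewrite mulr_ge0 ?expR_ge0 ?bump_ge0.
pose U l := l ^- (N + 4) * ball_moment 2 u l.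
pose W l := l ^- (N + 6) * ball_moment 3 w l.
pose E l := l ^- (N + 8) * ball_moment 4 f l.
pose Q l := Int (fun x => f x * kern p rp l (sqn x)).
have c_gt0 := @c0_gt0 R N.
have q'0 : 0 <= q' by apply: mulr_ge0; [apply: divr_ge0 => //; exact: ltW|exact: ltW].
have rp1 : 0 <= rp 1.
  by rewrite /rp; apply: r4_ge0 => //; exact: lt_le_trans p0.
(* The kernel is at most [rp 1 * psi] on the annulus. On the core [|x|^2 <= 2 A] it is at most 32,
   twice the bound 16 of [r4_le], and the bump is at least 1 there. *)
have Qle l : l0 < l -> Q l <= rp 1 * q' * ln l + (rp 1 * C5 + 32 * I2).
  move=> ll; have [l1 lp lA] := l0l l ll; have l1' := ltW l1.
  have [psi [D T]] := test l l1 lA; have PB := psiB l psi D l1 lA T.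
  have [[Cpsi _ psi0 psiE _] _] := T.
  have Cfp : Cc (fun x => f x * psi x) by exact: CcMl.
  apply: (@le_trans _ _ (Int (fun x => rp 1 * (f x * psi x) +
     32 * (f x * bump 1 (2 * A) (sqn x))))).
    apply: le_Int; [by apply: CcMl => //; exact: Cc_kern|by apply: CcD; exact: CcZ|].
    move=> x; have f0 : 0 <= f x by exact: expR_ge0.
    have -> : rp 1 * (f x * psi x) + 32 * (f x * bump 1 (2 * A) (sqn x)) =
        f x * (rp 1 * psi x + 32 * bump 1 (2 * A) (sqn x)) by ring.
    apply: ler_wpM2l => //.
    have t1 : 0 <= rp 1 * psi x by rewrite mulr_ge0.
    have t2 := @bump_ge0 R 1 (2 * A) (sqn x).
    have [sA|As] := leP (sqn x) (2 * A).
      have kb := @kern_bound R p rp 16 l (sqn x) (fun z => r4_le p0) l1' (sqn_ge0 x).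
      have := bump_ge1 A1 sA; have := ler_norm (kern p rp l (sqn x)).
      by lra.
    have [sl|ls] := leP (sqn x) (l ^+ 2); last first.
      by rewrite kern_eq0// ?(ltW ls)// addr_ge0// mulr_ge0.
    have range : 2 * A <= sqn x <= l ^+ 2 by rewrite (ltW As).
    by rewrite psiE//; have := kern_rellich_le A1 l1' range; lra.
  rewrite (IntD (CcZ _ Cfp) (CcZ _ CI2)) (IntZ _ Cfp) (IntZ _ CI2) -/I2.
  have := ler_wpM2l rp1 PB; rewrite mulrDr mulrA; lra.
have [C8 Ule] : exists C', forall l, l0 < l -> C' - rp 1 * q' / 96 * ln l <= U l.
  apply: (@radial_ode_lower_bound R U W E Q (rp 1 * q') (rp 1 * C5 + 32 * I2)).
  - exact: ltW.
  - by rewrite mulr_ge0.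
  - move=> l ll; have [_ lp _] := l0l l ll.
    have h := is_derive_ball_avg 0 Cu lp.
    by apply: (is_derive_eq h); rewrite /W; congr (_ / _ * _); ring.
  - move=> l ll; have [_ lp _] := l0l l ll.
    have h := is_derive_ball_avg 1 Cw lp.
    apply: (is_derive_eq h); rewrite /E /f.
    have -> : (fun x => \sum_i d2w i x) = (fun x => expR (u x)) by apply/funext.
    by congr (_ / _ * _); ring.
  - move=> l ll; have [l1 lp _] := l0l l ll.
    have h := @derive_Int_kern R N p 3 rp (r4' p%:R) f l drp
      (fun z => r4_ode z (lt_le_trans ltr01 p0)) cf l1.
    apply: (is_derive_eq h); rewrite /E mulrA; congr (_ * _).
    rewrite N8E.
    by rewrite (exprD _ 3) invfM mulrA mulfV ?mul1r// expf_neq0// gt_eqF.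
  - exact: Qle.
  - exact: winf.
(* On the annulus [|x| <= l] gives [psi = |x|^-(N-4) >= l^-(N-4)], so [l^N psi] dominates the
   weight, which is at most [l^4]; on the core [l^4] times the bump does. *)
have fle l : l0 < l ->
    l ^- (N + 4) * ball_moment 2 f l <= l ^- 4 * (q' * ln l + (C5 + I2)).
  move=> ll; have [l1 lp lA] := l0l l ll; have l1' := ltW l1.
  have [psi [D T]] := test l l1 lA; have PB := psiB l psi D l1 lA T.
  have [[Cpsi _ psi0 psiE _] _] := T.
  have Cfp : Cc (fun x => f x * psi x) by exact: CcMl.
  have h : ball_moment 2 f l <= l ^+ N * Int (fun x => f x * psi x) + l ^+ 4 * I2.
    rewrite -(IntZ _ Cfp) -(IntZ _ CI2) -(IntD (CcZ _ Cfp) (CcZ _ CI2)).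
    apply: le_Int; [by apply: CcMl => //; exact: Cc_bump|by apply: CcD; exact: CcZ|].
    move=> x; have f0 : 0 <= f x by exact: expR_ge0.
    have -> : l ^+ N * (f x * psi x) + l ^+ 4 * (f x * bump 1 (2 * A) (sqn x)) =
        f x * (l ^+ N * psi x + l ^+ 4 * bump 1 (2 * A) (sqn x)) by ring.
    apply: ler_wpM2l => //.
    have lN0 : 0 <= l ^+ N by rewrite exprn_ge0// ltW.
    have l40 : 0 <= l ^+ 4 by rewrite exprn_ge0// ltW.
    have t1 : 0 <= l ^+ N * psi x by rewrite mulr_ge0.
    have t2 : 0 <= l ^+ 4 * bump 1 (2 * A) (sqn x) by rewrite mulr_ge0 ?bump_ge0.
    have bl : bump 2 l (sqn x) <= l ^+ 4.
      rewrite (exprM l 2 2) lerXn2r ?nnegrE ?le_max ?lexx ?sqr_ge0//.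
      by rewrite ge_max sqr_ge0/= lerBlDr lerDl sqn_ge0.
    have [sA|As] := leP (sqn x) (2 * A).
      have := ler_wpM2l l40 (bump_ge1 A1 sA); rewrite mulr1; lra.
    have [sl|ls] := leP (sqn x) (l ^+ 2); last first.
      by rewrite bump_eq0// ?(ltW ls)// addr_ge0.
    have range : 2 * A <= sqn x <= l ^+ 2 by rewrite (ltW As).
    apply: (le_trans bl); rewrite -[leLHS]addr0 lerD// psiE//.
    have e0 : 0 < enorm x by rewrite enormE sqrtr_gt0; lra.
    rewrite ler_pdivlMr ?exprn_gt0//.
    have -> : l ^+ N = l ^+ 4 * l ^+ p by rewrite -exprD /p subnKC.
    rewrite ler_wpM2l// lerXn2r ?nnegrE ?(ltW e0) ?(ltW lp)//.
    by rewrite -ler_sqr ?nnegrE ?(ltW e0) ?(ltW lp)// sqr_enorm.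
  have w0 : 0 <= l ^- (N + 4) by rewrite invr_ge0 exprn_ge0// ltW.
  apply: (le_trans (ler_wpM2l w0 h)).
  have lN0 : l ^+ N != 0 by rewrite expf_neq0// gt_eqF.
  have l40 : l ^+ 4 != 0 by rewrite expf_neq0// gt_eqF.
  have -> : l ^- (N + 4) * (l ^+ N * Int (fun x => f x * psi x) + l ^+ 4 * I2) =
     l ^- 4 * Int (fun x => f x * psi x) + l ^- N * I2.
    rewrite exprD; move: (l ^+ N) (l ^+ 4) lN0 l40 => a b a0 b0.
    by field; rewrite a0 b0.
  rewrite addrA [leRHS]mulrDr lerD//.
    by apply: ler_wpM2l => //; rewrite invr_ge0 exprn_ge0// ltW.
  rewrite ler_wpM2r// lef_pV2 ?posrE ?exprn_gt0//.
  by rewrite ler_weXn2l.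
(* [l^4] beats the power of l lost in [exp (U / c0)]. The bound [N <= 12] is used here. *)
have dpos : 0 < 4 - rp 1 * q' / 96 / @c0 R N.
  rewrite subr_gt0 /q'.
  have -> : rp 1 * (H / rN 1 * @c0 R N) / 96 / @c0 R N = rp 1 * H / rN 1 / 96.
    move: (rN 1) rN1 (rp 1) (@c0 R N) c_gt0 => r r0 s c cp.
    by field; rewrite !gt_eqF.
  rewrite /rp pE; apply: critical_dimension.
  by case/andP: N5 => ? ?; rewrite !ler_nat; apply/andP.
apply: (@exp_linear_contradiction R (4 - rp 1 * q' / 96 / @c0 R N)
  (@c0 R N * expR (C8 / @c0 R N)) q' (C5 + I2) (ln l0)) => //.
  by rewrite mulr_gt0// expR_gt0.
(* With [l = exp t] and after multiplication by [l^4], the two estimates oppose an exponential in t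
   to an affine function. *)
move=> t tl; pose l := expR t.
have ll : l0 < l.
  by rewrite -[ltLHS]lnK ?posrE ?(lt_trans ltr01)// ltr_expR.
have [l1 lp _] := l0l l ll.
have lnl : ln l = t by rewrite /l expRK.
have := le_trans (weighted_jensen cu lp) (fle l ll); rewrite lnl -/(U l) => h.
have h2 : @c0 R N * expR ((C8 - rp 1 * q' / 96 * t) / @c0 R N) <=
    l ^- 4 * (q' * t + (C5 + I2)).
  apply: le_trans h; rewrite ler_pM2l// ler_expR ler_pM2r ?invr_gt0//.
  by have := Ule l ll; rewrite lnl.
have l4 : 0 < l ^+ 4 by rewrite exprn_gt0.
have := ler_wpM2l (ltW l4) h2; rewrite [X in _ <= X]mulrA mulfV ?gt_eqF// mul1r.
apply: le_trans; rewrite le_eqVlt; apply/orP; left; apply/eqP.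
rewrite /l -expRM_natl -mulrA -expRD [RHS]mulrCA -expRD; congr (_ * expR _).
by field; rewrite gt_eqF.
Qed.

End core.

(** * Integration under dilations and restrictions *)

Section dilation.
Context {R : realType}.
Local Notation mu := (@lebesgue_measure R).
Local Open Scope ereal_scope.

Lemma measurable_scale1 (a : R) : measurable_fun setT (fun t : measurableTypeR R => (a * t)%R : measurableTypeR R).
Proof. exact: measurable_funM. Qed.

(** The image of Lebesgue measure under [t -> a t], multiplied by [a], gives every half-open
    interval its length, hence is Lebesgue measure. *)
Lemma ge0_integral_scale1 (a : R) (k : R -> \bar R) : (0 < a)%R ->
  measurable_fun setT k -> (forall t, 0 <= k t) ->
  \int[mu]_t k t = a%:E * \int[mu]_t k (a * t)%R.
Proof.
move=> a0 mk k0.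
have an : (0 <= a)%R := ltW a0.
pose nu := mscale (NngNum an) (image_measure mu (measurable_scale1 a)).
have nuE A : measurable A -> mu A = nu A.
  apply: (@lebesgue_measure_unique R nu) => X [[b c] _ <-]/=.
  rewrite /nu /mscale/= /image_measure /pushforward.
  rewrite (_ : _ @^-1` _ = [set` `](b / a)%R, (c / a)%R]]); last first.
    by apply/seteqP; split => t /=; rewrite !in_itv/= ltr_pdivrMr// ler_pdivlMr// mulrC.
  rewrite !lebesgue_measure_itv/= !lte_fin ltr_pM2r ?invr_gt0//.
  case: ifPn => bc; last by rewrite mule0.
  by rewrite -!EFinD -EFinM; congr EFin; field; rewrite gt_eqF.
rewrite (eq_measure_integral nu); last by move=> A mA _; exact: nuE.
rewrite ge0_integral_mscale//.
have := @ge0_integral_pushforward _ _ _ _ _ _ (measurable_scale1 a) mu setT k measurableT mk.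
by rewrite preimage_setT => <- // y _.
Qed.

Lemma ge0_integral_dilation n (a : R) (h : 'rV[R]_n -> \bar R) : (0 < a)%R ->
  measurable_fun setT h -> (forall x, 0 <= h x) ->
  \int[lebesgue_rV n]_x h x = (a ^+ n)%:E * \int[lebesgue_rV n]_x h (a *: x).
Proof.
move=> a0; elim: n h => [|n IH] h mh h0.
  rewrite expr0 mul1e; apply: eq_integral => x _; congr h.
  by apply/rowP => -[].
have mZ m : measurable_fun setT (fun x : 'rV[R]_m => a *: x).
  apply: measurable_fun_coorP => i; under eq_fun do rewrite mxE.
  by apply: measurable_funM => //; exact: measurable_coor.
have mc := measurable_fun_cons mh.
rewrite [LHS]ge0_integral_rVS// [in RHS]ge0_integral_rVS//; last first.
  by apply: (measurableT_comp mh); exact: mZ.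
have E (t : measurableTypeR R) y : a *: cons_rV (t, y) = @cons_rV R n ((a * t)%R, a *: y).
  apply/rowP => j; rewrite mxE.
  by case: (unliftP ord0 j) => [i ->|->]; rewrite ?cons_rVS ?cons_rV0 ?mxE.
under [in RHS]eq_integral do under eq_integral do rewrite E.
pose k (t : R) := \int[lebesgue_rV n]_y h (cons_rV (t, y)).
have mk : measurable_fun setT k.
  by apply: (measurable_fun_fubini_tonelli_F (m2 := lebesgue_rV n) _ mc) => z; exact: h0.
have k0 t : 0 <= k t by apply: integral_ge0.
rewrite [LHS](ge0_integral_scale1 a0 mk k0) exprS EFinM -muleA; congr (_ * _).
have a_ge0 : 0 <= (a ^+ n)%:E by rewrite lee_fin exprn_ge0// ltW.
have mhs (t : R) : measurable_fun setT (fun y : 'rV[R]_n => h (cons_rV (t, y))).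
  by apply: (measurableT_comp mc); exact: measurable_pair1.
have mks : measurable_fun setT (fun t : measurableTypeR R => k (a * t)%R).
  by apply: (measurableT_comp mk); exact: measurable_scale1.
rewrite -ge0_integralZl//.
- by apply: eq_integral => t _; rewrite /k (IH (fun y => h (cons_rV ((a * t)%R, y)))).
- have mh2 : measurable_fun setT (fun z : measurableTypeR R * 'rV[R]_n =>
      h (cons_rV ((a * z.1)%R, a *: z.2))).
    apply: (measurableT_comp mc); apply/measurable_fun_pairP; split.
      by apply: (measurableT_comp (measurable_scale1 a)); exact: measurable_fst.
    by apply: (measurableT_comp (mZ n)); exact: measurable_snd.
  by apply: (measurable_fun_fubini_tonelli_F (m2 := lebesgue_rV n) _ mh2) => z; exact: h0.
- by move=> t _; exact: integral_ge0.
Qed.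

Lemma ge0_integral_mrestr d (T : measurableType d) (m : {measure set T -> \bar R})
    (D : set T) (mD : measurable D) (f : T -> \bar R) :
  measurable_fun setT f -> (forall x, 0 <= f x) ->
  \int[mrestr m mD]_x f x = \int[m]_(x in D) f x.
Proof.
move=> mf f0; have mDC := measurableC mD.
rewrite -[in LHS](setUv D) ge0_integral_setU//=; last 2 first.
- by rewrite setUv.
- exact/disj_setPCl.
rewrite [X in _ + X](_ : _ = 0) ?adde0; last first.
  apply: null_set_integral => //.
  - exact: measurable_funTS.
  - by rewrite -[LHS]/(m (~` D `&` D)) setICl measure0.
by apply: eq_measure_integral => A mA AD; rewrite -[LHS]/(m (A `&` D)) setIidl.
Qed.

End dilation.

(** * Polar coordinates for the cone-type surface measure *)

Section polar.
Context {R : realType} {n : nat}.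
Local Notation mu := (@lebesgue_measure R).
Local Notation mun := (@lebesgue_rV R n).
Implicit Types (f g h : 'rV[R]_n -> R).

(** For [r > 0] its integral in x is [1 / n] times the integral of [h] over the sphere of radius r
    for [sphere_measure]. The origin is left out because [radial_proj] does not send it to the
    sphere. *)
Definition shell h (r : R) (x : 'rV[R]_n) : R :=
  if 0 < enorm x < r then r^-1 * h (radial_proj r x) else 0.

(** What [shell] becomes under [r = t |x|]: [dr / r] turns into [dt / t], and [|x| < r] into
    [t > 1], with the end point added. *)
Definition ray h (t : R) (x : 'rV[R]_n) : R :=
  if (0 < enorm x) && (1 <= t) then t^-1 * h (t *: x) else 0.

Definition punctured h (x : 'rV[R]_n) : R := if 0 < enorm x then h x else 0.

Lemma measurable_inv : measurable_fun setT (fun t : measurableTypeR R => t^-1 : measurableTypeR R).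
Proof.
rewrite (_ : (fun t => _) = fun t : measurableTypeR R =>
    if 0 <= t then t `^ (-1) else - ((- t) `^ (-1))); last first.
  apply/funext => t; case: ifPn => t0; first by rewrite powR_inv1.
  by rewrite powR_inv1 ?invrN ?opprK// oppr_ge0 ltW// ltNge.
have mp : measurable_fun setT (fun t : measurableTypeR R => t `^ (-1)).
  exact: measurable_powR.
apply: measurable_fun_ifT => //; first exact: measurable_fun_ler.
have mn : measurable_fun setT (fun t : measurableTypeR R => - t : measurableTypeR R).
  by apply: measurable_funN; exact: measurable_id.
by apply: measurable_funN; exact: (measurableT_comp mp mn).
Qed.

Lemma measurable_scale_pair : measurable_fun setT
  (fun z : measurableTypeR R * 'rV[R]_n => z.1 *: z.2).
Proof.
apply: measurable_fun_coorP => i; under eq_fun do rewrite mxE.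
apply: measurable_funM; first exact: measurable_fst.
by apply: (measurableT_comp (measurable_coor i)); exact: measurable_snd.
Qed.

Let menorm2 : measurable_fun setT (fun z : measurableTypeR R * 'rV[R]_n => enorm z.2).
Proof. by apply: (measurableT_comp (@measurable_enorm R n)); exact: measurable_snd. Qed.

Lemma measurable_shell h : continuous h -> measurable_fun setT
  (fun z : measurableTypeR R * 'rV[R]_n => (shell h z.1 z.2)%:E).
Proof.
move=> /continuous_measurable_rV mh; apply/measurable_EFinP.
apply: measurable_fun_ifT => //.
  apply: measurable_and; apply: measurable_fun_ltr => //; exact: measurable_fst.
apply: measurable_funM.
  by apply: (measurableT_comp measurable_inv); exact: measurable_fst.
apply: (measurableT_comp mh); apply: measurable_fun_coorP => i.
under eq_fun do rewrite mxE.
apply: measurable_funM; last first.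
  by apply: (measurableT_comp (measurable_coor i)); exact: measurable_snd.
apply: measurable_funM; first exact: measurable_fst.
by apply: (measurableT_comp measurable_inv).
Qed.

Lemma measurable_ray h : continuous h -> measurable_fun setT
  (fun z : measurableTypeR R * 'rV[R]_n => (ray h z.1 z.2)%:E).
Proof.
move=> /continuous_measurable_rV mh; apply/measurable_EFinP.
apply: measurable_fun_ifT => //.
  apply: measurable_and; first by apply: measurable_fun_ltr.
  by apply: measurable_fun_ler => //; exact: measurable_fst.
apply: measurable_funM.
  by apply: (measurableT_comp measurable_inv); exact: measurable_fst.
by apply: (measurableT_comp mh); exact: measurable_scale_pair.
Qed.

Lemma shell_ge0 h : (forall x, 0 <= h x) -> forall r x, 0 <= shell h r x.
Proof.
move=> h0 r x; rewrite /shell; case: ifP => // /andP[x0 xr].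
by rewrite mulr_ge0// invr_ge0 ltW// (lt_trans x0).
Qed.

Lemma ray_ge0 h : (forall x, 0 <= h x) -> forall t x, 0 <= ray h t x.
Proof.
move=> h0 r x; rewrite /ray; case: ifP => // /andP[x0 xr].
by rewrite mulr_ge0// invr_ge0 (le_trans _ xr).
Qed.

(* Substitution r = |x| t. *)
Lemma integral_shell_ray h (x : 'rV[R]_n) : continuous h -> (forall x, 0 <= h x) ->
  (\int[mu]_r (shell h r x)%:E = \int[mu]_t (ray h t x)%:E)%E.
Proof.
move=> ch h0; have [x0|x0] := ltP 0 (enorm x); last first.
  rewrite !integral0_eq// => t _; first by rewrite /ray ltNge x0.
  by rewrite /shell ltNge x0.
set a := enorm x in x0 *.
pose G r : R := r^-1 * h ((r / a) *: x).
have cs : continuous (fun r : R => (r / a) *: x).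
  apply: continuous_coorP => i; under eq_fun do rewrite mxE.
  apply: contM; last exact: cont_cst.
  by apply: contM; [move=> ?; exact: cvg_id|exact: cont_cst].
have cG : {within `[a, +oo[, continuous G}.
  apply: continuous_in_subspaceT => r; rewrite inE/= in_itv/= andbT => ar.
  apply: cvgM; first by apply: cvgV; [rewrite gt_eqF// (lt_le_trans x0)|exact: cvg_id].
  by apply: continuous_comp; [exact: cs|exact: ch].
have mG : measurable_fun `]a, +oo[%classic (EFin \o G).
  apply/measurable_EFinP; apply: open_continuous_measurable_fun => //.
  move=> r; rewrite inE/= in_itv/= andbT => ar.
  apply: cvgM; first by apply: cvgV; [rewrite gt_eqF// (lt_trans x0)|exact: cvg_id].
  by apply: continuous_comp; [exact: cs|exact: ch].
transitivity (\int[mu]_(r in `]a, +oo[%classic) (G r)%:E)%E.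
  rewrite [RHS]integral_mkcond; apply: eq_integral => r _; rewrite patchE.
  rewrite /shell -/a x0/= mem_setE in_itv/= andbT; case: ifP => // ar.
rewrite integral_itv_obnd_cbnd//.
have F1 : (fun t => a * t) 1 = a by rewrite mulr1.
have dF (t : R) : is_derive t 1 (fun t : R => a * t) a.
  have h1 := is_deriveZ_fun a (is_derive_id t 1).
  by apply: (is_derive_eq h1); rewrite mulr1.
have dF1 : (fun t : R => a * t)^`()%classic = cst a.
  by apply/funext => t; rewrite derive1E; case: (dF t).
have := @increasing_ge0_integration_by_substitutiony R (fun t => a * t) G 1.
rewrite F1 dF1 => ->.
- rewrite integral_mkcond; apply: eq_integral => t _; rewrite patchE.
  rewrite /ray -/a x0/= mem_setE in_itv/= andbT; case: ifP => // t1.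
  congr EFin; rewrite /G /= mulrAC; congr (_ * h _).
    change ((a * t)^-1 * a = t^-1).
    by field; rewrite !gt_eqF// (lt_le_trans ltr01).
  by congr (_ *: _); rewrite mulrAC mulfV ?mul1r// gt_eqF.
- by move=> s t _ _ st; rewrite ltr_pM2l.
- by move=> t _; exact: cst_continuous.
- exact: is_cvg_cst.
- exact: is_cvg_cst.
- split; first by move=> t _; case: (dF t).
  by apply: cvg_at_right_filter; exact: (is_derive_cont (dF 1)).
- exact: gt0_cvgMry.
- exact: cG.
- move=> r; rewrite in_itv/= andbT => ar.
  by rewrite mulr_ge0// invr_ge0 ltW// (lt_trans x0).
Qed.

Lemma measurable_punctured h : continuous h ->
  measurable_fun setT (fun x => (punctured h x)%:E).
Proof.
move=> /continuous_measurable_rV mh; apply/measurable_EFinP.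
apply: measurable_fun_ifT => //; apply: measurable_fun_ltr => //.
exact: measurable_enorm.
Qed.

Lemma integral_ray h (t : R) : continuous h -> (forall x, 0 <= h x) ->
  (\int[mun]_x (ray h t x)%:E =
   (if 1 <= t then t ^- n.+1 else 0)%:E * \int[mun]_x (punctured h x)%:E)%E.
Proof.
move=> ch h0; case: ifPn => t1; last first.
  by rewrite mul0e integral0_eq// => x _; rewrite /ray (negbTE t1) andbF.
have t0 : 0 < t by exact: lt_le_trans t1.
have ph0 x : (0 <= (punctured h x)%:E)%E by rewrite lee_fin /punctured; case: ifP.
rewrite (ge0_integral_dilation t0 (measurable_punctured ch) ph0) muleA -EFinM.
have -> : t ^- n.+1 * t ^+ n = t^-1.
  by rewrite exprS; field; rewrite gt_eqF//= expf_neq0// gt_eqF.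
rewrite -ge0_integralZl//; last 2 first.
- apply: (measurableT_comp (measurable_punctured ch)).
  by apply: measurable_fun_coorP => i; under eq_fun do rewrite mxE;
    apply: measurable_funM => //; exact: measurable_coor.
- by rewrite lee_fin invr_ge0 ltW.
apply: eq_integral => x _; rewrite -EFinM; congr EFin.
rewrite /ray t1 andbT /punctured !enormE sqnZ !sqrtr_gt0 pmulr_rgt0 ?exprn_gt0//.
by case: ifP; rewrite ?mulr0.
Qed.

Lemma integral_inv_pow : (0 < n)%N ->
  (\int[mu]_t (if (1 : R) <= t then t ^- n.+1 else 0)%:E = (n%:R^-1)%:E)%E.
Proof.
move=> n0; have nr : n%:R != 0 :> R by rewrite pnatr_eq0 -lt0n.
transitivity (\int[mu]_(t in [set` `[1%R, +oo[%R]) (t ^- n.+1)%:E)%E.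
  rewrite [RHS]integral_mkcond; apply: eq_integral => t _; rewrite patchE.
  by rewrite mem_setE in_itv/= andbT; case: ifP.
pose F (t : R) : R := - n%:R^-1 * t ^- n.
have dF (t : R) : 0 < t -> is_derive t 1 F (t ^- n.+1).
  move=> t0; have h := is_deriveZ_fun (- n%:R^-1) (is_derive_exprVn n t0).
  by apply: (is_derive_eq h); rewrite mulrA mulrNN mulVf// mul1r.
rewrite (@ge0_continuous_FTC2y R (fun t => t ^- n.+1) F 1 0).
- by rewrite /F expr1n invr1 mulr1 sub0e -EFinN opprK.
- by move=> t t1; rewrite invr_ge0 exprn_ge0// (le_trans _ t1).
- apply: continuous_in_subspaceT => t; rewrite inE/= in_itv/= andbT => t1.
  have t0 : 0 < t by exact: lt_le_trans t1.
  exact: (is_derive_cont (is_derive_exprVn n.+1 t0)).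
- rewrite -(mulr0 (- n%:R^-1)); apply: cvgM; first exact: cvg_cst.
  apply/cvgr0Pnorm_lt => e e0; near=> t.
  have t1 : 1 <= t by near: t; exact: nbhs_pinfty_ge.
  have t0 : 0 < t by exact: lt_le_trans t1.
  rewrite ger0_norm ?invr_ge0 ?exprn_ge0 ?(ltW t0)//.
  rewrite invf_plt ?posrE ?exprn_gt0//.
  apply: (@lt_le_trans _ _ t).
    by near: t; apply: nbhs_pinfty_gt; exact: num_real.
  by rewrite -[leLHS]expr1 ler_weXn2l.
- by move=> t t1; case: (dF t (lt_trans ltr01 t1)).
- by apply: cvg_at_right_filter; exact: (is_derive_cont (dF 1 ltr01)).
- move=> t; rewrite in_itv/= andbT => t1.
  by rewrite derive1E; case: (dF t (lt_trans ltr01 t1)).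
Unshelve. all: by end_near. Qed.

(** Polar coordinates without a Jacobian: Tonelli's theorem, the substitution [r = t |x|] for fixed
    x, Tonelli again, and a dilation for fixed t; the factor [1 / n] is the integral of [t^-(n+1)]
    over [t >= 1]. *)
Lemma integral_shell h : (0 < n)%N -> continuous h -> (forall x, 0 <= h x) ->
  (\int[mu]_r \int[mun]_x (shell h r x)%:E =
   (n%:R^-1)%:E * \int[mun]_x (punctured h x)%:E)%E.
Proof.
move=> n0 ch h0.
have -> : (\int[mu]_r \int[mun]_x (shell h r x)%:E =
           \int[mun]_x \int[mu]_r (shell h r x)%:E)%E.
  apply: (fubini_tonelli (fun z : measurableTypeR R * 'rV[R]_n => (shell h z.1 z.2)%:E)).
    exact: measurable_shell.
  by move=> z; rewrite lee_fin shell_ge0.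
under eq_integral do rewrite integral_shell_ray//.
have <- : (\int[mu]_r \int[mun]_x (ray h r x)%:E =
           \int[mun]_x \int[mu]_r (ray h r x)%:E)%E.
  apply: (fubini_tonelli (fun z : measurableTypeR R * 'rV[R]_n => (ray h z.1 z.2)%:E)).
    exact: measurable_ray.
  by move=> z; rewrite lee_fin ray_ge0.
under eq_integral do rewrite integral_ray//.
rewrite ge0_integralZr//; first by rewrite integral_inv_pow.
- apply/measurable_EFinP; apply: measurable_fun_ifT => //.
    exact: measurable_fun_ler.
  apply: (measurableT_comp measurable_inv); exact: measurable_funX.
- move=> t _; rewrite lee_fin; case: ifP => // t1.
  by rewrite invr_ge0 exprn_ge0// (le_trans _ t1).
- by apply: integral_ge0 => x _; rewrite lee_fin /punctured; case: ifP.
Qed.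

(** A comparison on every sphere integrates to a comparison on the whole space. *)
Lemma integral_le_of_shell f g : (0 < n)%N ->
  continuous f -> continuous g -> (forall x, 0 <= f x) -> (forall x, 0 <= g x) ->
  (forall r, 0 < r ->
    (\int[mun]_x (shell f r x)%:E <= \int[mun]_x (shell g r x)%:E)%E) ->
  (\int[mun]_x (punctured f x)%:E <= \int[mun]_x (punctured g x)%:E)%E.
Proof.
move=> n0 cf cg f0 g0 fg.
have n1 : 0 < n%:R^-1 :> R by rewrite invr_gt0 ltr0n.
rewrite -(@lee_pmul2l _ (n%:R^-1)%:E)//.
rewrite -!integral_shell//; apply: ge0_le_integral => //.
- by move=> r _; apply: integral_ge0 => x _; rewrite lee_fin shell_ge0.
- apply: (measurable_fun_fubini_tonelli_F (m2 := mun) _ (measurable_shell cf)) => z.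
  by rewrite lee_fin shell_ge0.
- apply: (measurable_fun_fubini_tonelli_F (m2 := mun) _ (measurable_shell cg)) => z.
  by rewrite lee_fin shell_ge0.
- move=> r _; have [r0|r0] := ltP 0 r; first exact: fg.
  have E h x : shell h r x = 0.
    rewrite /shell; case: ifP => // /andP[x0 xr].
    by have := lt_trans x0 xr; rewrite ltNge r0.
  by under eq_integral do rewrite E; under [leRHS]eq_integral do rewrite E.
Qed.

End polar.

(** * From spherical averages to ball averages *)

Section sphere_average.
Context {R : realType} {n : nat}.
Local Notation mun := (@lebesgue_rV R n).
Implicit Types (v : 'rV[R]_n -> R).

Lemma bounded_on_balls v : continuous v ->
  forall L, exists2 M, 0 <= M & forall x, sqn x <= L -> `|v x| <= M.
Proof.
move=> cv L.
have /compact_bounded[M [_ HM]] := @continuous_compact _ _ _ _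
    (continuous_subspaceT cv) (@compact_rV_box R n (1 + `|L|)).
exists (1 + `|M|); first by rewrite addr_ge0.
move=> x xL; apply: (HM (1 + `|M|)); first by rewrite (le_lt_trans (ler_norm _))// ltrDr.
exists x => // j /=.
rewrite -ler_sqr ?nnegrE// ?addr_ge0// real_normK ?num_real//.
rewrite (le_trans (coor_sqn x j))// (le_trans xL)//.
rewrite (le_trans (ler_norm _))// sqrrD expr1n mul1r.
by rewrite (@le_trans _ _ (`|L| *+ 2)) ?ler_wpMn2l// ?mulr2n ?lerDl//
    addrAC lerDr addr_ge0// sqr_ge0.
Qed.

Lemma enorm_gt0 (x : 'rV[R]_n) : (0 < enorm x) = (x != 0).
Proof.
rewrite enormE sqrtr_gt0 lt0r sqn_ge0 andbT; congr (~~ _).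
apply/eqP/eqP => [x0|->].
  apply/rowP => i; rewrite mxE; apply/eqP.
  by rewrite -sqrf_eq0 eq_le sqr_ge0 andbT -x0 coor_sqn.
by rewrite /sqn big1// => i _; rewrite mxE expr0n.
Qed.

Lemma sqn_radial_proj r (x : 'rV[R]_n) : 0 < enorm x -> sqn (radial_proj r x) = r ^+ 2.
Proof.
move=> x0; rewrite /radial_proj sqnZ -sqr_enorm -exprMn; congr (_ ^+ 2).
by rewrite mulfVK// gt_eqF.
Qed.

Lemma measurable_esphere r : measurable (@esphere R n r).
Proof.
rewrite (_ : esphere r = setT `&` @enorm R n @^-1` [set r]); last by rewrite setTI.
by apply: measurable_enorm => //; exact: measurable_set1.
Qed.

Definition punctured_ball (r : R) : set 'rV[R]_n := [set x | 0 < enorm x < r].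

Lemma measurable_punctured_ball r : measurable (punctured_ball r).
Proof.
rewrite (_ : punctured_ball r = setT `&` @enorm R n @^-1` [set` `]0, r[]).
  by apply: measurable_enorm => //; exact: measurable_itv.
by rewrite setTI; apply/seteqP; split => x /=; rewrite in_itv.
Qed.

Lemma integral_sphere r (f : 'rV[R]_n -> \bar R) : 0 < r ->
  measurable_fun setT f -> (forall x, 0 <= f x)%E ->
  (\int[sphere_measure n r]_(x in esphere r) f x =
   (n%:R / r)%:E * \int[mun]_(x in punctured_ball r) f (radial_proj r x))%E.
Proof.
move=> r0 mf f0; have mE := measurable_esphere r.
rewrite /sphere_measure ge0_integral_mscale//; last exact: measurable_funTS.
rewrite /= ger0_norm ?divr_ge0 ?(ltW r0)//; congr (_ * _)%E.
pose m1 := mrestr mun (@measurable_eball R n r).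
have -> : (\int[image_measure m1 (@measurable_radial_proj R n r)]_(x in esphere r) f x =
   \int[m1]_(x in (@radial_proj R n r) @^-1` (esphere r)) f (radial_proj r x))%E.
  apply: (@ge0_integral_pushforward _ _ _ _ _ _ (@measurable_radial_proj R n r) m1) => //.
  exact: measurable_funTS.
have mp : measurable ((@radial_proj R n r) @^-1` (esphere r)).
  by rewrite -[X in measurable X]setTI; exact: measurable_radial_proj.
rewrite integral_mkcond ge0_integral_mrestr//; last 2 first.
- apply/(measurable_restrictT _ mp); apply: measurable_funTS.
  by apply: (measurableT_comp mf); exact: measurable_radial_proj.
- by move=> x; rewrite patchE; case: ifP.
(* [radial_proj] fixes the origin, which is off the sphere since [r > 0]; hence the punctured
   ball. *)
rewrite -integral_mkcondr (_ : _ `&` _ = punctured_ball r)//.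
apply/seteqP; split => x /=; rewrite /eball /esphere /punctured_ball /=.
  move=> [xr radx]; rewrite xr andbT lt0r enorm_ge0 andbT.
  apply/eqP => x0; move: radx; rewrite /radial_proj x0 invr0 mulr0 scale0r.
  move/eqP; rewrite enormE /sqn big1 ?sqrtr0; last by move=> i _; rewrite mxE expr0n.
  by rewrite lt_eqF.
move=> /andP[x0 xr]; split => //.
by rewrite enormE sqn_radial_proj// sqrtr_sqr ger0_norm// ltW.
Qed.

Lemma punctured_ball_finite r : (mun (punctured_ball r) < +oo)%E.
Proof.
apply: le_lt_trans (@lebesgue_rV_box R n r).
apply: le_measure; rewrite ?inE; [exact: measurable_punctured_ball|exact: measurable_rV_box|].
move=> x /= /andP[x0 xr] i.
have r0 : 0 < r by exact: lt_trans xr.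
rewrite -ler_sqr ?nnegrE ?(ltW r0)// real_normK ?num_real//.
rewrite (le_trans (coor_sqn x i))// -sqr_enorm lerXn2r ?nnegrE ?enorm_ge0 ?(ltW r0)//.
exact: ltW.
Qed.

(** The shift by [M] makes the integrand on the sphere nonnegative, so that the formulas for
    nonnegative integrands apply; the inequality is the one on averages multiplied by the mass of
    the sphere. *)
Lemma sphere_avg_le v (r e M : R) : (0 < n)%N -> continuous v -> 0 < r ->
  (forall x, sqn x = r ^+ 2 -> `|v x| <= M) ->
  sphere_avg v r <= e ->
  (\int[mun]_(x in punctured_ball r) (v (radial_proj r x) + M)%:E <=
   \int[mun]_(x in punctured_ball r) (e + M)%:E)%E.
Proof.
move=> n0 cv r0 vM avg.
pose S := sphere_measure n r.
have mE := measurable_esphere r; have mP := measurable_punctured_ball r.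
have mv := continuous_measurable_rV cv.
have nr0 : 0 < n%:R / r by rewrite divr_gt0// ltr0n.
have onE (x : 'rV[R]_n) : esphere r x -> sqn x = r ^+ 2 by rewrite /esphere/= => <-; rewrite sqr_enorm.
pose f x : R := Num.max 0 (v x + M).
have fE x : esphere r x -> f x = v x + M.
  by move=> /onE/vM; rewrite ler_norml => /andP[+ _] => h; rewrite /f max_r//; lra.
have cf : continuous f.
  apply: cont_comp; first exact: continuous_max0.
  by apply: contD => //; exact: cont_cst.
have mf := continuous_measurable_rV cf.
have f0 x : 0 <= f x by rewrite le_max lexx.
have mu1 := @integral_sphere r (cst 1%E) r0 (measurable_cst _) (fun=> lee01).
rewrite !integral_cst// !mul1e in mu1.
have Sfin : (S (esphere r) < +oo)%E.
  by rewrite [ltLHS]mu1 lte_mul_pinfty ?lee_fin ?ltW// punctured_ball_finite.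
have Sfn : S (esphere r) \is a fin_num by rewrite ge0_fin_numE.
have iv : S.-integrable (esphere r) (EFin \o v).
  apply: measurable_bounded_integrable => //; first exact: measurable_funTS.
  exists M; split; rewrite ?num_real// => y My x Ex.
  exact: (le_trans (vM x (onE x Ex)) (ltW My)).
have iM : S.-integrable (esphere r) (EFin \o cst M).
  apply: measurable_bounded_integrable => //; exact: bounded_cst.
have Iv : fine (\int[S]_(x in esphere r) (f x)%:E)%E =
    \int[S]_(x in esphere r) v x + M * fine (S (esphere r)).
  rewrite -[X in _ + X]Rintegral_cst// -RintegralD//; congr fine.
  by apply: eq_integral => x /set_mem Ex; rewrite fE.
have fpb : (\int[mun]_(x in punctured_ball r) (v (radial_proj r x) + M)%:E =
    \int[mun]_(x in punctured_ball r) (f (radial_proj r x))%:E)%E.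
  apply: eq_integral => x /set_mem/= /andP[x0 xr].
  by rewrite fE// /esphere/= enormE sqn_radial_proj// sqrtr_sqr ger0_norm// ltW.
have sph := integral_sphere r0 (f := EFin \o f) _ _.
have {}sph : (\int[S]_(x in esphere r) (f x)%:E = (n%:R / r)%:E *
   \int[mun]_(x in punctured_ball r) (f (radial_proj r x))%:E)%E.
  by apply: sph; [exact/measurable_EFinP|move=> x; rewrite lee_fin].
rewrite fpb integral_cst// -(@lee_pmul2l _ (n%:R / r)%:E)//.
rewrite -sph muleCA -mu1 -/S.
(* On a sphere of measure zero both sides vanish; otherwise the average can be multiplied out. *)
have [S0|S0] := eqVneq (S (esphere r)) 0%E.
  rewrite S0 mule0 null_set_integral//; exact/measurable_funTS/measurable_EFinP.
have Sgt0 : 0 < fine (S (esphere r)).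
  by rewrite fine_gt0// Sfin andbT lt0e S0 measure_ge0.
have ifin : (\int[S]_(x in esphere r) (f x)%:E)%E \is a fin_num.
  apply: integrable_fin_num => //.
  rewrite (_ : (fun x => _) = EFin \o f)//.
  apply: (eq_integrable _ (fun x => (v x)%:E + (cst M x)%:E)%E) => //.
    by move=> x /set_mem Ex; rewrite /= fE.
  exact: integrableD.
rewrite -(fineK ifin) -(fineK Sfn) -EFinM lee_fin Iv mulrDl lerD2r.
by move: avg; rewrite /sphere_avg -/S mulrC ler_pdivrMr// mulrC.
Qed.

Lemma lebesgue_rV_box0 : (0 < n)%N ->
  mun [set x | forall i, (`|x ord0 i| <= 0)%R] = 0%E.
Proof.
move=> n0; case: n n0 => // m _; rewrite lebesgue_rVS.
pose A : set (measurableTypeR R) := [set` `[(- 0)%R, 0%R]].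
pose B : set 'rV[R]_m := [set x | forall i, (`|x ord0 i| <= 0)%R].
have E : @cons_rV R m @^-1` [set x | forall i, (`|x ord0 i| <= 0)%R] = A `*` B.
  apply/seteqP; split=> -[a y]; rewrite /A /B /=.
    move=> hh; split.
      by have := hh ord0; rewrite cons_rV0 in_itv/= ler_norml.
    by move=> i; have := hh (lift ord0 i); rewrite cons_rVS.
  rewrite in_itv/= -ler_norml => -[ha hy] i.
  by case: (unliftP ord0 i) => [j ->|->]; rewrite ?cons_rVS ?cons_rV0.
rewrite E [LHS](product_measure1E (@lebesgue_measure R) (lebesgue_rV m))//=.
+ rewrite [X in (X * _)%E](_ : _ = 0%E) ?mul0e//.
  by rewrite [LHS]lebesgue_measure_itv/= oppr0 ltxx.
+ exact: measurable_itv.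
+ exact: measurable_rV_box.
Qed.

Lemma integral_punctured (h : 'rV[R]_n -> R) : (0 < n)%N -> continuous h ->
  (forall x, 0 <= h x) ->
  (\int[mun]_x (punctured h x)%:E = \int[mun]_x (h x)%:E)%E.
Proof.
move=> n0 ch h0.
apply: ge0_ae_eq_integral => //.
- exact: measurable_punctured.
- by apply/measurable_EFinP; exact: continuous_measurable_rV.
- by move=> x _; rewrite lee_fin /punctured; case: ifP.
- by move=> x _; rewrite lee_fin.
exists [set x : 'rV[R]_n | forall i, `|x ord0 i| <= 0]; split.
- exact: measurable_rV_box.
- exact: lebesgue_rV_box0.
move=> x /= + i; apply: contra_notP => xi _; congr EFin; rewrite /punctured.
case: ifPn => //; rewrite enorm_gt0 negbK => /eqP x0.
by move: xi; rewrite x0 mxE normr0 lexx.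
Qed.

(** The spheres of radius at least [r0] have averages below [e']; the remaining ball is fixed and
    contributes [O(l^6)], negligible against [l^(n+6)] because [n > 0]. *)
Lemma ball_moment_le v : (0 < n)%N -> continuous v ->
  sphere_avg v r @[r --> +oo] --> (0 : R) ->
  forall e, 0 < e -> exists L, forall l, L <= l ->
    ball_moment 3 v l <= e * l ^+ (n + 6).
Proof.
move=> n0 cv v0 e e0.
have c_gt0 := @c0_gt0 R n.
(* The integral of the weight of exponent 3 is at most [l^(n+6) c0], so this choice uses up half of
   [e]. *)
pose e' := e / (2 * @c0 R n).
have e'0 : 0 < e' by rewrite divr_gt0// mulr_gt0.
have [r1 [_ Hr1]] : \forall r \near +oo, sphere_avg v r <= e'.
  by apply: (cvgr_le 0 v0).
pose r0 := 1 + `|r1|.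
have r01 : 1 <= r0 by rewrite lerDl.
have avg r : r0 <= r -> sphere_avg v r <= e'.
  by move=> rr; apply: Hr1; rewrite (lt_le_trans _ rr)// (le_lt_trans (ler_norm _))// ltrDr.
have [M0 M00 HM0] := bounded_on_balls cv (r0 ^+ 2).
pose k1 (x : 'rV[R]_n) := bump 1 (r0 + 1) (sqn x).
have Ck1 : Cc k1 by exact: Cc_bump.
pose K := M0 * Int k1.
have K0 : 0 <= K by rewrite mulr_ge0// Int_ge0// => x; exact: bump_ge0.
(* Beyond this radius the contribution [K l^6] of the fixed ball is at most [(e / 2) l^(n+6)]. *)
exists (1 + 2 * K / e) => l lL.
have K2 : 0 <= 2 * K / e by apply: divr_ge0; [exact: mulr_ge0|exact: ltW].
have l1 : 1 <= l by rewrite (le_trans _ lL)// lerDl.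
have l0 : 0 < l by exact: lt_le_trans l1.
have [M M_ge0 HM] := bounded_on_balls cv (l ^+ 2).
pose b (x : 'rV[R]_n) := bump 3 l (sqn x).
have Cb : Cc b by exact: Cc_bump.
have C1b : Cc (fun x => 1 * b x) by exact: CcZ.
(* [M] bounds [|v|] on the ball of radius l and makes [f] nonnegative; it depends on l but cancels
   in the end. [M0 * k1] serves the spheres of radius below [r0], where [|v| <= M0] and
   [k1 >= 1]. *)
pose f x := (v x + M) * b x.
pose g x := (e' + M + M0 * k1 x) * b x.
have cf : continuous f by apply: contM; [apply: contD => //; exact: cont_cst|exact: Cb.1].
have cg : continuous g.
  apply: contM; last exact: Cb.1.
  by apply: contD; [exact: cont_cst|apply: contZ; exact: Ck1.1].
have b_ge0 x : 0 <= b x by exact: bump_ge0.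
have k_ge0 x : 0 <= k1 x by exact: bump_ge0.
have f0 x : 0 <= f x.
  rewrite /f /b; have [ls|sl] := leP (l ^+ 2) (sqn x); first by rewrite bump_eq0// mulr0.
  rewrite mulr_ge0 ?bump_ge0//; have := HM x (ltW sl).
  by rewrite ler_norml => /andP[+ _]; lra.
have E0 x : 0 <= e' + M + M0 * k1 x by rewrite !addr_ge0 ?(ltW e'0)// mulr_ge0.
have g0 x : 0 <= g x by rewrite mulr_ge0.
have fg r : 0 < r -> (\int[mun]_x (shell f r x)%:E <= \int[mun]_x (shell g r x)%:E)%E.
  move=> r_gt0.
  have bE x : 0 < enorm x -> b (radial_proj r x) = bump 3 l (r ^+ 2).
    by move=> x0; rewrite /b sqn_radial_proj.
  have [lr|rl] := leP l r.
    rewrite integral0_eq; first by apply: integral_ge0 => x _; rewrite lee_fin shell_ge0.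
    move=> x _; rewrite /shell; case: ifP => // /andP[x0 _].
    rewrite /f bE// bump_eq0 ?mulr0//.
    by rewrite lerXn2r ?nnegrE ?(ltW l0) ?(ltW r_gt0).
  pose B := r^-1 * bump 3 l (r ^+ 2).
  have B0 : 0 <= B by rewrite mulr_ge0 ?bump_ge0// invr_ge0 ltW.
  have mP := measurable_punctured_ball r.
  have shellE (h : 'rV[R]_n -> R) : continuous h ->
      (forall x, punctured_ball r x -> 0 <= h (radial_proj r x)) ->
      (\int[mun]_x (shell (fun x => h x * b x) r x)%:E =
       B%:E * \int[mun]_(x in punctured_ball r) (h (radial_proj r x))%:E)%E.
    move=> ch hp; rewrite -ge0_integralZl//; last first.
    - apply: measurable_funTS; apply/measurable_EFinP.
      apply: (measurableT_comp (continuous_measurable_rV ch)).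
      exact: measurable_radial_proj.
    rewrite [RHS]integral_mkcond; apply: eq_integral => x _; rewrite patchE.
    rewrite /shell; case: ifPn => Px; last by rewrite memNset//; exact/negP.
    rewrite mem_set//; have /andP[x0 _] := Px.
    by rewrite bE// -EFinM /B; congr EFin; ring.
  have sq x : punctured_ball r x -> sqn (radial_proj r x) = r ^+ 2.
    by move=> /andP[x0 _]; exact: sqn_radial_proj.
  have rl2 : r ^+ 2 <= l ^+ 2.
    by rewrite lerXn2r ?nnegrE ?(ltW l0) ?(ltW r_gt0)// ltW.
  rewrite (@shellE (fun x => v x + M)); first last.
  - move=> x Px; have := HM (radial_proj r x); rewrite sq// => /(_ rl2).
    by rewrite ler_norml => /andP[+ _]; lra.
  - by apply: contD => //; exact: cont_cst.
  rewrite (@shellE (fun x => e' + M + M0 * k1 x)); first last.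
  - by move=> x _.
  - by apply: contD; [exact: cont_cst|apply: contZ; exact: Ck1.1].
  rewrite lee_wpmul2l ?lee_fin//.
  have mE : measurable_fun (punctured_ball r) (fun x => (e' + M + M0 * k1 (radial_proj r x))%:E).
    apply: measurable_funTS; apply/measurable_EFinP.
    have ch : continuous (fun x => e' + M + M0 * k1 x).
      by apply: contD; [exact: cont_cst|apply: contZ; exact: Ck1.1].
    apply: (measurableT_comp (continuous_measurable_rV ch)).
    exact: measurable_radial_proj.
  have [rr|rr] := leP r0 r.
    apply: le_trans (sphere_avg_le n0 cv r_gt0 _ (avg r rr)) _.
      by move=> x xr; apply: HM; rewrite xr.
    apply: ge0_le_integral => //.
    - by move=> x _; rewrite lee_fin addr_ge0// ltW.
    - by move=> x _; rewrite lee_fin lerDl mulr_ge0.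
  apply: ge0_le_integral => //.
  - move=> x Px; rewrite lee_fin; have := HM (radial_proj r x); rewrite sq// => /(_ rl2).
    by rewrite ler_norml => /andP[+ _]; lra.
  - apply: measurable_funTS; apply/measurable_EFinP.
    have ch : continuous (fun x => v x + M) by apply: contD => //; exact: cont_cst.
    apply: (measurableT_comp (continuous_measurable_rV ch)).
    exact: measurable_radial_proj.
  - move=> x Px; rewrite lee_fin.
    have r2 : r ^+ 2 <= r0 ^+ 2 by have r0' := lt_trans r_gt0 rr;
        rewrite lerXn2r ?nnegrE ?(ltW r0') ?(ltW r_gt0)// ltW.
    have := HM0 (radial_proj r x); rewrite sq// => /(_ r2) h.
    have k1x : 1 <= k1 (radial_proj r x).
      by rewrite /k1 sq// bumpE ?expr1; nra.
    have h2 : M0 <= M0 * k1 (radial_proj r x) by rewrite ler_peMr.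
    have := ler_norm (v (radial_proj r x)); lra.
have := integral_le_of_shell n0 cf cg f0 g0 fg.
rewrite !integral_punctured//.
have Cvb : Cc (fun x => v x * b x) by exact: CcMl.
have Ckb : Cc (fun x => k1 x * b x) by apply: CcMl => //; exact: Ck1.1.
have fE : f = fun x => v x * b x + M * (1 * b x).
  by apply/funext => x; rewrite /f; ring.
have gE : g = fun x => (e' + M) * (1 * b x) + M0 * (k1 x * b x).
  by apply/funext => x; rewrite /g; ring.
have Cf : Cc f by rewrite fE; apply: CcD => //; exact: CcZ.
have Cg : Cc g by rewrite gE; apply: CcD; exact: CcZ.
rewrite -!EFin_Int// lee_fin fE gE.
rewrite (IntD Cvb (CcZ _ C1b)) (IntD (CcZ _ C1b) (CcZ _ Ckb)).
rewrite !(IntZ _ C1b) (IntZ _ Ckb) -/(ball_moment 3 v l).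
have I1 : Int (fun x => 1 * b x) <= l ^+ 2 * (l ^+ (n + 4) * @c0 R n).
  have -> : l ^+ (n + 4) * @c0 R n = @ball_moment R n 2 (cst 1) l.
    by rewrite -(ball_moment_cst l0) mulrA mulfV ?mul1r// expf_neq0// gt_eqF.
  rewrite -IntZ; last by apply: CcMl; [exact: cont_cst|exact: Cc_bump].
  apply: le_Int => //; first by apply: CcZ; apply: CcMl; [exact: cont_cst|exact: Cc_bump].
  move=> x; rewrite !mul1r /b; have [ls|sl] := leP (l ^+ 2) (sqn x).
    by rewrite !bump_eq0// mulr0.
  rewrite !bumpE ?(ltW sl)// exprS ler_wpM2r ?sqr_ge0//.
  by rewrite lerBlDr lerDl sqn_ge0.
have I2 : Int (fun x => k1 x * b x) <= l ^+ 6 * Int k1.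
  rewrite -IntZ//; apply: le_Int => //; first exact: CcZ.
  move=> x; rewrite mulrC ler_wpM2r// /b (exprM l 2 3).
  rewrite lerXn2r ?nnegrE ?le_max ?lexx ?sqr_ge0// ge_max sqr_ge0/=.
  by rewrite lerBlDr lerDl sqn_ge0.
have I3 : e' * (l ^+ 2 * (l ^+ (n + 4) * @c0 R n)) = e / 2 * l ^+ (n + 6).
  rewrite /e' (_ : n + 6 = 2 + (n + 4))%N; last by rewrite addnCA.
  rewrite (exprD _ 2 (n + 4)); move: (l ^+ (n + 4)) (@c0 R n) c_gt0 => z c c_pos.
  by field; rewrite gt_eqF.
have I4 : M0 * (l ^+ 6 * Int k1) <= e / 2 * l ^+ (n + 6).
  have -> : e / 2 * l ^+ (n + 6) = l ^+ 6 * (e / 2 * l ^+ n) by rewrite exprD; ring.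
  rewrite mulrCA -/K; apply: ler_wpM2l; first by rewrite exprn_ge0// ltW.
  apply: (@le_trans _ _ (e / 2 * l)).
    rewrite mulrC -ler_pdivrMr ?divr_gt0//.
    rewrite (le_trans _ lL)// (_ : K / (e / 2) = 2 * K / e) ?lerDr//.
    by field; rewrite gt_eqF.
  by rewrite ler_wpM2l ?divr_ge0 ?(ltW e0)// -[leLHS]expr1 ler_weXn2l.
have J1 := ler_wpM2l (ltW e'0) I1; have J2 := ler_wpM2l M00 I2.
rewrite I3 in J1; rewrite mulrDl; move: (Int _) J1 J2 I4 => A J1 J2 I4 H.
by move: H J1 J2 I4; move: (M0 * Int _) => X; lra.
Qed.

End sphere_average.

(** * Smooth functions of one variable and cutoffs *)

Section smooth_line.
Context {R : realType}.
Implicit Types (f g : R -> R) (C : set (R -> R)).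

(* Coinductive form of C^oo, which avoids iterated derivatives. *)
Definition derive_closed C := forall g, C g ->
  exists2 g', C g' & forall x : R, is_derive x 1 g (g' x).

Definition smooth f := exists2 C, derive_closed C & C f.

Inductive alg_gen C : (R -> R) -> Prop :=
| alg_in f : C f -> alg_gen C f
| alg_cst a : alg_gen C (fun=> a)
| alg_add f g : alg_gen C f -> alg_gen C g -> alg_gen C (fun x => f x + g x)
| alg_mul f g : alg_gen C f -> alg_gen C g -> alg_gen C (fun x => f x * g x).

(** By the sum and Leibniz rules the generated algebra is closed under differentiation once the
    generators have their derivatives in it. The inverse is the typical case: the derivative of
    [1 / f] is a polynomial in [1 / f] and f'. *)
Lemma alg_gen_smooth C :
  (forall g, C g -> exists2 g', alg_gen C g' & forall x : R, is_derive x 1 g (g' x)) ->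
  forall f, alg_gen C f -> smooth f.
Proof.
move=> CC f Cf; exists (alg_gen C) => // {f Cf} g.
elim=> {g} [f /CC//|a|f g Cf [f' Cf' df] Cg [g' Cg' dg]|f g Cf [f' Cf' df] Cg [g' Cg' dg]].
- by exists (fun=> 0); [exact: alg_cst|move=> x; exact: is_derive_cst].
- exists (fun x => f' x + g' x); first exact: alg_add.
  by move=> x; exact: is_deriveD_fun.
- exists (fun x => f' x * g x + f x * g' x); last by move=> x; exact: is_deriveM_fun.
  by apply: alg_add; exact: alg_mul.
Qed.

Lemma smooth_closed : derive_closed smooth.
Proof.
move=> f [C CC Cf]; have [f' Cf' df] := CC f Cf.
by exists f' => //; exists C.
Qed.

Lemma alg_smooth f : alg_gen smooth f -> smooth f.
Proof.
apply: alg_gen_smooth => g /smooth_closed[g' sg' dg].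
by exists g' => //; exact: alg_in.
Qed.

Lemma smooth_cst (a : R) : smooth (fun=> a).
Proof. by apply: alg_smooth; exact: alg_cst. Qed.

Lemma smoothD f g : smooth f -> smooth g -> smooth (fun x => f x + g x).
Proof. by move=> sf sg; apply: alg_smooth; apply: alg_add; exact: alg_in. Qed.

Lemma smoothM f g : smooth f -> smooth g -> smooth (fun x => f x * g x).
Proof. by move=> sf sg; apply: alg_smooth; apply: alg_mul; exact: alg_in. Qed.

Lemma smoothB f g : smooth f -> smooth g -> smooth (fun x => f x - g x).
Proof.
move=> sf sg; have := smoothD sf (smoothM (smooth_cst (-1)) sg).
by under eq_fun do rewrite mulN1r.
Qed.

Lemma smooth_id : smooth id.
Proof.
exists [set g | g = id \/ exists a : R, g = fun=> a]; last by left.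
move=> g [->|[a ->]].
  by exists (fun=> 1) => [|x]; [right; exists 1|exact: is_derive_id].
by exists (fun=> 0) => [|x]; [right; exists 0|exact: is_derive_cst].
Qed.

Lemma smooth_derive f : smooth f -> smooth (fun x : R => 'D_1 f x).
Proof.
move=> /smooth_closed[f' sf' df].
by rewrite (_ : (fun x => _) = f')//; apply/funext => x; case: (df x).
Qed.

Lemma smooth_is_derive f (x : R) : smooth f -> is_derive x 1 f ('D_1 f x).
Proof. by move=> /smooth_closed[f' _ df]; apply: derivableP; case: (df x). Qed.

Lemma smooth_continuous f : smooth f -> continuous f.
Proof. by move=> sf x; exact: (is_derive_cont (smooth_is_derive x sf)). Qed.

Lemma smooth_comp f g : smooth f -> smooth g -> smooth (fun x => f (g x)).
Proof.
move=> sf sg.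
pose C h := smooth h \/ exists2 f, smooth f & h = fun x => f (g x).
apply: (@alg_gen_smooth C); last by apply: alg_in; right; exists f.
move=> k [h_smooth|[h sh ->]].
  have [h' sh' dh] := smooth_closed h_smooth.
  by exists h' => //; apply: alg_in; left.
have [h' sh' dh] := smooth_closed sh; have [g' sg' dg] := smooth_closed sg.
exists (fun x => h' (g x) * g' x); last by move=> x; exact: is_derive_chain.
by apply: alg_mul; apply: alg_in; [right; exists h'|left].
Qed.

Lemma smooth_expR : smooth (@expR R).
Proof. by exists [set expR] => // g ->; exists expR => // x; exact: is_derive_expR. Qed.

Lemma smoothV f : smooth f -> (forall x, f x != 0) -> smooth (fun x => (f x)^-1).
Proof.
move=> sf f0; have [f' sf' df] := smooth_closed sf.
pose C h := smooth h \/ h = fun x => (f x)^-1.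
apply: (@alg_gen_smooth C); last by apply: alg_in; right.
move=> k [h_smooth|->].
  have [h' sh' dh] := smooth_closed h_smooth.
  by exists h' => //; apply: alg_in; left.
exists (fun x => -1 * ((f x)^-1 * (f x)^-1) * f' x).
  apply: alg_mul; last by apply: alg_in; left.
  apply: alg_mul; first exact: alg_cst.
  by apply: alg_mul; apply: alg_in; right.
move=> x; have h := is_deriveV_fun (f0 x) (df x).
by apply: (is_derive_eq h); rewrite expr2 invfM mulN1r.
Qed.

Lemma smooth_ln f : smooth f -> (forall x, 0 < f x) -> smooth (fun x => ln (f x)).
Proof.
move=> sf f0; have [f' sf' df] := smooth_closed sf.
have sV : smooth (fun x => (f x)^-1) by apply: smoothV => // x; rewrite gt_eqF.
pose C h := smooth h \/ h = fun x => ln (f x).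
apply: (@alg_gen_smooth C); last by apply: alg_in; right.
move=> k [h_smooth|->].
  have [h' sh' dh] := smooth_closed h_smooth.
  by exists h' => //; apply: alg_in; left.
exists (fun x => (f x)^-1 * f' x); first by apply: alg_mul; apply: alg_in; left.
by move=> x; exact: (is_derive_chain (is_derive1_ln (f0 x)) (df x)).
Qed.

(** Induction along Horner's scheme: half of the exponent absorbs the new factor [y], the other half
    the polynomial already treated. *)
Lemma poly_expR_bound (P : {poly R}) (e : R) : 0 < e ->
  exists2 K, 0 <= K & forall y, 0 <= y -> `|P.[y]| <= K * expR (e * y).
Proof.
elim/poly_ind: P e => [|P c IH] e e0.
  by exists 0 => // y y0; rewrite horner0 normr0 mul0r.
have e2 : 0 < e / 2 by rewrite divr_gt0.
have [K K0 HK] := IH _ e2.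
exists (K * (2 / e) + `|c|); first by rewrite addr_ge0// mulr_ge0// divr_ge0// ltW.
move=> y y0; rewrite hornerMXaddC (le_trans (ler_normD _ _))// mulrDl lerD//.
  rewrite normrM (ger0_norm y0).
  have h : y <= 2 / e * expR (e / 2 * y).
    rewrite -ler_pdivrMl ?divr_gt0// (le_trans _ (expR_ge1Dx _))//.
    rewrite invf_div -[leLHS]add0r lerD//.
  have -> : expR (e * y) = expR (e / 2 * y) * expR (e / 2 * y).
    by rewrite -expRD; congr expR; field.
  have -> : K * (2 / e) * (expR (e / 2 * y) * expR (e / 2 * y)) =
      (K * expR (e / 2 * y)) * (2 / e * expR (e / 2 * y)) by ring.
  by apply: ler_pM => //; exact: HK.
by rewrite ler_peMr// -[leLHS]expR0 ler_expR mulr_ge0// ltW.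
Qed.

(** The functions [P(1/t) exp(-1/t)], extended by zero, form a family closed under differentiation
    by [P -> X^2 (P - P')]; it contains [bexp], for P = 1. *)
Definition flat (P : {poly R}) (t : R) : R :=
  if 0 < t then P.[t^-1] * expR (- t^-1) else 0.

Lemma is_derive_flat (P : {poly R}) (t : R) :
  is_derive t 1 (flat P) (flat ('X^2 * (P - P^`())) t).
Proof.
have [t0|t0|t0] := ltgtP t 0.
- rewrite {2}/flat ltNge (ltW t0)/=.
  apply: (@near_eq_is_derive _ _ _ (cst 0)).
  have : \forall y \near t, y < 0 by exact: lt_nbhsl.
  by apply: filterS => y y0; rewrite /flat ltNge (ltW y0).
- rewrite {2}/flat t0/=.
  apply: (@near_eq_is_derive _ _ _ (fun t : R => P.[t^-1] * expR (- t^-1))).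
    have : \forall y \near t, 0 < y by exact: lt_nbhsr.
    by apply: filterS => y y0; rewrite /flat y0.
  have dV : is_derive t 1 (fun t : R => t^-1) (- t ^- 2 * 1).
    by apply: is_deriveV_fun; rewrite ?gt_eqF.
  have dP : is_derive t 1 (fun t : R => P.[t^-1]) ((P^`()).[t^-1] * (- t ^- 2 * 1)).
    exact: (@is_derive_chain _ _ (horner P) (fun t : R => t^-1) t 1 _ _
      (is_derive_poly P t^-1) dV).
  have dE := @is_derive_chain _ _ expR (fun t : R => - t^-1) t 1 _ _
    (is_derive_expR (- t^-1)) (is_deriveN_fun dV).
  have h := is_deriveM_fun dP dE.
  apply: (is_derive_eq h).
  rewrite hornerM hornerXn hornerD hornerN exprVn; ring.
rewrite t0 {2}/flat ltxx.
(* The difference quotient at 0 is [(X P)(1/h) exp(-1/h)]; with rate 1/2 it is at most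
   [K exp(-1/(2h)) <= 2 K h]. *)
have [K K0 HK] := poly_expR_bound ('X * P) (divr_gt0 (@ltr01 R) (ltr0n _ 2)).
have flat0 : flat P 0 = 0 by rewrite /flat ltxx.
have lim0 : h^-1 *: (flat P (h *: (1 : R) + 0) - flat P 0) @[h --> (0 : R)^'] --> (0 : R).
  apply/cvgr0Pnorm_lt => e e0.
  exists (e / (2 * K + 1)) => /=; first by rewrite divr_gt0// ltr_wpDl ?mulr_ge0.
  move=> h /= ; rewrite sub0r normrN => he _.
  rewrite flat0 subr0 addr0 [h *: 1]mulr1 /flat.
  case: (ltP 0 h) => h0; last by rewrite scaler0 normr0.
  have y0 : 0 <= h^-1 by rewrite invr_ge0 ltW.
  have := HK _ y0; rewrite hornerM hornerX => Hy.
  have -> : h^-1 *: (P.[h^-1] * expR (- h^-1)) = h^-1 * P.[h^-1] * expR (- h^-1).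
    by rewrite /GRing.scale/= mulrA.
  rewrite normrM (ger0_norm (expR_ge0 _)).
  apply: (@le_lt_trans _ _ (K * expR (1 / 2 * h^-1) * expR (- h^-1))).
    by rewrite ler_wpM2r ?expR_ge0.
  rewrite -mulrA -expRD.
  have -> : 1 / 2 * h^-1 + - h^-1 = - (h^-1 / 2) by field; rewrite gt_eqF.
  apply: (@le_lt_trans _ _ (K * (2 * h))).
    rewrite ler_wpM2l// expRN -[leRHS]invrK lef_pV2 ?posrE ?expR_gt0 ?invr_gt0 ?mulr_gt0//.
    rewrite (le_trans _ (expR_ge1Dx _))// invfM mulrC -[leLHS]add0r lerD//.
  rewrite ger0_norm ?ltW// in he.
  rewrite ltr_pdivlMr in he; last by rewrite ltr_wpDl ?mulr_ge0.
  by apply: le_lt_trans he; nra.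
split; first by apply/cvg_ex; exists 0.
exact/cvg_lim.
Qed.

Definition bexp (t : R) : R := if 0 < t then expR (- t^-1) else 0.

Lemma bexp_ge0 t : 0 <= bexp t.
Proof. by rewrite /bexp; case: ifP => // _; exact: expR_ge0. Qed.

Lemma bexp_gt0 t : (0 < bexp t) = (0 < t).
Proof. by rewrite /bexp; case: ifP; rewrite ?expR_gt0 ?ltxx. Qed.

Lemma bexp_eq0 t : t <= 0 -> bexp t = 0.
Proof. by move=> t0; rewrite /bexp ltNge t0. Qed.

Lemma smooth_bexp : smooth bexp.
Proof.
exists [set f | exists P : {poly R}, f = flat P].
  move=> _ [P ->]; exists (flat ('X^2 * (P - P^`()))); first by eexists.
  by move=> x; exact: is_derive_flat.
exists 1; apply/funext => t; rewrite /flat /bexp; case: ifP => // _.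
by rewrite hornerC mul1r.
Qed.

Definition step (t : R) : R := bexp (t - 1) / (bexp (t - 1) + bexp (2 - t)).

Lemma step_den t : 0 < bexp (t - 1) + bexp (2 - t).
Proof.
have [t1|t1] := ltP 1 t.
  by rewrite ltr_pwDl ?bexp_ge0// bexp_gt0 subr_gt0.
by rewrite ltr_wpDl ?bexp_ge0// bexp_gt0 subr_gt0 (le_lt_trans t1)// ltr1n.
Qed.

Lemma smooth_step : smooth step.
Proof.
have s1 : smooth (fun t => bexp (t - 1)).
  by apply: (smooth_comp smooth_bexp); apply: smoothB; [exact: smooth_id|exact: smooth_cst].
have s2 : smooth (fun t => bexp (2 - t)).
  by apply: (smooth_comp smooth_bexp); apply: smoothB; [exact: smooth_cst|exact: smooth_id].
apply: smoothM => //; apply: smoothV; first exact: smoothD.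
by move=> t; rewrite gt_eqF// step_den.
Qed.

Lemma step_eq0 t : t <= 1 -> step t = 0.
Proof. by move=> t1; rewrite /step bexp_eq0 ?mul0r// subr_le0. Qed.

Lemma step_eq1 t : 2 <= t -> step t = 1.
Proof.
move=> t2; rewrite /step; have := step_den t; rewrite (@bexp_eq0 (2 - t)) ?subr_le0//.
by rewrite addr0 => h; rewrite mulfV// gt_eqF.
Qed.

Lemma step_ge0 t : 0 <= step t.
Proof. by rewrite mulr_ge0 ?bexp_ge0// invr_ge0 ltW// step_den. Qed.

Lemma step_le1 t : step t <= 1.
Proof. by rewrite ler_pdivrMr ?step_den// mul1r lerDl bexp_ge0. Qed.

End smooth_line.

(** * Smooth functions on R^n *)

Section smooth_space.
Context {R : realType} {n : nat}.
Implicit Types (f g : 'rV[R]_n -> R) (C : set ('rV[R]_n -> R)).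

(** Continuity is part of the closure condition because the existence of partial derivatives does
    not imply it. *)
Definition pderive_closed C := forall g, C g -> continuous g /\
  forall i : 'I_n, exists2 g', C g' & forall x, is_derive x (delta_mx ord0 i) g (g' x).

Definition smooth_rV f := exists2 C, pderive_closed C & C f.

Inductive alg_rV C : ('rV[R]_n -> R) -> Prop :=
| alg_rV_in f : C f -> alg_rV C f
| alg_rV_cst a : alg_rV C (fun=> a)
| alg_rV_add f g : alg_rV C f -> alg_rV C g -> alg_rV C (fun x => f x + g x)
| alg_rV_mul f g : alg_rV C f -> alg_rV C g -> alg_rV C (fun x => f x * g x).

Lemma alg_rV_gen_smooth C :
  (forall g, C g -> continuous g /\ forall i : 'I_n,
    exists2 g', alg_rV C g' & forall x, is_derive x (delta_mx ord0 i) g (g' x)) ->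
  forall f, alg_rV C f -> smooth_rV f.
Proof.
move=> CC f Cf; exists (alg_rV C) => // {f Cf} g.
elim=> {g} [f /CC//|a|f g Cf [cf df] Cg [cg dg]|f g Cf [cf df] Cg [cg dg]].
- split; first exact: cont_cst.
  by move=> i; exists (fun=> 0); [exact: alg_rV_cst|move=> x; exact: is_derive_cst].
- split; first exact: contD.
  move=> i; have [f' Cf' f1] := df i; have [g' Cg' g1] := dg i.
  exists (fun x => f' x + g' x); first exact: alg_rV_add.
  by move=> x; exact: is_deriveD_fun.
- split; first exact: contM.
  move=> i; have [f' Cf' f1] := df i; have [g' Cg' g1] := dg i.
  exists (fun x => f' x * g x + f x * g' x); last by move=> x; exact: is_deriveM_fun.
  by apply: alg_rV_add; exact: alg_rV_mul.
Qed.

Lemma smooth_rV_closed : pderive_closed smooth_rV.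
Proof.
move=> f [C CC Cf]; have [cf df] := CC f Cf; split => // i.
by have [f' Cf' f1] := df i; exists f' => //; exists C.
Qed.

Lemma alg_rV_smooth f : alg_rV smooth_rV f -> smooth_rV f.
Proof.
apply: alg_rV_gen_smooth => g /smooth_rV_closed[cg dg]; split => // i.
by have [g' sg' g1] := dg i; exists g' => //; exact: alg_rV_in.
Qed.

Lemma smooth_rV_cst (a : R) : smooth_rV (fun=> a).
Proof. by apply: alg_rV_smooth; exact: alg_rV_cst. Qed.

Lemma smooth_rVD f g : smooth_rV f -> smooth_rV g -> smooth_rV (fun x => f x + g x).
Proof. by move=> sf sg; apply: alg_rV_smooth; apply: alg_rV_add; exact: alg_rV_in. Qed.

Lemma smooth_rVM f g : smooth_rV f -> smooth_rV g -> smooth_rV (fun x => f x * g x).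
Proof. by move=> sf sg; apply: alg_rV_smooth; apply: alg_rV_mul; exact: alg_rV_in. Qed.

Lemma smooth_rV_sum (I : Type) (r : seq I) (F : I -> 'rV[R]_n -> R) :
  (forall i, smooth_rV (F i)) -> smooth_rV (fun x => \sum_(i <- r) F i x).
Proof.
move=> sF; elim: r => [|i r IH].
  by under eq_fun do rewrite big_nil; exact: smooth_rV_cst.
by under eq_fun do rewrite big_cons; exact: smooth_rVD.
Qed.

Lemma smooth_rV_prod (I : Type) (r : seq I) (F : I -> 'rV[R]_n -> R) :
  (forall i, smooth_rV (F i)) -> smooth_rV (fun x => \prod_(i <- r) F i x).
Proof.
move=> sF; elim: r => [|i r IH].
  by under eq_fun do rewrite big_nil; exact: smooth_rV_cst.
by under eq_fun do rewrite big_cons; exact: smooth_rVM.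
Qed.

Lemma smooth_rV_coor (i : 'I_n) : smooth_rV (fun x => x ord0 i).
Proof.
exists [set g | g = (fun x : 'rV[R]_n => x ord0 i) \/ exists a : R, g = fun=> a]; last by left.
move=> g [->|[a ->]].
  split; first exact: coord_continuous.
  move=> j; exists (fun=> (j == i)%:R); first by right; exists (j == i)%:R.
  by move=> x; exact: is_derive_coor.
split; first exact: cont_cst.
by move=> j; exists (fun=> 0) => [|x]; [right; exists 0|exact: is_derive_cst].
Qed.

Lemma smooth_rV_sqn : smooth_rV (@sqn R n).
Proof.
rewrite (_ : @sqn R n = fun x => \sum_i x ord0 i * x ord0 i) //.
by apply: smooth_rV_sum => i; apply: smooth_rVM; exact: smooth_rV_coor.
Qed.

Lemma smooth_rV_comp (f : R -> R) g : smooth f -> smooth_rV g ->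
  smooth_rV (fun x => f (g x)).
Proof.
move=> sf sg.
pose C h := smooth_rV h \/ exists2 f, smooth f & h = fun x => f (g x).
apply: (@alg_rV_gen_smooth C); last by apply: alg_rV_in; right; exists f.
have [cg dg] := smooth_rV_closed sg.
move=> k [sk|[h sh ->]].
  have [ck dk] := smooth_rV_closed sk; split => // i.
  by have [k' sk' k1] := dk i; exists k' => //; apply: alg_rV_in; left.
split; first by apply: cont_comp => //; exact: smooth_continuous.
have [h' sh' dh] := smooth_closed sh.
move=> i; have [g' sg' g1] := dg i.
exists (fun x => h' (g x) * g' x); last first.
  by move=> x; exact: (is_derive_chain (dh (g x)) (g1 x)).
by apply: alg_rV_mul; apply: alg_rV_in; [right; exists h'|left].
Qed.

Lemma smooth_rV_is_derive f i x : smooth_rV f ->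
  is_derive x (delta_mx ord0 i) f ('D_(delta_mx ord0 i) f x).
Proof.
move=> /smooth_rV_closed[_ df]; have [f' _ f1] := df i.
by apply: derivableP; case: (f1 x).
Qed.

Lemma smooth_rV_derive f i : smooth_rV f ->
  smooth_rV (fun x => 'D_(delta_mx ord0 i) f x).
Proof.
move=> /smooth_rV_closed[_ df]; have [f' sf' f1] := df i.
by rewrite (_ : (fun x => _) = f')//; apply/funext => x; case: (f1 x).
Qed.

Lemma smooth_rV_continuous f : smooth_rV f -> continuous f.
Proof. by move=> /smooth_rV_closed[]. Qed.

Lemma smooth_rV_pderiv f s : smooth_rV f -> smooth_rV (pderiv s f).
Proof. by move=> sf; elim: s => //= i s IH; exact: smooth_rV_derive. Qed.

Lemma smooth_rV_Ck f k : smooth_rV f -> Ck k f.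
Proof.
move=> sf s _; have sp := smooth_rV_pderiv s sf; split.
  exact: smooth_rV_continuous.
by move=> _ i x; case: (smooth_rV_is_derive i x sp).
Qed.

End smooth_space.

Lemma C2of_pderiv {R : realType} {n : nat} (f : 'rV[R]_n -> R) df d2f i :
  C2of f df d2f -> pderiv [:: i] f = df i /\ pderiv [:: i; i] f = d2f i.
Proof.
move=> [_ _ _ d1 d2].
have e1 : pderiv [:: i] f = df i by apply/funext => x; case: (d1 i x).
split => //; apply/funext => x; rewrite -[LHS]/('D_(delta_mx ord0 i) (pderiv [:: i] f) x).
by rewrite e1; case: (d2 i x).
Qed.

Lemma C2of_laplacian {R : realType} {n : nat} (f : 'rV[R]_n -> R) df d2f :
  C2of f df d2f -> laplacian f = fun x => \sum_i d2f i x.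
Proof.
move=> Cf; apply/funext => x; apply: eq_bigr => i _.
by have [_ ->] := C2of_pderiv i Cf.
Qed.

Lemma smooth_affine {R : realType} (b c : R) : smooth (fun t : R => b * t + c).
Proof.
apply: smoothD; last exact: smooth_cst.
by apply: smoothM; [exact: smooth_cst|exact: smooth_id].
Qed.

(** * The truncated Rellich power *)

Section radial_test.
Context {R : realType} {N : nat}.
Variable A0 : R.
Hypothesis N5 : (5 <= N)%N.
Hypothesis A01 : 1 <= A0.

(** The exponent in the variable [s = |x|^2], so that [s^a = |x|^(-(N-4)/2)]. *)
Let a : R := - ((N%:R - 4) / 4).

Let A0_gt0 : 0 < A0. Proof. exact: lt_le_trans A01. Qed.

(* Equal to s for s >= A0 and positive everywhere. *)
Let base (s : R) : R := step (2 * (s / A0)) * s + (1 - step (2 * (s / A0))).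

(** The power [s^a], smooth on the whole line because [ln] is applied to the positive [base], times
    a cutoff that vanishes for [s <= A0]. *)
Let pw (s : R) : R := expR (a * ln (base s)) * step (s / A0).

(** Equal to 1 up to 5/4 and to 0 from 7/4 on: the margins make the derivatives vanish on the closed
    ranges [t <= 1] and [t >= 2] as well. *)
Let cut (t : R) : R := 1 - step (2 * t - 3 / 2).

Let base_gt0 s : 0 < base s.
Proof.
rewrite /base; set t := step _.
have t0 : 0 <= t by exact: step_ge0.
have t1 : t <= 1 by exact: step_le1.
have [s0|s0] := ltP 0 s.
  have [t2|t2] := ltP t 1; first by rewrite ltr_wpDl ?subr_gt0// mulr_ge0// ltW.
  have -> : t = 1 by apply/eqP; rewrite eq_le t1.
  by rewrite mul1r subrr addr0.
rewrite /t step_eq0 ?mul0r ?add0r ?subr0//.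
by rewrite (le_trans _ ler01)// mulr_ge0_le0// mulr_le0_ge0// invr_ge0 ltW.
Qed.

Let smooth_step_div (b : R) : smooth (fun s => step (b * (s / A0))).
Proof.
apply: (smooth_comp smooth_step).
have := smooth_affine (b / A0) 0; congr smooth; apply/funext => t.
by rewrite addr0; ring.
Qed.

Let smooth_pw : smooth pw.
Proof.
apply: smoothM; last first.
  by have := smooth_step_div 1; congr smooth; apply/funext => s; rewrite mul1r.
apply: (smooth_comp smooth_expR); apply: smoothM; first exact: smooth_cst.
apply: smooth_ln => //; apply: smoothD.
  by apply: smoothM; [exact: smooth_step_div|exact: smooth_id].
by apply: smoothB; [exact: smooth_cst|exact: smooth_step_div].
Qed.

Let smooth_cut : smooth cut.
Proof.
apply: smoothB; first exact: smooth_cst.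
exact: (smooth_comp smooth_step (smooth_affine 2 (- (3 / 2)))).
Qed.

Let pw_eq0 s : s <= A0 -> pw s = 0.
Proof. by move=> sA; rewrite /pw step_eq0 ?mulr0// ler_pdivrMr// mul1r. Qed.

Let E (s : R) : R := expR (a * ln s).

Let pwE s : 2 * A0 <= s -> pw s = E s.
Proof.
move=> As; rewrite /pw step_eq1 ?mulr1; last by rewrite ler_pdivlMr.
rewrite /base step_eq1 ?mul1r ?subrr ?addr0//.
by rewrite mulrA ler_pdivlMr//; move: A0_gt0 As; lra.
Qed.

Let cut1 t : t <= 5 / 4 -> cut t = 1.
Proof. by move=> h; rewrite /cut step_eq0 ?subr0//; lra. Qed.

Let cut0 t : 7 / 4 <= t -> cut t = 0.
Proof. by move=> h; rewrite /cut step_eq1 ?subrr//; lra. Qed.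

Let p1 (s : R) : R := 'D_1 pw s.
Let p2 (s : R) : R := 'D_1 p1 s.
Let z1 (s : R) : R := 'D_1 cut s.
Let z2 (s : R) : R := 'D_1 z1 s.

Let smooth_p1 : smooth p1. Proof. exact: smooth_derive. Qed.
Let smooth_z1 : smooth z1. Proof. exact: smooth_derive. Qed.
Let smooth_p2 : smooth p2. Proof. exact: smooth_derive. Qed.
Let smooth_z2 : smooth z2. Proof. exact: smooth_derive. Qed.

Let derive_near (F G : R -> R) (s d : R) : (\forall t \near s, G t = F t) ->
  is_derive s 1 G d -> 'D_1 F s = d.
Proof. by move=> GF dG; have [_ <-] := near_eq_is_derive GF dG. Qed.

Let p1E s : 2 * A0 < s -> p1 s = a / s * E s.
Proof.
move=> As; have s0 : 0 < s by move: A0_gt0 As; lra.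
apply: (derive_near (G := E)).
  by near=> t; rewrite pwE// ltW//; near: t; exact: lt_nbhsr.
have h := @is_derive_chain _ _ expR (fun s : R => a * ln s) s 1 _ _
  (is_derive_expR _) (is_deriveZ_fun a (is_derive1_ln s0)).
by apply: (is_derive_eq h); rewrite mulrC.
Unshelve. all: by end_near. Qed.

Let p2E s : 2 * A0 < s -> p2 s = a * (a - 1) / s ^+ 2 * E s.
Proof.
move=> As; have s0 : 0 < s by move: A0_gt0 As; lra.
apply: (derive_near (G := fun s => a / s * E s)).
  by near=> t; rewrite p1E//; near: t; exact: lt_nbhsr.
have h := @is_derive_chain _ _ expR (fun s : R => a * ln s) s 1 _ _
  (is_derive_expR _) (is_deriveZ_fun a (is_derive1_ln s0)).
have s1 : s != 0 by rewrite gt_eqF.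
have dV := is_deriveZ_fun a (@is_deriveV_fun _ _ (fun s : R => s) s 1 _ s1 (is_derive_id s 1)).
have h2 := is_deriveM_fun dV h.
by apply: (is_derive_eq h2); rewrite -/(E s); field.
Unshelve. all: by end_near. Qed.

Let z1_lt t : t < 5 / 4 -> z1 t = 0.
Proof.
move=> t1; apply: (derive_near (G := cst 1)).
  by near=> x; rewrite cut1// ltW//; near: x; exact: lt_nbhsl.
Unshelve. all: by end_near. Qed.

Let z2_lt t : t < 5 / 4 -> z2 t = 0.
Proof.
move=> t1; apply: (derive_near (G := cst 0)).
  by near=> x; rewrite z1_lt//; near: x; exact: lt_nbhsl.
Unshelve. all: by end_near. Qed.

Let z1_gt t : 7 / 4 < t -> z1 t = 0.
Proof.
move=> t1; apply: (derive_near (G := cst 0)).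
  by near=> x; rewrite cut0// ltW//; near: x; exact: lt_nbhsr.
Unshelve. all: by end_near. Qed.

Let z2_gt t : 7 / 4 < t -> z2 t = 0.
Proof.
move=> t1; apply: (derive_near (G := cst 0)).
  by near=> x; rewrite z1_gt//; near: x; exact: lt_nbhsr.
Unshelve. all: by end_near. Qed.

Let Phi (l s : R) : R := pw s * cut (s / l ^+ 2).

Let Phi1 (l s : R) : R :=
  p1 s * cut (s / l ^+ 2) + pw s * (z1 (s / l ^+ 2) / l ^+ 2).

Let Phi2 (l s : R) : R := p2 s * cut (s / l ^+ 2) +
  2 * p1 s * (z1 (s / l ^+ 2) / l ^+ 2) + pw s * (z2 (s / l ^+ 2) / l ^+ 4).

Let smooth_scaled (f : R -> R) (q : R) : smooth f -> smooth (fun s => f (s / q)).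
Proof.
move=> sf; have := smooth_comp sf (smooth_affine q^-1 0).
by congr smooth; apply/funext => s; rewrite addr0 mulrC.
Qed.

Let derive_scaled (f : R -> R) (q s : R) : smooth f ->
  is_derive s 1 (fun s => f (s / q)) ('D_1 f (s / q) / q).
Proof.
move=> sf.
have d1 : is_derive s 1 (fun s : R => s / q) q^-1.
  rewrite (_ : (fun s => _) = fun s => q^-1 * s); last by apply/funext => t; rewrite mulrC.
  have h := is_deriveZ_fun q^-1 (is_derive_id s 1).
  by apply: (is_derive_eq h); rewrite mulr1.
exact: (@is_derive_chain _ _ f (fun s : R => s / q) s 1 _ _ (smooth_is_derive _ sf) d1).
Qed.

Let derive_Phi (l s : R) : is_derive s 1 (Phi l) (Phi1 l s).
Proof.
have h := is_deriveM_fun (smooth_is_derive s smooth_pw) (derive_scaled (l ^+ 2) s smooth_cut).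
by apply: (is_derive_eq h).
Qed.

Let derive_Phi1 (l s : R) : is_derive s 1 (Phi1 l) (Phi2 l s).
Proof.
have h1 := is_deriveM_fun (smooth_is_derive s smooth_p1) (derive_scaled (l ^+ 2) s smooth_cut).
have hz := is_deriveM_fun (derive_scaled (l ^+ 2) s smooth_z1)
  (@is_derive_cst _ _ R (l ^+ 2)^-1 s 1).
have h2 := is_deriveM_fun (smooth_is_derive s smooth_pw) hz.
have h := is_deriveD_fun h1 h2.
apply: (is_derive_eq h); rewrite /Phi2 -/(p1 s) -/(p2 s) -/(z1 _) -/(z2 _).
rewrite (_ : l ^+ 4 = l ^+ 2 * l ^+ 2) ?invfM -?exprD//=; ring.
Qed.

Let smooth_Phi l : smooth (Phi l).
Proof. by apply: smoothM => //; exact: smooth_scaled. Qed.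

Let smooth_Phi1 l : smooth (Phi1 l).
Proof.
apply: smoothD; first by apply: smoothM => //; exact: smooth_scaled.
apply: smoothM => //; apply: smoothM; last exact: smooth_cst.
exact: smooth_scaled.
Qed.

Let smooth_Phi2 l : smooth (Phi2 l).
Proof.
apply: smoothD; [apply: smoothD|].
- by apply: smoothM => //; exact: smooth_scaled.
- apply: smoothM; first by apply: smoothM => //; exact: smooth_cst.
  by apply: smoothM; [exact: smooth_scaled|exact: smooth_cst].
- apply: smoothM => //.
  by apply: smoothM; [exact: smooth_scaled|exact: smooth_cst].
Qed.

Let lapE l : laplacian (fun x : 'rV[R]_N => Phi l (sqn x)) =
  fun x => 4 * sqn x * Phi2 l (sqn x) + 2 * N%:R * Phi1 l (sqn x).
Proof.
have C := @C2of_radial R N (Phi l) (Phi1 l) (Phi2 l)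
  (smooth_continuous (smooth_Phi l)) (smooth_continuous (smooth_Phi1 l))
  (smooth_continuous (smooth_Phi2 l)) (derive_Phi l) (derive_Phi1 l).
rewrite (C2of_laplacian C); apply/funext => x.
exact: radial_laplacian.
Qed.

Let bounded_on (F : R -> R) (b : R) : continuous F ->
  exists2 M, 0 <= M & forall s, 0 <= s <= b -> `|F s| <= M.
Proof.
move=> cF; have /compact_bounded[M [_ HM]] := @continuous_compact _ _ _ _
   (continuous_subspaceT cF) (@segment_compact R 0 b).
exists (1 + `|M|); first by rewrite addr_ge0.
move=> s sb; apply: (HM (1 + `|M|)); first by rewrite (le_lt_trans (ler_norm _))// ltrDr.
by exists s => //=; rewrite in_itv.
Qed.

Let E_gt0 s : 0 < E s. Proof. exact: expR_gt0. Qed.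

Let E_sqr (x : 'rV[R]_N) : 0 < sqn x -> E (sqn x) ^+ 2 = enorm x ^- (N - 4).
Proof.
move=> s0; have e0 : 0 < enorm x by rewrite enormE sqrtr_gt0.
rewrite /E -sqr_enorm lnXn// -expRM_natl.
rewrite -[in RHS](@lnK R (enorm x)) ?posrE// -expRM_natl -expRN natrB; last first.
  exact: leq_trans N5.
by congr expR; rewrite /a -mulr_natl; field.
Qed.

(** The power is exact from [2 A0] on; the estimates start at [4 A0], strictly inside the region
    where [p1] and [p2] have closed forms. [C] is uniform in l because the outer layer is a
    rescaling of a fixed profile. *)
Lemma radial_test_function : exists2 C : R, 0 <= C & forall l, 1 < l ->
  4 * A0 <= l ^+ 2 -> exists phi : 'rV[R]_N -> R,
  [/\ smooth_rV phi, forall x, sqn x <= A0 -> phi x = 0,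
      forall x, 2 * l ^+ 2 <= sqn x -> phi x = 0 &
   [/\ forall x, 4 * A0 <= sqn x <= l ^+ 2 -> phi x ^+ 2 = enorm x ^- (N - 4),
      forall x, 4 * A0 <= sqn x <= l ^+ 2 ->
        laplacian phi x ^+ 2 <= @hardy_rellich R N * enorm x ^- N,
      forall x, sqn x <= 4 * A0 -> laplacian phi x ^+ 2 <= C,
      forall x, l ^+ 2 <= sqn x <= 2 * l ^+ 2 -> laplacian phi x ^+ 2 <= C * l ^- N &
      forall x, 2 * l ^+ 2 <= sqn x -> laplacian phi x ^+ 2 <= 0]].
Proof.
have [CA CA0 HCA] : exists2 M, 0 <= M & forall s, 0 <= s <= 4 * A0 ->
    `|4 * s * p2 s + 2 * N%:R * p1 s| <= M.
  apply: bounded_on; apply: contD.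
    apply: contM; last exact: smooth_continuous.
    by apply: contZ => ?; exact: cvg_id.
  by apply: contZ; exact: smooth_continuous.
have [Z0 Z00 HZ0] := @bounded_on cut 2 (smooth_continuous smooth_cut).
have [Z1 Z10 HZ1] := @bounded_on z1 2 (smooth_continuous smooth_z1).
have [Z2 Z20 HZ2] := @bounded_on z2 2 (smooth_continuous smooth_z2).
pose b1 := `|a|; pose b2 := `|a * (a - 1)|.
have b10 : 0 <= b1 := normr_ge0 _.
have b20 : 0 <= b2 := normr_ge0 _.
(* Bounds the profile in [t = s / l^2] that is left when [s^a / l^2] is factored out of the
   Laplacian on the outer layer, where [1 <= t <= 2]. *)
pose K := 4 * (b2 * Z0 + 2 * b1 * Z1 + 2 * Z2) + 2 * N%:R * (b1 * Z0 + Z1).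
have K0 : 0 <= K.
  by rewrite /K addr_ge0// mulr_ge0 ?addr_ge0 ?mulr_ge0.
exists (CA ^+ 2 + K ^+ 2); first by rewrite addr_ge0 ?sqr_ge0.
move=> l l1 Al; have l0 : 0 < l by exact: lt_trans l1.
have q0 : 0 < l ^+ 2 by rewrite exprn_gt0.
exists (fun x => Phi l (sqn x)); split.
- by apply: smooth_rV_comp => //; exact: smooth_rV_sqn.
- by move=> x sA; rewrite /Phi pw_eq0 ?mul0r.
- move=> x ls; rewrite /Phi cut0 ?mulr0// ler_pdivlMr// (le_trans _ ls)// ler_wpM2r ?ltW//.
  lra.
have inner s : s <= l ^+ 2 -> Phi1 l s = p1 s /\ Phi2 l s = p2 s.
  move=> sl; have t1 : s / l ^+ 2 < 5 / 4.
    by rewrite (@le_lt_trans _ _ 1)// ?ler_pdivrMr ?mul1r//; lra.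
  by rewrite /Phi1 /Phi2 z1_lt// z2_lt// cut1 ?ltW//; split; ring.
split.
- move=> x /andP[As sl]; have s2 : 2 * A0 <= sqn x by move: A0_gt0 As; lra.
  have s0 : 0 < sqn x by move: A0_gt0 As; lra.
  rewrite -(E_sqr s0) /Phi pwE// cut1 ?mulr1//.
  by rewrite (@le_trans _ _ 1)// ?ler_pdivrMr ?mul1r//; lra.
- move=> x /andP[As sl]; have s2 : 2 * A0 < sqn x by move: A0_gt0 As; lra.
  have s0 : 0 < sqn x by move: A0_gt0 As; lra.
  have [e1 e2] := inner _ sl; rewrite lapE e1 e2 p1E// p2E//.
  have s1 : sqn x != 0 by rewrite gt_eqF.
  (* The choice of [a] gives [4 a - 4 + 2 N = N], hence the coefficient [a N = - N (N - 4) / 4]. *)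
  have -> : 4 * sqn x * (a * (a - 1) / sqn x ^+ 2 * E (sqn x)) +
      2 * N%:R * (a / sqn x * E (sqn x)) = a * N%:R / sqn x * E (sqn x).
    by rewrite /a; field.
  have e0 : 0 < enorm x by rewrite enormE sqrtr_gt0.
  rewrite exprMn E_sqr//.
  have -> : enorm x ^- N = enorm x ^- (N - 4) / sqn x ^+ 2.
    rewrite -sqr_enorm -exprM -invfM -exprD subnK//; exact: leq_trans N5.
  rewrite le_eqVlt; apply/orP; left; apply/eqP.
  by rewrite /hardy_rellich /a; move: (enorm x ^- _) => y; field.
- move=> x sA; have [e1 e2] := inner _ (le_trans sA Al); rewrite lapE e1 e2.
  rewrite -[leLHS]real_normK ?num_real// -[leLHS]addr0 lerD ?sqr_ge0//.
  by rewrite lerXn2r ?nnegrE// HCA// sqn_ge0.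
- move=> x /andP[ls sl]; have s2 : 2 * A0 < sqn x by move: A0_gt0 Al ls; lra.
  have s0 : 0 < sqn x by move: A0_gt0 s2; lra.
  set s := sqn x in ls sl s2 s0 *.
  pose t := s / l ^+ 2.
  have t02 : 0 <= t <= 2 by rewrite divr_ge0 ?(ltW s0) ?(ltW q0)//= ler_pdivrMr.
  have [B0 [B1 B2]] : `|cut t| <= Z0 /\ `|z1 t| <= Z1 /\ `|z2 t| <= Z2.
    by split; [exact: HZ0|split; [exact: HZ1|exact: HZ2]].
  have e0 : 0 < enorm x by rewrite enormE sqrtr_gt0.
  have lap : `|laplacian (fun x : 'rV[R]_N => Phi l (sqn x)) x| <= E s / l ^+ 2 * K.
    rewrite lapE -/s /Phi1 /Phi2 -/t p1E// p2E// pwE ?(ltW s2)//.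
    have s1 : s != 0 by rewrite gt_eqF.
    have l2 : l ^+ 2 != 0 by rewrite gt_eqF.
    have t1 : 0 < t by rewrite divr_gt0.
    have ti : t^-1 <= 1 by rewrite invf_le1// ler_pdivlMr ?mul1r.
    have -> : 4 * s * (a * (a - 1) / s ^+ 2 * E s * cut t +
        2 * (a / s * E s) * (z1 t / l ^+ 2) + E s * (z2 t / l ^+ 4)) +
        2 * N%:R * (a / s * E s * cut t + E s * (z1 t / l ^+ 2)) =
        E s / l ^+ 2 * (4 * (a * (a - 1) * cut t * t^-1 + 2 * a * z1 t + t * z2 t) +
        2 * N%:R * (a * cut t * t^-1 + z1 t)).
      rewrite /t (_ : l ^+ 4 = l ^+ 2 * l ^+ 2); last by rewrite -exprD.
      set q := l ^+ 2 in l2 *; set e := E s.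
      set c := cut (s / q); set y1 := z1 (s / q); set y2 := z2 (s / q).
      clearbody c y1 y2 e; clearbody q.
      by field; rewrite l2 s1.
    rewrite normrM ger0_norm ?divr_ge0 ?(ltW (E_gt0 s)) ?(ltW q0)//.
    apply: ler_wpM2l; first by rewrite divr_ge0 ?(ltW (E_gt0 s)) ?(ltW q0).
    have tn : `|t^-1| <= 1 by rewrite ger0_norm// invr_ge0 ltW.
    have tn2 : `|t| <= 2 by rewrite ger0_norm ?(ltW t1)//; case/andP: t02.
    have h1 : `|a * (a - 1) * cut t * t^-1| <= b2 * Z0.
      rewrite -[leRHS]mulr1 !normrM -(normrM a (a - 1)) ler_pM// ?mulr_ge0//.
      by rewrite ler_wpM2l.
    have h2 : `|2 * a * z1 t| <= 2 * b1 * Z1.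
      by rewrite normrM (normrM 2 a) (ger0_norm (ler0n R 2)) ler_wpM2l// mulr_ge0.
    have h3 : `|t * z2 t| <= 2 * Z2 by rewrite normrM ler_pM.
    have h4 : `|a * cut t * t^-1| <= b1 * Z0.
      rewrite -[leRHS]mulr1 !normrM ler_pM// ?mulr_ge0//.
      by rewrite ler_wpM2l.
    have N0 : 0 <= N%:R :> R by rewrite ler0n.
    rewrite (le_trans (ler_normD _ _))// /K lerD//.
      rewrite normrM (ger0_norm (ler0n R 4)) ler_wpM2l//.
      rewrite (le_trans (ler_normD _ _))// lerD//.
      by rewrite (le_trans (ler_normD _ _))// lerD.
    rewrite normrM ger0_norm ?mulr_ge0// ler_wpM2l ?mulr_ge0//.
    by rewrite (le_trans (ler_normD _ _))// lerD.
  have EE : E s ^+ 2 <= l ^- (N - 4).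
    rewrite E_sqr// lef_pV2 ?posrE ?exprn_gt0// lerXn2r ?nnegrE ?(ltW l0) ?(ltW e0)//.
    by rewrite -ler_sqr ?nnegrE ?(ltW l0) ?(ltW e0)// sqr_enorm.
  rewrite -[leLHS]real_normK ?num_real//.
  apply: (@le_trans _ _ ((E s / l ^+ 2 * K) ^+ 2)).
    rewrite lerXn2r ?nnegrE// mulr_ge0// divr_ge0 ?(ltW (E_gt0 s)) ?(ltW q0)//.
  apply: (@le_trans _ _ (K ^+ 2 * l ^- N)).
    have -> : l ^- N = l ^- (N - 4) * l ^- 4.
      by rewrite -invfM -exprD subnK//; exact: leq_trans N5.
    have -> : (E s / l ^+ 2 * K) ^+ 2 = K ^+ 2 * (E s ^+ 2 * l ^- 4).
      rewrite (_ : l ^+ 4 = l ^+ 2 * l ^+ 2); last by rewrite -exprD.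
      by field; rewrite gt_eqF.
    rewrite ler_wpM2l ?sqr_ge0// ler_wpM2r// invr_ge0 exprn_ge0// ltW//.
  by rewrite ler_wpM2r ?lerDr ?sqr_ge0// invr_ge0 exprn_ge0// ltW.
move=> x ls; rewrite lapE.
have t1 : 7 / 4 < sqn x / l ^+ 2.
  by rewrite (@lt_le_trans _ _ 2)// ?ler_pdivlMr//; lra.
by rewrite /Phi1 /Phi2 z1_gt// z2_gt// cut0 ?(ltW t1)// !(mulr0, mul0r, addr0) expr0n.
Qed.

End radial_test.

(** * Boxes, orthants and smooth approximations of their indicators *)

Section boxes.
Context {R : realType} {n : nat}.
Implicit Types (a b x : 'rV[R]_n).

Definition orthant a : set 'rV[R]_n := [set x | forall i, a ord0 i < x ord0 i].

Definition obox a b : set 'rV[R]_n :=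
  [set x | forall i, a ord0 i < x ord0 i < b ord0 i].

Definition cbox a b : set 'rV[R]_n :=
  [set x | forall i, a ord0 i <= x ord0 i <= b ord0 i].

Lemma measurable_orthant a : measurable (orthant a).
Proof.
rewrite (_ : orthant a = \bigcap_(i in [set: 'I_n])
    [set x | x ord0 i \in `]a ord0 i, +oo[]); last first.
  by apply/seteqP; split=> [x xa i _|x xa i]; have := xa i; rewrite /= in_itv/= andbT//; exact.
apply: fin_bigcap_measurable => // i _.
rewrite -[X in measurable X]setTI.
exact: (measurable_coor i measurableT (measurable_itv `]a ord0 i, +oo[)).
Qed.

Lemma measurable_obox a b : measurable (obox a b).
Proof.
rewrite (_ : obox a b = \bigcap_(i in [set: 'I_n])
    [set x | x ord0 i \in `]a ord0 i, b ord0 i[]); last first.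
  by apply/seteqP; split=> [x xa i _|x xa i]; have := xa i; rewrite /= in_itv//=; exact.
apply: fin_bigcap_measurable => // i _.
rewrite -[X in measurable X]setTI.
exact: (measurable_coor i measurableT (measurable_itv `]a ord0 i, b ord0 i[)).
Qed.

Lemma closed_cbox a b : closed (cbox a b).
Proof.
rewrite (_ : cbox a b = \bigcap_(i in [set: 'I_n])
    ((fun x : 'rV[R]_n => x ord0 i) @^-1` `[a ord0 i, b ord0 i])); last first.
  by apply/seteqP; split=> [x xa i _|x xa i]; have := xa i; rewrite /= in_itv//=; exact.
apply: closed_bigI => i _; apply: preimage_closed; last exact: interval_closed.
by move=> x _; exact: coord_continuous.
Qed.

Lemma compact_cbox a b : compact (cbox a b).
Proof.
have := @rV_compact R n (fun i => `[a ord0 i, b ord0 i]%classic)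
  (fun i => @segment_compact R _ _).
by congr compact; apply/seteqP; split=> x xM i; have := xM i; rewrite /= in_itv.
Qed.

Lemma obox_bounded a b : exists2 M : R, 0 <= M &
  forall x, obox a b x -> forall i, `|x ord0 i| <= M.
Proof.
exists (\sum_i (`|a ord0 i| + `|b ord0 i|)).
  by apply: sumr_ge0 => i _; rewrite addr_ge0.
move=> x xab i; rewrite (bigD1 i)//= -[leLHS]addr0 lerD//; last first.
  by apply: sumr_ge0 => j _; rewrite addr_ge0.
have /andP[/ltW ax /ltW xb] := xab i.
rewrite ler_norml (le_trans xb) ?andbT; last first.
  by rewrite (le_trans (ler_norm _))// lerDr.
rewrite (le_trans _ ax)// lerNl -normrN (le_trans (ler_norm _))// ?normrN ?lerDl//.
Qed.

(** The coordinate half-spaces generate the product sigma-algebra, and each of them is a countable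
    union of orthants. *)
Lemma measurable_orthants :
  (@measurable _ 'rV[R]_n) `<=` <<s range orthant >>.
Proof.
pose S := g_sigma_algebraType (range orthant).
suff /(_ _) h : measurable_fun [set: S] (fun x : S => x : 'rV[R]_n).
  by move=> A mA; have := h measurableT A mA; rewrite setTI preimage_id.
apply: measurable_fun_coorP => i.
apply: (measurability _ (RGenOInfty.measurableE R)) => _ [_ [c ->] <-].
rewrite setTI.
(* Coordinate [i] has the bound [c]; the others exceed [- k], a constraint that the union over k
   removes. *)
pose a (k : nat) : 'rV[R]_n := \row_j (if j == i then c else - k%:R).
rewrite (_ : _ @^-1` _ = \bigcup_k orthant (a k)); last first.
  apply/seteqP; split=> x /=; rewrite in_itv/= andbT.
    move=> cx; exists (Num.truncn (\sum_j `|x ord0 j|)).+1 => // j.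
    rewrite mxE; case: eqP => [->//|_]; rewrite ltrNl.
    apply: le_lt_trans (truncnS_gt _); rewrite (le_trans (ler_norm _))// normrN.
    by rewrite (bigD1 j)//= lerDl sumr_ge0.
  by move=> [k _ /(_ i)]; rewrite mxE eqxx.
by apply: bigcup_measurable => k _; apply: sub_sigma_algebra; exists (a k).
Qed.

(** Dynkin's theorem: orthants are stable under intersection, and the sets over which [h], extended
    by zero off [Q], has integral zero form a Dynkin class; [hQ] supplies the whole space. *)
Lemma integral_orthants_ae_eq0 (Q : set 'rV[R]_n) (h : 'rV[R]_n -> R) :
  measurable Q -> (lebesgue_rV n).-integrable Q (EFin \o h) ->
  (\int[lebesgue_rV n]_(x in Q) (h x)%:E = 0)%E ->
  (forall a, \int[lebesgue_rV n]_(x in Q `&` orthant a) (h x)%:E = 0)%E ->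
  ae_eq (lebesgue_rV n) Q (EFin \o h) (cst 0%E).
Proof.
move=> mQ ih hQ ho.
pose g := (EFin \o h) \_ Q.
have ig : (lebesgue_rV n).-integrable setT g by exact: (integrable_mkcond _ mQ).1.
have gE A : (\int[lebesgue_rV n]_(x in A) g x = \int[lebesgue_rV n]_(x in Q `&` A) (h x)%:E)%E.
  by rewrite setIC; exact/esym/integral_mkcondr.
suff H A : measurable A -> (\int[lebesgue_rV n]_(x in A) g x = 0)%E.
  apply: integral_ae_eq => // E EQ mE; rewrite integral0.
  by rewrite -(setIidr EQ) -gE; exact: H.
move=> mA; have := measurable_orthants mA; rewrite -setI_closed_g_dynkin_g_sigma_algebra; last first.
  move=> _ _ [a _ <-] [b _ <-]; exists (\row_i Num.max (a ord0 i) (b ord0 i)) => //.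
  apply/seteqP; split=> [x xm|x [xa xb] i]; last by rewrite mxE gt_max xa xb.
  by split=> i; have := xm i; rewrite mxE gt_max => /andP[].
suff /(_ A) : <<d range orthant >> `<=`
    [set A | measurable A /\ (\int[lebesgue_rV n]_(x in A) g x = 0)%E].
  by move=> /[apply] -[].
apply: smallest_sub; last first.
  by move=> _ [a _ <-]; split; [exact: measurable_orthant|rewrite gE].
split.
- by split=> //; rewrite gE setIT.
- move=> B [mB B0]; split; first exact: measurableC.
  have mB' := measurableC mB.
  have := @integral_setU _ _ _ (lebesgue_rV n) B (~` B) g mB mB'.
  rewrite setUv B0 add0e (gE setT) setIT hQ => <-//; first exact: measurable_int ig.
  by apply/disj_setPS; rewrite setICr.
- move=> F tF mF; split; first by apply: bigcup_measurable => k _; case: (mF k).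
  rewrite integral_bigcup//; last 2 first.
    by move=> k; case: (mF k).
    apply: integrableS ig => //; apply: bigcup_measurable => k _; by case: (mF k).
  by rewrite eseries0// => k _ _; case: (mF k).
Qed.


Lemma cvg_prodr (F : set_system nat) {FF : Filter F} (I : Type) (r : seq I)
    (f : I -> nat -> R) (l : I -> R) :
  (forall i, f i k @[k --> F] --> l i) ->
  \prod_(i <- r) f i k @[k --> F] --> \prod_(i <- r) l i.
Proof.
move=> fl; elim: r => [|i r IH].
  by rewrite big_nil; under eq_cvg do rewrite big_nil; exact: cvg_cst.
by rewrite big_cons; under eq_cvg do rewrite big_cons; exact: cvgM.
Qed.

Lemma bexp_le1 (t : R) : bexp t <= 1.
Proof.
case: (ltP 0 t) => t0; last by rewrite bexp_eq0.
by rewrite /bexp t0 -expR0 ler_expR oppr_le0 invr_ge0 ltW.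
Qed.

Lemma cvg_bexp (t : R) : bexp (k%:R * t) @[k --> \oo] --> ((0 < t)%R%:R : R).
Proof.
case: (ltP 0 t) => t0; last first.
  rewrite (_ : (fun k : nat => _) = fun=> 0) ?mulr0n; first exact: cvg_cst.
  by apply/funext => k; rewrite bexp_eq0// mulr_ge0_le0.
rewrite mulr1n.
have c : expR (- (t^-1 * k.+1%:R^-1)) @[k --> \oo] -->
    expR (- (t^-1 * 0)).
  apply: (@cvg_comp _ _ _ _ expR); last exact: continuous_expR.
  apply: cvgN.
  by apply: cvgM; [exact: cvg_cst|exact: (@cvg_harmonic R)].
rewrite mulr0 oppr0 expR0 in c.
rewrite -cvg_shiftS /=; apply: cvg_trans c; apply: near_eq_cvg; near=> k.
by rewrite /bexp mulr_gt0// invfM mulrC.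
Unshelve. all: by end_near. Qed.

(** As k grows, [bexp (k t)] tends to the indicator of [t > 0]; on the open box the product thus
    tends to the indicator of the orthant, while its support stays in the fixed closed box. *)
Definition box_bump (a0 b0 a : 'rV[R]_n) (k : nat) (x : 'rV[R]_n) : R :=
  \prod_i (bexp (k%:R * (x ord0 i - a0 ord0 i)) *
    bexp (k%:R * (b0 ord0 i - x ord0 i)) * bexp (k%:R * (x ord0 i - a ord0 i))).

Lemma smooth_box_bump a0 b0 a k : smooth_rV (box_bump a0 b0 a k).
Proof.
have lin (c e : R) : smooth (fun s : R => bexp (c * s + e)).
  exact: (smooth_comp smooth_bexp (smooth_affine c e)).
apply: smooth_rV_prod => i.
have s1 c e : smooth_rV (fun x : 'rV[R]_n => bexp (c * x ord0 i + e)).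
  exact: (smooth_rV_comp (lin c e) (smooth_rV_coor i)).
apply: smooth_rVM; first apply: smooth_rVM.
- have := s1 k%:R (- (k%:R * a0 ord0 i)).
  by congr smooth_rV; apply/funext => x; rewrite mulrBr.
- have := s1 (- k%:R) (k%:R * b0 ord0 i).
  by congr smooth_rV; apply/funext => x; rewrite mulrBr mulNr addrC.
- have := s1 k%:R (- (k%:R * a ord0 i)).
  by congr smooth_rV; apply/funext => x; rewrite mulrBr.
Qed.

Lemma box_bump_ge0 a0 b0 a k x : 0 <= box_bump a0 b0 a k x.
Proof. by apply: prodr_ge0 => i _; rewrite !mulr_ge0 ?bexp_ge0. Qed.

Lemma box_bump_le1 a0 b0 a k x : box_bump a0 b0 a k x <= 1.
Proof.
apply: prodr_ile1 => i _; rewrite !mulr_ge0 ?bexp_ge0//=.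
by rewrite mulr_ile1 ?mulr_ge0 ?mulr_ile1 ?bexp_ge0 ?bexp_le1.
Qed.

Lemma box_bump_eq0 a0 b0 a k x : ~ obox a0 b0 x -> box_bump a0 b0 a k x = 0.
Proof.
move=> /existsNP[i /negP]; rewrite negb_and -!leNgt => ix.
rewrite /box_bump (bigD1 i)//=; case/orP: ix => ix.
  by rewrite (@bexp_eq0 _ (k%:R * (x ord0 i - _))) ?mul0r// mulr_ge0_le0// subr_le0.
by rewrite (@bexp_eq0 _ (k%:R * (b0 ord0 i - _))) ?(mulr0, mul0r)// mulr_ge0_le0// subr_le0.
Qed.

Lemma cvg_box_bump a0 b0 a x : obox a0 b0 x ->
  box_bump a0 b0 a k x @[k --> \oo] --> (\1_(orthant a) x : R).
Proof.
move=> xab; rewrite (_ : \1_(orthant a) x = \prod_i (1 * 1 * (a ord0 i < x ord0 i)%R%:R)).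
  apply: cvg_prodr => i; apply: cvgM; first apply: cvgM.
  - have := @cvg_bexp (x ord0 i - a0 ord0 i).
    by rewrite subr_gt0; case/andP: (xab i) => -> _.
  - have := @cvg_bexp (b0 ord0 i - x ord0 i).
    by rewrite subr_gt0; case/andP: (xab i) => _ ->.
  - by have := @cvg_bexp (x ord0 i - a ord0 i); rewrite subr_gt0.
rewrite indicE; have [xa|xa] := pselect (orthant a x).
  by rewrite mem_set// big1// => i _; rewrite xa !mulr1.
have [i /negP/negbTE ai] : exists i, ~ (a ord0 i < x ord0 i) by exact/existsNP.
by rewrite memNset// (bigD1 i)//= ai !(mulr0, mul0r).
Qed.

End boxes.

(** * The fundamental lemma of the calculus of variations *)

Section uniqueness.
Context {R : realType} {n : nat} (O : set 'rV[R]_n).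
Hypothesis oO : open O.
Implicit Types f g h psi : 'rV[R]_n -> R.

Local Notation mu := (@lebesgue_rV R n).

Let mO : measurable O. Proof. exact: measurable_openrV. Qed.

Lemma test_function_supp psi (F : set 'rV[R]_n) : smooth_rV psi ->
  compact F -> closed F -> F `<=` O -> (forall x, ~ F x -> psi x = 0) ->
  test_function O psi.
Proof.
move=> spsi kF cF FO psi0.
have sF : closure [set x | psi x != 0] `<=` F.
  rewrite [X in _ `<=` X](closure_id F).1//; apply: closure_subset => x /=.
  by move=> /eqP px; apply: contrapT => /psi0.
split; [by move=> k; exact: smooth_rV_Ck| |exact: subset_trans FO].
apply: subclosed_compact kF sF; exact: closed_closure.
Qed.

Lemma L2_mul_integrable g h : L2 O g -> L2 O h -> mu.-integrable O (fun x => (g x * h x)%:E).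
Proof.
move=> [mg ig] [mh ih].
have igh := integrableD mO ig ih.
apply: le_integrable igh => //.
  by apply/measurable_EFinP; exact: measurable_funM.
move=> x Ox; rewrite /= lee_fin normrM [leRHS]ger0_norm ?addr_ge0 ?sqr_ge0//.
rewrite -(real_normK (num_real (g x))) -(real_normK (num_real (h x))).
have := sqr_ge0 (`|g x| - `|h x|); have := normr_ge0 (g x); have := normr_ge0 (h x).
nra.
Qed.

Lemma L2B g h : L2 O g -> L2 O h -> L2 O (fun x => g x - h x).
Proof.
move=> Lg Lh; have [mg ig] := Lg; have [mh ih] := Lh.
split; first exact: measurable_funB.
have i2 := integrableD mO (integrableD mO ig ih) (integrableD mO ig ih).
apply: le_integrable i2 => //.
  by apply/measurable_EFinP; apply: measurable_funX; exact: measurable_funB.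
move=> x Ox; rewrite /= lee_fin ger0_norm ?sqr_ge0// ger0_norm ?addr_ge0 ?sqr_ge0//.
by have := sqr_ge0 (g x + h x); lra.
Qed.

Lemma Cc_L2 f : Cc f -> L2 O f.
Proof.
move=> cf; split.
  by apply: measurable_funTS; apply: continuous_measurable_rV; case: cf.
apply: (@integrableS _ _ _ mu setT) => //.
by apply: (@Cc_integrable _ _ (fun x => f x ^+ 2)); apply: CcMl => //; case: cf.
Qed.

(** On a box whose closure lies in [O], testing against [box_bump] and passing to the limit by
    dominated convergence annihilates the integrals over all orthants, so [h] is zero almost
    everywhere in the box; countably many such boxes cover [O]. *)
Lemma L2_null h : L2 O h ->
  (forall psi, smooth_rV psi -> test_function O psi -> \int[mu]_(x in O) (h x * psi x) = 0) ->
  ae_eq mu O (EFin \o h) (cst 0%E).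
Proof.
move=> Lh h0; have [mh ih] := Lh.
have main a0 b0 : cbox a0 b0 `<=` O -> ae_eq mu (obox a0 b0) (EFin \o h) (cst 0%E).
  move=> QO; set Q := obox a0 b0.
  have [M M0 QM] := obox_bounded a0 b0.
  have QO' : Q `<=` O.
    move=> x Qx; apply: QO => i; have /andP[? ?] := Qx i.
    by apply/andP; split; exact: ltW.
  have mQ : measurable Q := measurable_obox a0 b0.
  have mhQ : measurable_fun Q h by exact: measurable_funS mh.
  have ihQ : mu.-integrable Q (EFin \o h).
    have i1 : mu.-integrable Q (EFin \o cst (1 : R)).
      apply: measurable_bounded_integrable => //.
        apply: le_lt_trans (lebesgue_rV_box n M).
        by apply: le_measure; rewrite ?inE//; exact: measurable_rV_box.
      by exists 1; split=> // t t1 x _; rewrite /= normr1 ltW.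
    have i2 := integrableD mQ i1 (integrableS mO mQ QO' ih).
    apply: le_integrable i2 => //; first exact/measurable_EFinP.
    move=> x Qx; rewrite /= lee_fin [leRHS]ger0_norm ?addr_ge0 ?sqr_ge0//.
    have := sqr_ge0 (`|h x| - 1); rewrite -(real_normK (num_real (h x))).
    have := normr_ge0 (h x); nra.
  have bump0 a k : (\int[mu]_(x in Q) (h x * box_bump a0 b0 a k x)%:E = 0)%E.
    pose psi := box_bump a0 b0 a k.
    have tpsi : test_function O psi.
      apply: (@test_function_supp _ (cbox a0 b0)) => //.
      - exact: smooth_box_bump.
      - exact: compact_cbox.
      - exact: closed_cbox.
      - move=> x nx; apply: box_bump_eq0; apply: contra_not nx => Qx i.
        by have /andP[? ?] := Qx i; apply/andP; split; exact: ltW.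
    have Cpsi : Cc psi.
      split; first exact/smooth_rV_continuous/smooth_box_bump.
      exists (1 + \sum_(i < n) M ^+ 2) => x Mx; apply: box_bump_eq0 => Qx.
      suff : sqn x <= \sum_(i < n) M ^+ 2 by lra.
      apply: ler_sum => i _; rewrite -real_normK ?num_real// lerXn2r ?nnegrE//.
      exact: QM.
    have i3 := L2_mul_integrable Lh (Cc_L2 Cpsi).
    have hO : (\int[mu]_(x in O) (h x * psi x)%:E = 0)%E.
      rewrite -[LHS]fineK; last exact: integrable_fin_num i3.
      by congr EFin; apply: h0 => //; exact: smooth_box_bump.
    apply: etrans hO.
    rewrite integral_mkcond [RHS]integral_mkcond; congr (integral _ _ _); apply/funext => x.
    rewrite !patchE; case: ifPn => Qx; first by rewrite mem_set//; apply: QO'; rewrite inE in Qx.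
    by case: ifPn => // _; rewrite /psi box_bump_eq0 ?mulr0//; move: Qx; rewrite notin_setE.
  have lim a : (\int[mu]_(x in Q `&` orthant a) (h x)%:E = 0)%E.
    have mf k : measurable_fun Q (fun x => (h x * box_bump a0 b0 a k x)%:E).
      apply/measurable_EFinP; apply: measurable_funM => //.
      apply: measurable_funTS; apply: continuous_measurable_rV.
      exact/smooth_rV_continuous/smooth_box_bump.
    have mg : measurable_fun Q (fun x => (h x * \1_(orthant a) x)%:E).
      apply/measurable_EFinP; apply: measurable_funM => //.
      apply: measurable_funTS; apply: measurable_indic; exact: measurable_orthant.
    have [||_ _] := @dominated_convergence _ _ _ mu Q mQ _ _ (EFin \o (fun x => `|h x|)) mf mg _ (integrable_norm ihQ).
      apply: aeW => x Qx; apply: cvg_EFin; first exact: nearW.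
      by apply: cvgM; [exact: cvg_cst|exact: cvg_box_bump].
      apply: aeW => x k Qx; rewrite /= lee_fin normrM (ger0_norm (box_bump_ge0 _ _ _ _ _)).
      apply: ler_piMr => //; exact: box_bump_le1.
    move=> c; have : (0%E : \bar R) @[k --> \oo] -->
        (\int[mu]_(x in Q) (h x * \1_(orthant a) x)%:E)%E.
      by apply: cvg_trans c; apply: near_eq_cvg; apply: nearW => k /=; rewrite bump0.
    move=> /cvg_lim e; have := e (@ereal_hausdorff _); rewrite lim_cst; last exact: ereal_hausdorff.
    move=> ->; rewrite integral_mkcondr; apply: eq_integral => x _.
    by rewrite patchE indicE; case: ifP; rewrite ?(mulr1, mulr0).
  (* The box lies in the orthant at its own corner [a0], which also gives the integral over the
     whole of [Q]. *)
  apply: integral_orthants_ae_eq0 => //; rewrite -[in LHS](setIT Q).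
  rewrite -(lim a0); congr (integral _ _ _).
  rewrite setIT; apply/seteqP; split=> [x Qx|x []//]; split => // i.
  by have /andP[] := Qx i.
(* Opposite corners of the rational cubes; enumerating them by [pickle] keeps the union of the
   exceptional sets negligible. *)
pose q0 (q : 'rV[rat]_n * nat) : 'rV[R]_n := \row_i (ratr (q.1 ord0 i) - q.2.+1%:R^-1).
pose q1 (q : 'rV[rat]_n * nat) : 'rV[R]_n := \row_i (ratr (q.1 ord0 i) + q.2.+1%:R^-1).
pose P q x := cbox (q0 q) (q1 q) `<=` O -> obox (q0 q) (q1 q) x -> h x = 0.
have aeP k : \forall x \ae mu, if unpickle k is Some q then P q x else True.
  case: unpickle => [q|]; last by apply: aeW.
  have [qO|qO] := pselect (cbox (q0 q) (q1 q) `<=` O); last by apply: aeW => x /qO.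
  have := main _ _ qO; apply: filterS => x + _ qx; by move=> /(_ qx) [].
have := ae_foralln aeP; apply: filterS => x Px Ox; congr EFin.
have [q [qx qO]] := open_rat_cube oO Ox.
have := Px (pickle q); rewrite pickleK; apply.
  move=> y qy; apply: qO => i; have := qy i; rewrite !mxE distrC ler_norml.
  by move=> /andP[h1 h2]; rewrite lerBrDl h1 lerBlDl h2.
move=> i; rewrite !mxE; have := qx i; rewrite distrC ltr_norml.
by move=> /andP[h1 h2]; rewrite -ltrBlDl h2 andbT -ltrBrDl.
Qed.

End uniqueness.

Lemma compact_sqn {R : realType} {n : nat} (K : set 'rV[R]_n) : compact K ->
  exists2 A : R, 1 <= A & forall x, K x -> sqn x < A.
Proof.
move=> /compact_bounded[M [_ HM]].
exists (1 + \sum_(i < n) (1 + `|M|) ^+ 2).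
  by rewrite lerDl sumr_ge0// => i _; rewrite sqr_ge0.
move=> x Kx; suff : sqn x <= \sum_(i < n) (1 + `|M|) ^+ 2 by lra.
apply: ler_sum => i _; rewrite -real_normK ?num_real// lerXn2r ?nnegrE ?addr_ge0//.
apply: le_trans (HM (1 + `|M|) _ x Kx); last first.
  by rewrite (le_lt_trans (ler_norm _))// ltrDr.
by rewrite [leRHS]/Num.norm/= mx_normrE; exact: (le_bigmax _ (fun j : 'I_1 * 'I_n => `|x j.1 j.2|) (ord0, i)).
Qed.

(** * Smooth test functions in the Sobolev spaces *)

Section weak_derivatives.
Context {R : realType} {n : nat} (O : set 'rV[R]_n).
Hypothesis oO : open O.
Implicit Types (f g psi phi : 'rV[R]_n -> R) (s : seq 'I_n).

Local Notation mu := (@lebesgue_rV R n).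

Let mO : measurable O. Proof. exact: measurable_openrV. Qed.

Lemma test_function_Cc psi s : test_function O psi -> Cc (pderiv s psi).
Proof.
move=> [Cpsi csupp _].
have bpsi : bounded_supp psi.
  have [A _ HA] := compact_sqn csupp; exists A => x Ax.
  apply: contrapT => /eqP px.
  have /HA : closure [set x | psi x != 0] x by exact: subset_closure.
  by rewrite ltNge Ax.
elim: s => [|i s IH]; first by split=> //; have [] := Cpsi 0 [::] isT.
have [cs ds] := Cpsi (size s).+2 s (leqW (leqnSn _)).
split; first by have [] := Cpsi (size s).+1 (i :: s) (leqnn _).
apply: (@Cc_derive _ _ (pderiv s psi) i); first by case: IH.
by move=> x; apply: derivableP; apply: ds; rewrite ltnS leqnSn.
Qed.

Lemma Rint_Int f : (forall x, ~ O x -> f x = 0) -> \int[mu]_(x in O) f x = Int f.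
Proof.
move=> f0; rewrite /Int Rintegral_mkcond; congr (Rintegral _ _ _).
apply/funext => x; rewrite patchE; case: ifPn => // /negP xO.
by rewrite f0// => Ox; apply: xO; rewrite inE.
Qed.

(** Derivatives are moved across one at a time, the outermost first, which reverses their order. For
    the lists [[:: i; i]] of the Laplacian the reversal is the identity. *)
Lemma Int_pderiv_parts f psi s : smooth_rV f -> test_function O psi ->
  Int (fun x => f x * pderiv s psi x) =
  (-1) ^+ size s * Int (fun x => pderiv (rev s) f x * psi x).
Proof.
move=> sf tpsi; elim: s => [|i s IH] in f sf *; first by rewrite mul1r.
have [Cpsi _ _] := tpsi.
rewrite [LHS](@Int_by_parts _ _ i f ('D_(delta_mx ord0 i) f) (pderiv s psi)).
- rewrite IH; last exact: smooth_rV_derive.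
  rewrite rev_cons /pderiv foldr_rcons /= exprS mulN1r mulNr.
  by congr (- (_ * Int _)).
- exact: smooth_rV_continuous.
- exact/smooth_rV_continuous/smooth_rV_derive.
- exact: test_function_Cc.
- by have [] := test_function_Cc (i :: s) tpsi.
- by move=> x; exact: smooth_rV_is_derive.
- move=> x; apply: derivableP.
  by have [_] := Cpsi (size s).+1 s (leqnSn _); exact.
Qed.

Lemma L2_weak_pderiv_unique s f g h : L2 O g -> L2 O h ->
  weak_pderiv O s f g -> weak_pderiv O s f h ->
  ae_eq mu O (EFin \o g) (EFin \o h).
Proof.
move=> Lg Lh wg wh.
suff h0 : forall psi, smooth_rV psi -> test_function O psi ->
    \int[mu]_(x in O) ((g x - h x) * psi x) = 0.
  have := L2_null oO (L2B oO Lg Lh) h0; apply: filterS => x + Ox => /(_ Ox) [].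
  by move=> /eqP; rewrite subr_eq0 => /eqP /= ->.
move=> psi _ tpsi; have Lpsi := Cc_L2 oO (test_function_Cc [::] tpsi).
under eq_Rintegral do rewrite mulrBl.
rewrite RintegralB//; [|exact: L2_mul_integrable..].
apply/eqP; rewrite subr_eq0; apply/eqP.
apply: (@mulfI _ ((-1) ^+ size s)); first by rewrite signr_eq0.
by rewrite -wg// -wh.
Qed.

(** [wderiv] is an arbitrary choice among the weak derivatives, so uniqueness almost everywhere is
    what ties it to a given one. *)
Lemma wderiv_ae s f g : L2 O g -> weak_pderiv O s f g ->
  L2 O (wderiv O s f) /\ ae_eq mu O (EFin \o wderiv O s f) (EFin \o g).
Proof.
move=> Lg wg; have [Lw ww] : [set g | L2 O g /\ weak_pderiv O s f g] (wderiv O s f).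
  by apply: (@xgetPex _ (fun=> 0)); exists g.
by split=> //; exact: L2_weak_pderiv_unique ww wg.
Qed.

Section smooth_compact.
Variable phi : 'rV[R]_n -> R.
Hypothesis sphi : smooth_rV phi.
Hypothesis tphi : test_function O phi.

Let phi0 x : ~ O x -> phi x = 0.
Proof.
have [_ _ suppO] := tphi; move=> nO; apply: contrapT => /eqP px.
by apply: nO; apply: suppO; exact: subset_closure.
Qed.

Lemma smooth_weak_pderiv s : weak_pderiv O s phi (pderiv (rev s) phi).
Proof.
move=> psi tpsi; rewrite !Rint_Int ?Int_pderiv_parts//.
  move=> x nO; have [_ _ suppO] := tpsi.
  suff -> : psi x = 0 by rewrite mulr0.
  by apply: contrapT => /eqP px; apply: nO; apply: suppO; exact: subset_closure.
by move=> x /phi0 ->; rewrite mul0r.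
Qed.

Let L2_pderiv s : L2 O (pderiv s phi).
Proof. by apply: Cc_L2 => //; exact: test_function_Cc. Qed.

Lemma smooth_sobolevH k : sobolevH O k phi.
Proof.
split; first exact: (L2_pderiv [::]).
by move=> s _; exists (pderiv (rev s) phi) => //; exact: smooth_weak_pderiv.
Qed.

(** [phi] approximates itself. What remains is the norm of the zero function, whose chosen weak
    derivatives vanish only almost everywhere. *)
Lemma smooth_sobolevH10 : sobolevH10 O phi.
Proof.
split; first exact: smooth_sobolevH.
move=> e e0; exists phi => //.
have z0 : (phi \- phi)%R = fun=> 0 by apply/funext => x /=; rewrite subrr.
have L0 : L2 O (fun=> 0).
  by apply: Cc_L2 => //; split; [exact: cont_cst|exists 0].
rewrite z0 /H1_sqnorm integral0_eq; last by move=> x _; rewrite expr0n.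
rewrite big1 ?add0e ?lte_fin// => i _.
have [[mw _] w0] : L2 O (wderiv O [:: i] (fun=> 0)) /\
    ae_eq mu O (EFin \o wderiv O [:: i] (fun=> 0)) (EFin \o fun=> 0).
  apply: wderiv_ae => // psi _; rewrite /Rintegral !integral0_eq ?mulr0//.
    by move=> x _; rewrite mul0r.
  by move=> x _; rewrite mul0r.
rewrite (@ae_eq_integral _ _ _ mu O (cst 0%E))// ?integral0//.
  by apply/measurable_EFinP; exact: measurable_funX.
by apply: filterS w0 => x + Ox => /(_ Ox) [] ->; rewrite expr0n.
Qed.

Lemma wlaplacian_ae :
  ae_eq mu O (fun x => (`|wlaplacian O phi x| ^+ 2)%:E) (fun x => (laplacian phi x ^+ 2)%:E).
Proof.
have h (i : 'I_n) : ae_eq mu O (EFin \o wderiv O [:: i; i] phi) (EFin \o pderiv [:: i; i] phi).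
  have [_] := @wderiv_ae [:: i; i] phi _ (L2_pderiv _) (@smooth_weak_pderiv [:: i; i]).
  exact.
have : \forall x \ae mu, forall i : 'I_n, O x -> wderiv O [:: i; i] phi x = pderiv [:: i; i] phi x.
  apply: filter_forall => i; apply: filterS (h i) => x + Ox => /(_ Ox) [].
  exact.
apply: filterS => x hx Ox; congr EFin; rewrite real_normK ?num_real//; congr (_ ^+ 2).
by apply: eq_bigr => i _; rewrite hx.
Qed.

Lemma stable_on_smooth u : continuous u -> stable_on O u ->
  Int (fun x => expR (u x) * phi x ^+ 2) <= Int (fun x => laplacian phi x ^+ 2).
Proof.
move=> cu su; have Cphi : Cc phi := test_function_Cc [::] tphi.
have Clap : Cc (laplacian phi).
  by apply: Cc_sum => i; exact: (test_function_Cc [:: i; i] tphi).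
have C1 : Cc (fun x => expR (u x) * phi x ^+ 2).
  apply: CcMl; first by apply: cont_comp => //; exact: continuous_expR.
  by apply: CcMl => //; case: Cphi.
have C2 : Cc (fun x => laplacian phi x ^+ 2) by apply: CcMl => //; case: Clap.
rewrite -lee_fin !EFin_Int//.
have := su phi (@smooth_sobolevH 2) smooth_sobolevH10.
have mlap : measurable_fun setT (fun x : 'rV[R]_n => (laplacian phi x ^+ 2)%:E).
  by apply/measurable_EFinP; apply: continuous_measurable_rV; case: C2.
rewrite (@ae_eq_integral _ _ _ mu O (fun x => (laplacian phi x ^+ 2)%:E) _ mO _ _ wlaplacian_ae); last 2 first.
- apply/measurable_EFinP; apply: measurable_funX; apply: measurableT_comp => //.
  apply: measurable_sum => i.
  by have [[]] := @wderiv_ae [:: i; i] phi _ (L2_pderiv _) (@smooth_weak_pderiv [:: i; i]).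
- exact: measurable_funTS.
(* On the left [phi] vanishes outside [O]; on the right the domain of a nonnegative integrand is
   enlarged to the whole space. *)
move=> le1; apply: le_trans (le_trans le1 _).
  rewrite [leRHS]integral_mkcond le_eqVlt; apply/orP; left; apply/eqP.
  apply: eq_integral => x _; rewrite patchE; case: ifPn => // /negP xO.
  by rewrite phi0 ?expr0n ?mulr0// => Ox; apply: xO; rewrite inE.
apply: ge0_subset_integral => // x _; by rewrite lee_fin sqr_ge0.
Qed.

End smooth_compact.
End weak_derivatives.

(** * Assembling the test functions, the decay of v and the contradiction *)

Lemma Ck_C2of {R : realType} {n : nat} (u : 'rV[R]_n -> R) s : Ck (size s).+2 u ->
  C2of (pderiv s u) (fun i => pderiv (i :: s) u) (fun i => pderiv [:: i, i & s] u).
Proof.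
move=> Cu; have c s' : (size s' <= (size s).+2)%N -> continuous (pderiv s' u).
  by move=> ss; have [] := Cu s' ss.
have d s' i x : (size s' < (size s).+2)%N ->
    is_derive x (delta_mx ord0 i) (pderiv s' u) (pderiv (i :: s') u x).
  by move=> ss; apply: derivableP; have [_] := Cu s' (ltnW ss); exact.
by split; [apply: c; rewrite ltnW|move=> i; exact: c|move=> i; exact: c|move=> i x; apply: d|move=> i x; apply: d].
Qed.

Lemma C2of_sum {R : realType} {n : nat} (I : finType) (f : I -> 'rV[R]_n -> R) df d2f :
  (forall j, C2of (f j) (df j) (d2f j)) ->
  C2of (fun x => \sum_j f j x) (fun i x => \sum_j df j i x)
    (fun i x => \sum_j d2f j i x).
Proof.
move=> Cf; have is_deriveS (g dg : I -> 'rV[R]_n -> R) v x :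
    (forall j, is_derive x v (g j) (dg j x)) ->
    is_derive x v (fun y => \sum_j g j y) (\sum_j dg j x).
  move=> gj; elim: (index_enum I) => [|j r IH].
    by under eq_fun do rewrite big_nil; rewrite big_nil; exact: is_derive_cst.
  by under eq_fun do rewrite big_cons; rewrite big_cons; exact: is_deriveD_fun.
split=> [|i|i|i x|i x].
- by apply: cont_sum => j; have [] := Cf j.
- by apply: cont_sum => j; have [_ ? _ _ _] := Cf j.
- by apply: cont_sum => j; have [_ _ ? _ _] := Cf j.
- by apply: (is_deriveS f (fun j => df j i)) => j; have [_ _ _ + _] := Cf j; exact.
- by apply: (is_deriveS (fun j => df j i) (fun j => d2f j i)) => j; have [_ _ _ _] := Cf j; exact.
Qed.

(** The closed annulus [A <= |x|^2 <= B] is compact, lies in [O] and contains the support. *)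
Lemma test_function_annulus {R : realType} {n : nat} (O : set 'rV[R]_n) (phi : 'rV[R]_n -> R)
    (A B : R) : smooth_rV phi ->
  (forall x, A <= sqn x -> O x) ->
  (forall x, sqn x <= A -> phi x = 0) -> (forall x, B <= sqn x -> phi x = 0) ->
  test_function O phi.
Proof.
move=> sphi AO phiA phiB.
pose F : set 'rV[R]_n := @sqn R n @^-1` `[A, B].
have cF : closed F.
  apply: preimage_closed; last exact: interval_closed.
  by move=> x _; exact: continuous_sqn.
apply: (@test_function_supp _ _ _ _ F) => //.
- apply: (subclosed_compact cF (@compact_rV_box R n (1 + `|B|))) => x.
  rewrite /F /= in_itv/= => /andP[_ xB] i.
  rewrite -ler_sqr ?nnegrE ?addr_ge0// real_normK ?num_real//.
  rewrite (le_trans (coor_sqn x i))// (le_trans xB)// (le_trans (ler_norm _))//.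
  have := normr_ge0 B; nra.
- by move=> x; rewrite /F /= in_itv/= => /andP[? _]; exact: AO.
- move=> x; rewrite /F /= in_itv/= => /negP; rewrite negb_and -!ltNge.
  by move=> /orP[] /ltW; [exact: phiA|exact: phiB].
Qed.

Theorem theorem1p7 (R : realType) (N : nat) (u : 'rV[R]_N -> R) :
  (5 <= N <= 12)%N ->
  Ck 4 u ->
  (forall x, laplacian (laplacian u) x = expR (u x)) ->
  let v := fun x => - laplacian u x in
  sphere_avg v r @[r --> +oo] --> (0 : R) ->
  ~ exists K : set 'rV[R]_N, compact K /\ stable_on (~` K) u.
Proof.
move=> N5 Cu eu v v0 [K [cK sK]].
have /andP[N5l _] := N5.
have Cu2 : C2of u (fun i => pderiv [:: i] u) (fun i => pderiv [:: i; i] u).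
  apply: (@Ck_C2of _ _ u [::]) => s s2; have [c d] := Cu s (@leq_trans 2 _ 4 s2 isT).
  by split=> // s1; apply: d; exact: (@leq_trans 2 _ 4 s1 isT).
have Cw := C2of_sum (fun j => @Ck_C2of _ _ u [:: j; j] Cu).
have [cu _ _ _ _] := Cu2; have [cw _ _ _ _] := Cw.
have oO : open (~` K) by apply: closed_openC; exact: compact_closed.
have [A0 A01 KA] := compact_sqn cK.
have [C C0 tests] := @radial_test_function R N A0 N5l A01.
(* With [A = 2 * A0] the threshold [2 * A] of [rellich_test] is the [4 * A0] from which the test
   functions are controlled. *)
apply: (@no_rellich_solution R N N5 u _ _ _ _ (2 * A0) C Cu2 Cw) => //.
- by move=> x; rewrite -eu -[X in laplacian X]/(fun x => \sum_j pderiv [:: j; j] u x) (C2of_laplacian Cw).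
- lra.
- move=> l l1 Al; have [|phi [sphi phiA phiB [t1 t2 t3 t4 t5]]] := tests l l1.
    by rewrite (le_trans _ Al)//; lra.
  have tphi : test_function (~` K) phi.
    by apply: (test_function_annulus sphi _ phiA phiB) => x Ax /KA; rewrite ltNge Ax.
  have Cphi : Cc phi := test_function_Cc [::] tphi.
  have Clap : Cc (laplacian phi).
    by apply: Cc_sum => i; exact: (test_function_Cc [:: i; i] tphi).
  have A4 : 2 * (2 * A0) = 4 * A0 by lra.
  exists (fun x => phi x ^+ 2), (fun x => laplacian phi x ^+ 2); rewrite /rellich_test A4.
  split; split; try assumption.
  + by apply: (@CcMl _ _ phi phi Cphi.1 Cphi).
  + by apply: (@CcMl _ _ (laplacian phi) (laplacian phi) Clap.1 Clap).
  + by move=> x; exact: sqr_ge0.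
  + exact: (stable_on_smooth oO sphi tphi cu sK).
(* The Laplacian is [- v], so the upper bound on the moments of [v] is the lower bound required
   here. *)
- move=> e e0; have cv : continuous v by exact: contN.
  have [|L HL] := ball_moment_le _ cv v0 e0; first exact: leq_trans N5l.
  exists (Num.max 1 L) => l; rewrite ge_max => /andP[l1 Ll].
  have l0 : 0 < l by exact: lt_le_trans l1.
  have -> : ball_moment 3 (fun x => \sum_i pderiv [:: i; i] u x) l = - ball_moment 3 v l.
    rewrite /ball_moment -IntN; last first.
      by apply: CcMl => //; exact: Cc_bump.
    by congr Int; apply/funext => x; rewrite /v mulNr opprK.
  by rewrite mulrN lerN2 ler_pdivrMl ?exprn_gt0// mulrC HL.
Qed.
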